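(* Let $p>2$. For $\lambda>0$ consider the equation $$(P_\lambda)\qquad -\Delta u-\frac{1}{\lambda^2}[x_1\partial_{x_2}-x_2\partial_{x_1}]^2u+u=|u|^{p-2}u\ \text{ on }\mathbb{R}^2,\qquad u(x)\to 0\ \text{ as }|x|\to\infty .$$ (i) If $u\in H$ is a nontrivial weak solution of $(P_\lambda)$ for some $\lambda>0$ satisfying $$\lambda<\Big(\frac{1}{(p-1)|u|_\infty^{p-2}}\Big)^{\frac12},$$ then $u$ is a radial function. (ii) For every $c>0$ there exists $\lambda_c>0$ with the property that every weak solution $u\in H$ of $(P_\lambda)$ for some $\lambda\in(0,\lambda_c)$ with $E_\lambda(u)\le c$ is radial.
   Context: All functions are real-valued. $|\cdot|_\infty$ denotes the norm of $L^\infty(\mathbb{R}^2)$. Write $\partial_\theta:=x_1\partial_{x_2}-x_2\partial_{x_1}$ (in the weak sense), and $$H:=\Big\{u\in H^1(\mathbb{R}^2):\ \int_{\mathbb{R}^2}|\partial_\theta u|^2\,dx<\infty\Big\},\qquad \langle u,v\rangle_\lambda:=\int_{\mathbb{R}^2}\Big(\nabla u\cdot\nabla v+\frac{1}{\lambda^2}(\partial_\theta u)(\partial_\theta v)+uv\Big)dx .$$ A weak solution of $(P_\lambda)$ is a function $u\in H$ with $\langle u,v\rangle_\lambda=\int_{\mathbb{R}^2}|u|^{p-2}uv\,dx$ for all $v\in H$. The energy functional is $$E_\lambda(u):=\frac12\int_{\mathbb{R}^2}\Big(|\nabla u|^2+\frac{1}{\lambda^2}|\partial_\theta u|^2+|u|^2\Big)dx-\frac1p\int_{\mathbb{R}^2}|u|^p\,dx,\qquad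 u\in H .$$ *)

(* Defs.v *)
From HB Require Import structures.
From mathcomp Require Import all_boot all_order all_algebra.
From mathcomp Require Import all_classical all_reals all_analysis.
Set Implicit Arguments.
Unset Strict Implicit.
Unset Printing Implicit Defensive.
Import Order.TTheory GRing.Theory Num.Theory.
Import numFieldNormedType.Exports.
Local Open Scope classical_set_scope.
Local Open Scope ring_scope.

(* Lebesgue measure on the (Borel) plane. Elements of L^2(R^2), H^1(R^2) and H
   are represented by Borel functions R * R -> R, identified up to a.e.
   equality. *)
Definition leb2 (R : realType) :
    {measure set (measurableTypeR R * measurableTypeR R) -> \bar R} :=
  (@lebesgue_measure R \x @lebesgue_measure R)%E.

Section plane.
Context {R : realType}.
Implicit Types (f u v g phi : R * R -> R) (e : R * R) (lam p : R).

Definition e1 : R * R := (1, 0).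
Definition e2 : R * R := (0, 1).

(* The library norm of R * R is the max norm, hence this definition. *)
Definition enorm (x : R * R) : R := Num.sqrt (x.1 ^+ 2 + x.2 ^+ 2).

Fixpoint Ck (k : nat) f : Prop :=
  if k is k'.+1 then
    forall e, e \in [:: e1; e2] ->
      (forall x, derivable f x e) /\ Ck k' ('D_e f)
  else continuous f.

Definition test_function phi : Prop :=
  (forall k, Ck k phi) /\ compact (closure [set x | phi x != 0]).

Definition locally_integrable2 f : Prop :=
  measurable_fun setT f /\
  forall K : set (R * R), compact K -> (leb2 R).-integrable K (EFin \o f).

Definition is_weak_partial e u g : Prop :=
  [/\ locally_integrable2 u, locally_integrable2 g &
    forall phi, test_function phi ->
      \int[leb2 R]_x (u x * 'D_e phi x) = - \int[leb2 R]_x (g x * phi x)].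

(* A chosen representative of the weak partial derivative, which is unique up
   to a.e. equality; the junk value is 0 when no weak derivative exists. *)
Definition weak_partial e u : R * R -> R :=
  xget (cst 0) [set g | is_weak_partial e u g].

Definition L2 : set (R * R -> R) := [set u | u \in Lfun (leb2 R) 2%:E].

Definition spaceH1 : set (R * R -> R) :=
  [set u | L2 u /\ forall e, e \in [:: e1; e2] ->
             exists2 g, is_weak_partial e u g & L2 g].

Definition dtheta u : R * R -> R :=
  fun x => x.1 * weak_partial e2 u x - x.2 * weak_partial e1 u x.

Definition spaceH : set (R * R -> R) := [set u | spaceH1 u /\ L2 (dtheta u)].

Definition grad_dot u v : R * R -> R :=
  fun x => weak_partial e1 u x * weak_partial e1 v x
         + weak_partial e2 u x * weak_partial e2 v x.

Definition innerH lam u v : R :=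
  \int[leb2 R]_x
    (grad_dot u v x + (lam ^+ 2)^-1 * (dtheta u x * dtheta v x) + u x * v x).

Definition weak_solution p lam u : Prop :=
  spaceH u /\
  forall v, spaceH v ->
    innerH lam u v = \int[leb2 R]_x (`|u x| `^ (p - 2) * u x * v x).

Definition energy p lam u : R :=
  2^-1 * (\int[leb2 R]_x
    (grad_dot u u x + (lam ^+ 2)^-1 * `|dtheta u x| ^+ 2 + `|u x| ^+ 2))
  - p^-1 * (\int[leb2 R]_x (`|u x| `^ p)).

Definition nontrivial u : Prop := ~ {ae leb2 R, forall x, u x = 0}.

Definition radial u : Prop :=
  exists f : R -> R, {ae leb2 R, forall x, u x = f (enorm x)}.

(* The L^oo norm, equal to +oo when u is not essentially bounded. *)
Definition Linfty_norm u : \bar R := ('N[leb2 R]_+oo[EFin \o u])%E.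

End plane.

(* Main.v *)
(* Let w = u o R - u, where R is the rotation by h = 2 pi / N. The equation is
   rotation invariant, so testing the equations of u and u o R with w gives
   <w, w>_lam = int (f(u o R) - f(u)) w with f(t) = |t|^(p-2) t. The orbit sums
   of w over the group generated by R vanish, so a discrete Wirtinger inequality
   gives |w|^2 <= C_N |dtheta w|^2 <= C_N lam^2 <w, w>_lam with C_N -> 1. In (i)
   f is Lipschitz on the range of u with constant (p-1)|u|_oo^(p-2), so w = 0 for
   N large. In (ii) the energy bounds the norm of u, hence all its even moments
   by Gagliardo's inequality int |u|^(2k+2) <= (k+1)^2 int |u|^k |d1 u| int
   |u|^k |d2 u|, and the right-hand side is at most C lam <w, w>_lam, so again
   w = 0. Invariance under all rotations by 2 pi / N with N large yields
   invariance under every rotation, and Fubini turns this into radiality. *)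
From HB Require Import structures.
From mathcomp Require Import all_boot all_order all_algebra.
From mathcomp Require Import all_classical all_reals all_analysis.
From mathcomp Require Import measurable_realfun ess_sup_inf.
From mathcomp Require Import ring lra.
Require Import Defs.
Set Implicit Arguments.
Unset Strict Implicit.
Unset Printing Implicit Defensive.
Import Order.TTheory GRing.Theory Num.Theory.
Import numFieldNormedType.Exports.
Local Open Scope classical_set_scope.
Local Open Scope ring_scope.

(** * Measure-preserving maps of the plane *)

(** Differentiating the equation along the angle would call for [dtheta u] as a test function, which
    is regularity that membership in H does not give. The finite increment w avoids this: rotations
    act on H, so w is admissible. The price is a Wirtinger constant that is only nearly 1; the
    strict inequality in (i) leaves room for the loss. Weak derivatives are given only through test
    functions, so the behaviour of u along curves has to be recovered. One abstract flow argument
    does this for rotations and for both families of translations: the increment of u along a flow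
    is, almost everywhere, the time integral of its weak derivative. For rotations this bounds the
    increment of w by h |dtheta w|, which turns the discrete inequality on orbits into the angular
    one. For translations it gives the fundamental theorem of calculus on almost every line parallel
    to an axis, the input to Gagliardo's inequality. In (ii) no sup bound on u is at hand, and a
    high moment of u, integrated against a fourth moment of w, takes its place. *)

Definition measure_preserving {d} {T : measurableType d} {R : realType}
    (mu : set T -> \bar R) (phi : T -> T) : Prop :=
  measurable_fun setT phi /\
  forall A, measurable A -> mu (phi @^-1` A) = mu A.

Section measure_preserving.
Context {d} {T : measurableType d} {R : realType}.
Variable mu : {measure set T -> \bar R}.
Implicit Types phi psi : T -> T.

Lemma measure_preserving_comp phi psi : measure_preserving mu phi ->
  measure_preserving mu psi -> measure_preserving mu (phi \o psi).
Proof.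
move=> [mphi phiE] [mpsi psiE]; split; first exact: measurableT_comp.
move=> A mA; rewrite comp_preimage psiE ?phiE//.
by rewrite -[X in measurable X]setTI; exact: mphi.
Qed.

Lemma ge0_integral_measure_preserving phi (f : T -> \bar R) :
  measure_preserving mu phi -> measurable_fun setT f -> (forall x, 0 <= f x)%E ->
  (\int[mu]_x f (phi x) = \int[mu]_x f x)%E.
Proof.
move=> [mphi phiE] mf f0.
transitivity (\int[pushforward mu phi]_x f x)%E.
  by rewrite ge0_integral_pushforward.
by apply: eq_measure_integral => A mA _; exact: phiE.
Qed.

Lemma integral_measure_preserving phi (f : T -> \bar R) :
  measure_preserving mu phi -> measurable_fun setT f ->
  (\int[mu]_x f (phi x) = \int[mu]_x f x)%E.
Proof.
move=> phiP mf; rewrite integralE [RHS]integralE; congr (_ - _)%E.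
- under eq_integral do rewrite (funepos_comp f).
  exact: (ge0_integral_measure_preserving phiP (measurable_funepos mf)).
- under eq_integral do rewrite (funeneg_comp f).
  exact: (ge0_integral_measure_preserving phiP (measurable_funeneg mf)).
Qed.

Lemma ae_measure_preserving phi (P : T -> Prop) : measure_preserving mu phi ->
  {ae mu, forall x, P x} -> {ae mu, forall x, P (phi x)}.
Proof.
move=> [mphi phiE] [A [mA A0 PA]]; exists (phi @^-1` A); split.
- by rewrite -[X in measurable X]setTI; exact: mphi.
- by rewrite phiE.
- by move=> x /= nP; exact: PA.
Qed.

End measure_preserving.

Section plane_isometries.
Context {R : realType}.
Let leb := @lebesgue_measure R.

(** Lebesgue measure is determined by its values on half-open intervals, and the preimage of such an
    interval under a translation has the same length. *)
Lemma measure_preserving_addr (a : R) :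
  measure_preserving leb (fun x : measurableTypeR R => x + a).
Proof.
have ma : measurable_fun setT
    ((fun x => x + a) : measurableTypeR R -> measurableTypeR R).
  exact: measurable_funD.
split=> // A mA; apply/esym.
pose phi : measurableTypeR R -> measurableTypeR R := fun x => x + a.
have := @lebesgue_measure_unique R (pushforward leb phi : {measure set _ -> \bar R}).
apply => //= _ [[b c]] _ <-.
rewrite /pushforward.
have -> : phi @^-1` `]b, c]%classic = `]b - a, c - a]%classic.
  by apply/seteqP; split=> x /=; rewrite !in_itv/= /phi ltrBlDr lerBrDr.
rewrite /leb !lebesgue_measure_itv/= !lte_fin ltrD2r -!EFinB.
by congr (if _ then _ else _); congr (_%:E); ring.
Qed.

(** On every horizontal line the shear is a translation, so Tonelli reduces the claim to
    [measure_preserving_addr]. *)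
Lemma measure_preserving_shear1 (h : R -> R) : measurable_fun setT h ->
  measure_preserving (leb2 R) (fun x => (x.1 + h x.2, x.2)).
Proof.
move=> mh; pose phi (x : measurableTypeR R * measurableTypeR R) :
  measurableTypeR R * measurableTypeR R := (x.1 + h x.2, x.2).
have mphi : measurable_fun setT phi.
  apply: measurable_fun_pair; first exact: measurable_funD measurable_fst (measurableT_comp mh measurable_snd).
  exact: measurable_snd.
split=> // A mA.
pose chi (z : measurableTypeR R * measurableTypeR R) : \bar R := (\1_A z)%:E.
have mchi : measurable_fun setT chi by exact/measurable_EFinP.
have chi0 z : (0 <= chi z)%E by rewrite lee_fin.
have mpreA : measurable (phi @^-1` A) by rewrite -[X in measurable X]setTI; exact: mphi.
transitivity (\int[leb2 R]_z chi (phi z))%E.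
  by rewrite -[in LHS](setIT (_ @^-1` _)) -integral_indic//; apply: eq_integral.
transitivity (\int[leb2 R]_z chi z)%E; last first.
  by rewrite -[in RHS](setIT A) -integral_indic.
have E1 := @fubini_tonelli2 _ _ _ _ R leb leb (chi \o phi) (measurableT_comp mchi mphi)
  (fun z => chi0 (phi z)).
have E2 := @fubini_tonelli2 _ _ _ _ R leb leb chi mchi chi0.
rewrite [LHS]E1 [RHS]E2; apply: eq_integral => y _; rewrite /fubini_G /=.
rewrite -[RHS](ge0_integral_measure_preserving (measure_preserving_addr (h y)))//.
exact: measurableT_comp.
Qed.

Lemma measure_preserving_shear2 (h : R -> R) : measurable_fun setT h ->
  measure_preserving (leb2 R) (fun x => (x.1, x.2 + h x.1)).
Proof.
move=> mh; pose phi (x : measurableTypeR R * measurableTypeR R) :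
  measurableTypeR R * measurableTypeR R := (x.1, x.2 + h x.1).
have mphi : measurable_fun setT phi.
  apply: measurable_fun_pair; first exact: measurable_fst.
  exact: measurable_funD measurable_snd (measurableT_comp mh measurable_fst).
split=> // A mA.
pose chi (z : measurableTypeR R * measurableTypeR R) : \bar R := (\1_A z)%:E.
have mchi : measurable_fun setT chi by exact/measurable_EFinP.
have chi0 z : (0 <= chi z)%E by rewrite lee_fin.
have mpreA : measurable (phi @^-1` A) by rewrite -[X in measurable X]setTI; exact: mphi.
transitivity (\int[leb2 R]_z chi (phi z))%E.
  by rewrite -[in LHS](setIT (_ @^-1` _)) -integral_indic//; apply: eq_integral.
transitivity (\int[leb2 R]_z chi z)%E; last first.
  by rewrite -[in RHS](setIT A) -integral_indic.
have E1 := @fubini_tonelli1 _ _ _ _ R leb leb (chi \o phi) (measurableT_comp mchi mphi)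
  (fun z => chi0 (phi z)).
have E2 := @fubini_tonelli1 _ _ _ _ R leb leb chi mchi chi0.
rewrite [LHS]E1 [RHS]E2; apply: eq_integral => y _; rewrite /fubini_F /=.
rewrite -[RHS](ge0_integral_measure_preserving (measure_preserving_addr (h y)))//.
exact: measurableT_comp.
Qed.

Definition translate1 (a : R) (x : R * R) : R * R := (x.1 + a, x.2).
Definition translate2 (a : R) (x : R * R) : R * R := (x.1, x.2 + a).
Definition rotate (c s : R) (x : R * R) : R * R :=
  (c * x.1 - s * x.2, s * x.1 + c * x.2).

Lemma measure_preserving_translate1 a : measure_preserving (leb2 R) (translate1 a).
Proof. exact: (measure_preserving_shear1 (measurable_cst a)). Qed.

Lemma measure_preserving_translate2 a : measure_preserving (leb2 R) (translate2 a).
Proof. exact: (measure_preserving_shear2 (measurable_cst a)). Qed.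

(* A rotation with s != 0 is a product of three shears. *)
Lemma measure_preserving_rotate c s : c ^+ 2 + s ^+ 2 = 1 ->
  measure_preserving (leb2 R) (rotate c s).
Proof.
have shear c' s' : s' != 0 -> c' ^+ 2 + s' ^+ 2 = 1 ->
    measure_preserving (leb2 R) (rotate c' s').
  (* For c' = cos t and s' = sin t this is - tan (t / 2). *)
  move=> s0 cs1; pose a := (c' - 1) / s'.
  have m1 : measurable_fun setT (fun t : R => a * t) by exact: measurable_funM.
  have m2 : measurable_fun setT (fun t : R => s' * t) by exact: measurable_funM.
  have -> : rotate c' s' = (fun x => (x.1 + a * x.2, x.2)) \o
      ((fun x => (x.1, x.2 + s' * x.1)) \o (fun x => (x.1 + a * x.2, x.2))).
    apply/funext => -[x y]; rewrite /rotate /a /=; congr (_, _); last by field.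
    have -> : c' * x - s' * y = c' * x + ((c' ^+ 2 - 1) / s') * y.
      by rewrite -cs1; field.
    by field.
  apply: measure_preserving_comp; first exact: measure_preserving_shear1.
  apply: measure_preserving_comp; last exact: measure_preserving_shear1.
  exact: measure_preserving_shear2.
move=> cs1; have [s0|] := eqVneq s 0; last by move=> s0; exact: shear.
(* With zero sine the map is plus or minus the identity. Splitting off a quarter turn leaves two
   rotations of nonzero sine. *)
have -> : rotate c s = rotate 0 1 \o rotate s (- c).
  by apply/funext => -[x y]; rewrite /rotate /=; congr (_, _); ring.
have c0 : c != 0.
  by apply: contra_eq_neq cs1 => ->; rewrite s0 expr0n /= addr0 eq_sym oner_neq0.
apply: measure_preserving_comp; apply: shear => //.
- by rewrite expr0n expr1n add0r.
- by rewrite oppr_eq0.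
- by rewrite sqrrN addrC.
Qed.

End plane_isometries.

(** * Smooth functions and test functions *)

Section smooth.
Context {R : realType}.
Implicit Types (f g phi : R * R -> R) (e v w : R * R).
Local Notation e1 := (@e1 R).
Local Notation e2 := (@e2 R).

Definition smooth f : Prop := forall k, Ck k f.

Lemma e1_in : e1 \in [:: e1; e2]. Proof. by rewrite !inE eqxx. Qed.
Lemma e2_in : e2 \in [:: e1; e2]. Proof. by rewrite !inE eqxx orbT. Qed.
Hint Resolve e1_in e2_in : core.

Lemma scale_e1 (a : R) : a *: e1 = (a, 0).
Proof. by congr pair; [exact: mulr1|exact: mulr0]. Qed.

Lemma scale_e2 (a : R) : a *: e2 = (0, a).
Proof. by congr pair; [exact: mulr0|exact: mulr1]. Qed.

Lemma smooth_continuous f : smooth f -> continuous f.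
Proof. exact: (fun H => H 0%N). Qed.

Lemma smooth_derivable f e x : smooth f -> e \in [:: e1; e2] -> derivable f x e.
Proof. by move=> sf ein; have [] := sf 1%N e ein. Qed.

Lemma smooth_derive f e : smooth f -> e \in [:: e1; e2] -> smooth ('D_e f).
Proof. by move=> sf ein k; have [] := sf k.+1 e ein. Qed.

Lemma CkD k f g : Ck k f -> Ck k g -> Ck k (f + g).
Proof.
elim: k f g => [|k IH] f g /=; first by move=> cf cg x; exact: (cvgD (cf x) (cg x)).
move=> Cf Cg e ein; have [df Cdf] := Cf e ein; have [dg Cdg] := Cg e ein.
split=> [x|]; first by apply: derivableD.
have -> : 'D_e (f + g) = 'D_e f + 'D_e g; last exact: IH.
by apply/funext => x; rewrite deriveD.
Qed.

Lemma smoothD f g : smooth f -> smooth g -> smooth (f + g).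
Proof. by move=> sf sg k; exact: CkD. Qed.

Lemma smoothM f g : smooth f -> smooth g -> smooth (f * g).
Proof.
move=> sf sg k; elim: k f g sf sg => [|k IH] f g sf sg /=.
  by move=> x; exact: (cvgM (@smooth_continuous _ sf x) (@smooth_continuous _ sg x)).
move=> e ein; split=> [x|]; first by apply: derivableM; exact: smooth_derivable.
have -> : 'D_e (f * g) = f * 'D_e g + g * 'D_e f.
  apply/funext => x; rewrite deriveM; [by []|exact: smooth_derivable..].
by apply: CkD; apply: IH => //; exact: smooth_derive.
Qed.

Lemma smooth_cst (c : R) : smooth (cst c).
Proof.
move=> k; elim: k c => [|k IH] c /=; first by move=> x; exact: cst_continuous.
move=> e ein; split=> [x|]; first exact: derivable_cst.
have -> : 'D_e (cst c : R * R -> R) = cst 0; last exact: IH.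
by apply/funext => x; rewrite derive_cst.
Qed.

(* A difference quotient depends on the function only along the line. *)
Lemma derive_along {V W : normedModType R} (A : V -> W) (F : W -> R) (x e : V) (w : W) :
  (forall h : R, A (h *: e + x) = h *: w + A x) ->
  (derivable F (A x) w -> derivable (F \o A) x e) /\
  'D_e (F \o A) x = 'D_w F (A x).
Proof.
move=> AE; rewrite /derivable /derive.
have -> : (fun h : R => h^-1 *: ((F \o A \o shift x) (h *: e) - (F \o A) x)) =
  (fun h : R => h^-1 *: ((F \o shift (A x)) (h *: w) - F (A x))).
  by apply/funext => h /=; rewrite AE.
by split.
Qed.

Lemma line_is_derive f x e (t : R) : derivable f (t *: e + x) e ->
  is_derive t 1 (fun s => f (s *: e + x)) ('D_e f (t *: e + x)).
Proof.
pose A (s : R) := s *: e + x.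
have AE (h : R) : A (h *: 1 + t) = h *: e + A t.
  by rewrite /A -[h *: 1]/(h * 1) mulr1 scalerDl addrA.
have [dA DA] := derive_along f AE.
by move=> df; apply: DeriveDef; [exact: dA|exact: DA].
Qed.

Lemma line_MVT f x e (h : R) : (forall y, derivable f y e) ->
  exists2 t : R, `|t| <= `|h| & f (h *: e + x) - f x = h * 'D_e f (t *: e + x).
Proof.
move=> df; pose g (s : R) := f (s *: e + x).
have dg (s : R) : is_derive s 1 g ('D_e f (s *: e + x)) by exact: line_is_derive.
have cg : continuous g.
  by move=> s; apply/differentiable_continuous/derivable1_diffP; have [] := dg s.
have g0 : g 0 = f x by rewrite /g scale0r add0r.
have [h0|h0] := leP 0 h.
  have [//|t tin] := @MVT_segment _ g _ 0 h h0 (fun s _ => dg s).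
    exact: continuous_subspaceT.
  rewrite -/(g h) g0 subr0 mulrC => ->; exists t => //.
  by move: tin; rewrite in_itv /= => /andP[t0 th]; rewrite !ger0_norm.
have [//|t tin] := @MVT_segment _ g _ h 0 (ltW h0) (fun s _ => dg s).
  exact: continuous_subspaceT.
rewrite g0 sub0r -/(g h) => E; exists t.
  move: tin; rewrite in_itv /= => /andP[t0 th].
  by rewrite !ler0_norm ?lerN2 //; exact: ltW.
by rewrite -opprB E mulrN opprK mulrC.
Qed.

(** [Ck] speaks only of derivatives along the two axes. Going from x to h + x first along [e1], then
    along [e2], the mean value theorem expresses the increment by partial derivatives at nearby
    points, and their continuity makes the error o(h). *)
Lemma smooth_differentiable f x : smooth f -> differentiable f x /\
  forall v, 'd f x v = v.1 * 'D_e1 f x + v.2 * 'D_e2 f x.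
Proof.
move=> sf; pose d v := v.1 * 'D_e1 f x + v.2 * 'D_e2 f x : R.
have lind : linear d.
  move=> a u w; rewrite -[a *: d u]/(a * d u).
  by rewrite -[LHS]/((a * u.1 + w.1) * _ + (a * u.2 + w.2) * _) /d; ring.
pose dM := GRing.isLinear.Build _ _ _ _ _ lind.
pose dL : {linear (R * R)%type -> R} := HB.pack d dM.
have cd : continuous dL.
  move=> v; apply: cvgD; apply: cvgM;
    [exact: cvg_fst|exact: cvg_cst|exact: cvg_snd|exact: cvg_cst].
have fo : f \o shift x = cst (f x) + dL +o_ 0 id.
  apply/eqaddoP => eps eps0.
  have c1 : {for x, continuous ('D_e1 f)} by exact/smooth_continuous/smooth_derive.
  have c2 : {for x, continuous ('D_e2 f)} by exact/smooth_continuous/smooth_derive.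
  have eps20 : 0 < eps / 2 by rewrite divr_gt0.
  have /cvgrPdist_le/(_ _ eps20)/nbhs_ballP[r1 /= r10 B1] := c1.
  have /cvgrPdist_le/(_ _ eps20)/nbhs_ballP[r2 /= r20 B2] := c2.
  pose r := Num.min r1 r2.
  have r0 : 0 < r by rewrite lt_min r10 r20.
  apply/nbhs_ballP; exists r => //= h; rewrite -ball_normE /= sub0r normrN => hr.
  have h1 : `|h.1| <= `|h| by rewrite [leRHS]prod_normE le_max lexx.
  have h2 : `|h.2| <= `|h| by rewrite [leRHS]prod_normE le_max lexx orbT.
  have [t1 t1h E1] := line_MVT x h.1 (fun y => @smooth_derivable f e1 y sf e1_in).
  have [t2 t2h E2] := line_MVT (h.1 *: e1 + x) h.2 (fun y => @smooth_derivable f e2 y sf e2_in).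
  have -> : (f \o shift x - (cst (f x) + dL)) h =
      h.1 * ('D_e1 f (t1 *: e1 + x) - 'D_e1 f x) +
      h.2 * ('D_e2 f (t2 *: e2 + (h.1 *: e1 + x)) - 'D_e2 f x).
    rewrite /= /d -[LHS]/(f (h + x) - (f x + d h)).
    have -> : h + x = h.2 *: e2 + (h.1 *: e1 + x).
      rewrite scale_e1 scale_e2 addrA; congr (_ + _).
      by rewrite [LHS]surjective_pairing; congr pair; rewrite /= ?add0r ?addr0.
    rewrite /d; move: E1 E2.
    by move=> /eqP; rewrite subr_eq => /eqP E1 /eqP; rewrite subr_eq => /eqP ->; rewrite E1; ring.
  have n1 : `|'D_e1 f (t1 *: e1 + x) - 'D_e1 f x| <= eps / 2.
    rewrite distrC; apply: B1; rewrite -ball_normE /= distrC addrK normrZ.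
    rewrite (@le_lt_trans _ _ `|h|)//; last first.
      by rewrite (lt_le_trans hr)// ge_min lexx.
    rewrite (le_trans _ h1)// (_ : `|e1| = 1) ?mulr1//.
    by rewrite prod_normE /= normr1 normr0; apply/max_idPl; rewrite ler01.
  have n2 : `|'D_e2 f (t2 *: e2 + (h.1 *: e1 + x)) - 'D_e2 f x| <= eps / 2.
    rewrite distrC; apply: B2; rewrite -ball_normE /= distrC addrA addrK.
    rewrite (@le_lt_trans _ _ `|h|)//; last first.
      by rewrite (lt_le_trans hr)// ge_min lexx orbT.
    rewrite scale_e1 scale_e2 [leLHS]prod_normE /=.
    by rewrite addr0 add0r ge_max h1 (le_trans t2h).
  rewrite (le_trans (ler_normD _ _))// !normrM.
  by rewrite (splitr eps) mulrDl lerD// mulrC ler_pM.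
split.
  apply/diff_locallyP; rewrite (diff_unique cd fo); split=> //.
by move=> v; rewrite (diff_unique cd fo).
Qed.

End smooth.

Section smooth_comp.
Context {R : realType}.
Implicit Types (f g phi : R * R -> R) (e v w x : R * R).
Local Notation e1 := (@e1 R).
Local Notation e2 := (@e2 R).
Hint Resolve e1_in e2_in : core.

Lemma smooth_deriveE f v x : smooth f ->
  'D_v f x = v.1 * 'D_e1 f x + v.2 * 'D_e2 f x.
Proof.
by move=> sf; have [df dE] := smooth_differentiable x sf; rewrite deriveE.
Qed.

Lemma smooth_derivable_dir f v x : smooth f -> derivable f x v.
Proof. by move=> sf; apply: diff_derivable; have [] := smooth_differentiable x sf. Qed.

Lemma smooth_is_derive_curve f (c1 c2 : R -> R) (d1 d2 t : R) : smooth f ->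
  is_derive t 1 c1 d1 -> is_derive t 1 c2 d2 ->
  is_derive t 1 (fun s => f (c1 s, c2 s))
    (d1 * 'D_e1 f (c1 t, c2 t) + d2 * 'D_e2 f (c1 t, c2 t)).
Proof.
move=> sf [dc1 d1E] [dc2 d2E].
have [df dfE] := smooth_differentiable (c1 t, c2 t) sf.
move/derivable1_diffP in dc1; move/derivable1_diffP in dc2.
have dc : differentiable (fun s => (c1 s, c2 s)) t by exact: differentiable_pair.
have dfc : differentiable (f \o (fun s => (c1 s, c2 s))) t by exact: differentiable_comp.
apply: DeriveDef; first exact/derivable1_diffP.
rewrite (deriveE _ dfc) diff_comp//= dfE diff_pair//= -!deriveE//.
by rewrite d1E d2E.
Qed.

(** The two identities say that A is affine, with w1 and w2 the images of [e1] and [e2] under its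
    linear part. The partial derivatives of f \o A are then again of the form (smooth function) \o
    A, so the induction on k runs over all f at once. *)
Lemma smooth_comp_affine f (A : R * R -> R * R) w1 w2 : smooth f -> continuous A ->
  (forall x (h : R), A (h *: e1 + x) = h *: w1 + A x) ->
  (forall x (h : R), A (h *: e2 + x) = h *: w2 + A x) ->
  smooth (f \o A).
Proof.
move=> sf cA A1 A2 k; elim: k f sf => [|k IH] f sf /=.
  by move=> x; apply: continuous_comp; [exact: cA|exact: smooth_continuous].
move=> e; rewrite !inE => /orP[] /eqP ->; split.
- by move=> x; have [+ _] := derive_along f (A1 x); apply; exact: smooth_derivable_dir.
- have -> : 'D_e1 (f \o A) = (cst w1.1 * 'D_e1 f + cst w1.2 * 'D_e2 f) \o A.
    by apply/funext => x; have [_ ->] := derive_along f (A1 x); exact: smooth_deriveE.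
  by apply: IH; apply: smoothD; apply: smoothM; try exact: smooth_cst; exact: smooth_derive.
- by move=> x; have [+ _] := derive_along f (A2 x); apply; exact: smooth_derivable_dir.
- have -> : 'D_e2 (f \o A) = (cst w2.1 * 'D_e1 f + cst w2.2 * 'D_e2 f) \o A.
    by apply/funext => x; have [_ ->] := derive_along f (A2 x); exact: smooth_deriveE.
  by apply: IH; apply: smoothD; apply: smoothM; try exact: smooth_cst; exact: smooth_derive.
Qed.

Lemma derive_fst v x : 'D_v (fst : R * R -> R) x = v.1.
Proof.
have c : continuous (fst : R * R -> R) by move=> y; exact: cvg_fst.
by rewrite deriveE; [rewrite diff_lin|exact: linear_differentiable].
Qed.

Lemma derive_snd v x : 'D_v (snd : R * R -> R) x = v.2.
Proof.
have c : continuous (snd : R * R -> R) by move=> y; exact: cvg_snd.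
by rewrite deriveE; [rewrite diff_lin|exact: linear_differentiable].
Qed.

Lemma smooth_fst : smooth (fst : R * R -> R).
Proof.
case=> [|k] /=; first by move=> x; exact: cvg_fst.
move=> e ein; split=> [x|].
  by apply/diff_derivable/linear_differentiable => y; exact: cvg_fst.
have -> : 'D_e (fst : R * R -> R) = cst e.1; last exact: smooth_cst.
by apply/funext => x; rewrite derive_fst.
Qed.

Lemma smooth_snd : smooth (snd : R * R -> R).
Proof.
case=> [|k] /=; first by move=> x; exact: cvg_snd.
move=> e ein; split=> [x|].
  by apply/diff_derivable/linear_differentiable => y; exact: cvg_snd.
have -> : 'D_e (snd : R * R -> R) = cst e.2; last exact: smooth_cst.
by apply/funext => x; rewrite derive_snd.
Qed.

Lemma test_functionP phi (K : set (R * R)) : smooth phi -> compact K ->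
  (forall x, ~ K x -> phi x = 0) -> test_function phi.
Proof.
move=> sphi cK phiK; split=> //; have clK : closed K.
  by apply: compact_closed => //; exact: norm_hausdorff.
apply: (subclosed_compact _ cK); first exact: closed_closure.
rewrite closureE => x; apply; split=> // y /=.
by apply: contra_neqP => /phiK.
Qed.

Lemma test_function_support phi :
  test_function phi -> exists2 K, compact K & forall x, ~ K x -> phi x = 0.
Proof.
move=> [_ cK]; eexists; first exact: cK.
by move=> x; apply: contra_notP => /eqP nz; exact: subset_closure.
Qed.

Lemma test_functionMl f phi : smooth f -> test_function phi -> test_function (f * phi).
Proof.
move=> sf tphi; have [K cK phiK] := test_function_support tphi.
apply: (test_functionP _ cK); first exact: smoothM sf tphi.1.
by move=> x /phiK; rewrite -[(f * phi) x]/(f x * phi x) => ->; rewrite mulr0.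
Qed.

Lemma test_function_derive phi e : test_function phi -> e \in [:: e1; e2] ->
  test_function ('D_e phi).
Proof.
move=> tphi ein; have [_ cK] := tphi.
apply: (test_functionP _ cK); first exact: smooth_derive tphi.1 ein.
move=> x nK.
(* Off the closed support, [phi] vanishes in a whole neighbourhood, and so does its derivative. *)
have /= Kn : nbhs x (~` closure [set x | phi x != 0]).
  by apply: open_nbhs_nbhs; split=> //; exact/closed_openC/closed_closure.
rewrite (@near_eq_derive _ _ _ phi (cst 0)) ?derive_cst//.
apply: filterS Kn => y nKy; apply: contrapT => /eqP nz.
by apply: nKy; exact: subset_closure.
Qed.

Lemma test_function_comp phi (A B : R * R -> R * R) w1 w2 : test_function phi ->
  continuous A -> continuous B -> cancel A B ->
  (forall x (h : R), A (h *: e1 + x) = h *: w1 + A x) ->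
  (forall x (h : R), A (h *: e2 + x) = h *: w2 + A x) ->
  test_function (phi \o A).
Proof.
move=> tphi cA cB AB A1 A2; have [K cK phiK] := test_function_support tphi.
apply: (@test_functionP _ (B @` K)).
- exact: smooth_comp_affine tphi.1 cA A1 A2.
- by apply: continuous_compact => //; exact: continuous_subspaceT.
- by move=> x nBK; apply: phiK => KA; apply: nBK; exists (A x).
Qed.

End smooth_comp.

(** * The fundamental lemma of the calculus of variations *)

Section bump.
Context {R : realType}.
Implicit Types (P Q : {poly R}) (x h : R).

(* The family of flat functions P(1/x) exp(-1/x) on x > 0 is stable under
   differentiation, which makes smoothness provable by induction. *)
Definition flat_exp P x : R := if 0 < x then P.[x^-1] * expR (- x^-1) else 0.

Lemma flat_expM P x : x^-1 * flat_exp P x = flat_exp (P * 'X) x.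
Proof.
rewrite /flat_exp; case: ifPn => [x0|]; last by rewrite mulr0.
by rewrite hornerMX; ring.
Qed.

(** Comes from e^y >= y^(n+1) / (n+1)! at y = 1/x, applied to each monomial of P. A linear bound
    suffices: applied to P * 'X it also controls the difference quotient at 0. *)
Lemma flat_exp_bound P : exists C : R, forall x, `|flat_exp P x| <= C * `|x|.
Proof.
have mono n : forall x, `|flat_exp 'X^n x| <= n.+1`!%:R * `|x|.
  move=> x; rewrite /flat_exp; case: ifPn => [x0|]; last first.
    by rewrite normr0 mulr_ge0.
  rewrite hornerXn (gtr0_norm x0) ger0_norm; last first.
    by rewrite mulr_ge0 ?expR_ge0// exprn_ge0// invr_ge0 ltW.
  rewrite expRN ler_pdivrMr ?expR_gt0//.
  have := expR_ge1Dxn n (ltW (_ : 0 < x^-1)); rewrite invr_gt0 => /(_ x0) H.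
  have F0 : 0 < n.+1`!%:R :> R by rewrite ltr0n fact_gt0.
  have : n.+1`!%:R * x * (x^-1 ^+ n.+1 / n.+1`!%:R) <= n.+1`!%:R * x * expR x^-1.
    rewrite ler_pM2l ?mulr_gt0//; apply: le_trans H; by rewrite lerDr.
  by apply: le_trans; rewrite exprS le_eqVlt; apply/orP; left; apply/eqP; field;
    rewrite !gt_eqF.
rewrite -(coefK P) poly_def.
elim/big_ind: _ => [|p q [C1 H1] [C2 H2]|i _].
- exists 0 => x; rewrite /flat_exp mul0r; case: ifP => _; last by rewrite normr0.
  by rewrite horner0 mul0r normr0.
- exists (C1 + C2) => x; rewrite mulrDl; apply: le_trans (lerD (H1 x) (H2 x)).
  apply: le_trans (ler_normD _ _); rewrite /flat_exp; case: ifP => _.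
    by rewrite hornerD mulrDl.
  by rewrite addr0.
- exists (`|P`_i| * i.+1`!%:R) => x; rewrite -mulrA.
  apply: le_trans (ler_wpM2l (normr_ge0 _) (mono i x)); rewrite -normrM.
  rewrite /flat_exp; case: ifP => _; last by rewrite mulr0.
  by rewrite hornerZ mulrA.
Qed.

Lemma flat_exp_is_derive P x :
  is_derive x 1 (flat_exp P) (flat_exp ('X^2 * (P - P^`())) x).
Proof.
have [x0|x0|->] := ltgtP x 0.
- have -> : flat_exp ('X^2 * (P - P^`())) x = 0 by rewrite /flat_exp ltNge (ltW x0).
  apply: (@near_eq_is_derive _ _ _ (cst 0)).
    near=> y; rewrite /flat_exp ifF//; apply/negbTE; rewrite -leNgt ltW//.
    by near: y; exact: lt_nbhsl.
- rewrite /flat_exp x0.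
  pose f := (fun y : R => P.[y^-1] * expR (- y^-1)).
  have dV : is_derive x 1 (fun y : R => y^-1) (- x ^- 2).
    apply: DeriveDef; first by apply: derivableV; rewrite ?gt_eqF//; exact: derivable_id.
    by rewrite deriveV ?gt_eqF// derive_id -[_ *: _]/(_ * _) mulr1.
  have d1 : is_derive x 1 (horner P \o (fun y : R => y^-1)) (P^`().[x^-1] * - x ^- 2).
    exact: is_derive1_comp.
  have d2 : is_derive x 1 (expR \o (fun y : R => - y^-1)) (expR (- x^-1) * - - x ^- 2).
    exact: is_derive1_comp.
  have : is_derive x 1 f (x^-1 ^+ 2 * (P - P^`()).[x^-1] * expR (- x^-1)).
    apply: (is_derive_eq (is_deriveM d1 d2)).
    rewrite /= -![_ *: _]/(_ * _) hornerD hornerN exprVn; ring.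
  rewrite hornerM hornerXn; apply: near_eq_is_derive.
  near=> y; rewrite ifT//.
  by near: y; exact: lt_nbhsr.
- have -> : flat_exp ('X^2 * (P - P^`())) 0 = 0 by rewrite /flat_exp ltxx.
  (* By [flat_expM] the difference quotient of [flat_exp P] at 0 is [flat_exp (P * 'X)], which is
     O(h). *)
  have [C HC] := flat_exp_bound (P * 'X).
  have cv : h^-1 *: ((flat_exp P \o shift 0) (h *: 1) - flat_exp P 0) @[h --> 0^'] --> (0 : R).
    apply/cvgrPdist_le => eps eps0.
    near=> h.
    rewrite /= addr0 {2}/flat_exp ltxx subr0 sub0r normrN.
    rewrite -[h *: 1]/(h * 1) mulr1 -[_ *: _]/(_ * _) flat_expM.
    rewrite (le_trans (HC h))// (@le_trans _ _ ((`|C| + 1) * `|h|))//.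
      by rewrite ler_wpM2r// (le_trans (ler_norm _))// lerDl.
    rewrite -ler_pdivlMl ?ltr_wpDl// mulrC; near: h; apply: dnbhs0_le.
    by rewrite divr_gt0 ?ltr_wpDl.
  apply: DeriveDef; first by apply/cvg_ex; exists 0.
  exact: cvg_lim.
Unshelve. all: by end_near. Qed.

End bump.

(** * Open boxes, Borel sets and the topology of the plane *)

Section plane_borel.
Context {R : realType}.
Let T : measurableType _ := (measurableTypeR R * measurableTypeR R)%type.

Definition obox (a b c d : R) : set (R * R) := `]a, b[%classic `*` `]c, d[%classic.

Definition oboxes : set (set (R * R)) :=
  [set B | exists a b c d, B = obox a b c d].

Lemma in_obox a b c d (x : R * R) :
  obox a b c d x <-> [/\ a < x.1, x.1 < b, c < x.2 & x.2 < d].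
Proof.
rewrite /obox /= !in_itv /=; split; first by move=> [/andP[-> ->] /andP[-> ->]].
by move=> [-> -> -> ->].
Qed.

Lemma measurable_obox a b c d : measurable (obox a b c d : set T).
Proof. by apply: measurableX; exact: measurable_itv. Qed.

Lemma obox_bigcup_fst (a b : R) :
  `]a, b[%classic `*` setT = \bigcup_n obox a b (- n%:R) n%:R.
Proof.
apply/seteqP; split => [[x y] [/= xab _]|[x y] [n _] [xab _]]; last by split.
exists (Num.truncn `|y|).+1 => //; split => //=.
rewrite in_itv /= -ltr_norml.
by rewrite (lt_le_trans (truncnS_gt _)).
Qed.

Lemma obox_bigcup_snd (a b : R) :
  setT `*` `]a, b[%classic = \bigcup_n obox (- n%:R) n%:R a b.
Proof.
apply/seteqP; split => [[x y] [_ /= xab]|[x y] [n _] [_ xab]]; last by split.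
exists (Num.truncn `|x|).+1 => //; split => //=.
rewrite in_itv /= -ltr_norml.
by rewrite (lt_le_trans (truncnS_gt _)).
Qed.

(** Indicators of open boxes are limits of test functions, so boxes are the generators wanted for
    the Dynkin argument in [ae_eq0_test_functions]. Strips are countable unions of boxes, which
    makes both projections measurable for the generated sigma-algebra. *)
Lemma measurable_oboxesE : @measurable _ T = <<s oboxes >>.
Proof.
apply/seteqP; split; last first.
  apply: smallest_sub; first exact: sigma_algebra_measurable.
  by move=> _ [a [b [c [d ->]]]]; exact: measurable_obox.
rewrite measurable_prod_measurableType.
apply: smallest_sub; first exact: smallest_sigma_algebra.
move=> _ [A mA [B mB <-]].
have -> : A `*` B = (fst @^-1` A) `&` (snd @^-1` B) by [].
pose T' : measurableType _ := g_sigma_algebraType oboxes.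
have mfst : measurable_fun setT (fst : T' -> measurableTypeR R).
  apply: (measurability _ (RGenOpens.measurableE R)).
  move=> _ [_ [a [b ->]] <-]; rewrite setTI.
  have -> : fst @^-1` `]a, b[%classic = `]a, b[%classic `*` setT :> set (R * R).
    by apply/seteqP; split => // x [].
  rewrite obox_bigcup_fst; apply: bigcupT_measurable => n.
  by apply: sub_sigma_algebra; do 4 eexists.
have msnd : measurable_fun setT (snd : T' -> measurableTypeR R).
  apply: (measurability _ (RGenOpens.measurableE R)).
  move=> _ [_ [a [b ->]] <-]; rewrite setTI.
  have -> : snd @^-1` `]a, b[%classic = setT `*` `]a, b[%classic :> set (R * R).
    by apply/seteqP; split => // x [].
  rewrite obox_bigcup_snd; apply: bigcupT_measurable => n.
  by apply: sub_sigma_algebra; do 4 eexists.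
apply: (@measurableI _ T').
- by rewrite -[X in measurable X]setTI; exact: mfst.
- by rewrite -[X in measurable X]setTI; exact: msnd.
Qed.

Lemma oboxes_setI : setI_closed oboxes.
Proof.
move=> _ _ [a [b [c [d ->]]]] [a' [b' [c' [d' ->]]]].
exists (Num.max a a'), (Num.min b b'), (Num.max c c'), (Num.min d d').
apply/seteqP; split => x.
  move=> [/in_obox[? ? ? ?] /in_obox[? ? ? ?]]; apply/in_obox.
  by rewrite !gt_max !lt_min; split; apply/andP.
move=> /in_obox; rewrite !gt_max !lt_min => -[/andP[? ?] /andP[? ?] /andP[? ?] /andP[? ?]].
by split; apply/in_obox.
Qed.

(** Boxes with rational centres and radii 1 / (n + 1) are countably many and form a base of the
    topology. *)
Lemma open_measurable_plane (U : set (R * R)) : open U -> measurable (U : set T).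
Proof.
move=> oU.
pose B (q : rat * rat * nat) :=
  obox (ratr q.1.1 - q.2.+1%:R^-1) (ratr q.1.1 + q.2.+1%:R^-1)
       (ratr q.1.2 - q.2.+1%:R^-1) (ratr q.1.2 + q.2.+1%:R^-1).
have -> : U = \bigcup_(q in [set q | B q `<=` U]) B q.
  apply/seteqP; split; last by move=> x [q /= qU Bq]; exact: qU.
  move=> x Ux; move: oU; rewrite openE => /(_ _ Ux)/nbhs_ballP[e /= e0 eU].
  (* Half of e, because a box of radius 1 / (n + 1) whose centre is that close to x reaches points
     at distance up to 2 / (n + 1) from x. *)
  have [n ne] : exists n : nat, n.+1%:R^-1 < e / 2 :> R.
    exists (Num.truncn (e / 2)^-1); rewrite invf_plt ?posrE ?divr_gt0//.
    exact: truncnS_gt.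
  have n0 : 0 < n.+1%:R^-1 :> R by rewrite invr_gt0 ltr0n.
  set i : R := n.+1%:R^-1 in n0 ne.
  have near_rat (t : R) : exists q : rat, t - i < ratr q < t + i.
    have /rat_in_itvoo[q] : t - i < t + i by lra.
    by rewrite in_itv /=; exists q.
  have [q1 /andP[q1l q1r]] := near_rat x.1.
  have [q2 /andP[q2l q2r]] := near_rat x.2.
  exists (q1, q2, n); last by apply/in_obox; split => /=; rewrite -/i; lra.
  move=> y /in_obox [/=]; rewrite -/i => y1 y2 y3 y4; apply: eU.
  by split; rewrite /ball /= ltr_norml; apply/andP; split; lra.
rewrite bigcup_mkcond; apply: countable_bigcupT_measurable => // q.
by case: ifP => // _; exact: measurable_obox.
Qed.

Lemma continuous_measurable_plane (f : R * R -> R) :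
  continuous f -> measurable_fun (setT : set T) (f : T -> R).
Proof.
move=> /continuousP cf; apply: (measurability _ (RGenOpens.measurableE R)).
move=> _ [_ [a [b ->]] <-]; rewrite setTI; apply: open_measurable_plane.
exact/cf/interval_open.
Qed.

Lemma compact_measurable_plane (K : set (R * R)) : compact K -> measurable (K : set T).
Proof.
move=> cK; rewrite -[K]setCK; apply: measurableC; apply: open_measurable_plane.
by apply: closed_openC; apply: compact_closed => //; exact: norm_hausdorff.
Qed.

End plane_borel.

Section box_bump.
Context {R : realType}.
Local Notation e1 := (@e1 R).
Local Notation e2 := (@e2 R).
Implicit Types (a b c d : R).

Lemma smooth_flat_exp (P : {poly R}) a b c :
  smooth (fun x : R * R => flat_exp P (a * x.1 + b * x.2 + c)).
Proof.
pose A (x : R * R) := a * x.1 + b * x.2 + c.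
have A1 x (h : R) : A (h *: e1 + x) = h *: a + A x.
  by rewrite scale_e1 /A -[h *: a]/(h * a) /=; ring.
have A2 x (h : R) : A (h *: e2 + x) = h *: b + A x.
  by rewrite scale_e2 /A -[h *: b]/(h * b) /=; ring.
(* The factor w collects the chain rule constants a and b, so that the family F w Q \o A is closed
   under both partial derivatives. *)
pose F (w : R) Q (y : R) := w * flat_exp Q y.
suff CF k : forall w Q, Ck k (F w Q \o A).
  move=> k; have -> : (fun x => flat_exp P (A x)) = F 1 P \o A; last exact: CF.
  by apply/funext => x; rewrite /F /= mul1r.
have dF w Q y v : derivable (F w Q) y v /\
    'D_v (F w Q) y = F (w * v) ('X^2 * (Q - Q^`())) y.
  have : is_derive y 1 (F w Q) (w * flat_exp ('X^2 * (Q - Q^`())) y).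
    apply: (is_derive_eq (is_deriveM (is_derive_cst _ _ _) (flat_exp_is_derive Q y))).
    by rewrite scaler0 addr0.
  move=> [dQ DQ]; move/derivable1_diffP in dQ.
  split; first exact: diff_derivable.
  rewrite deriveE// -[v in 'd _ _ v]mulr1 [LHS]linearZ -deriveE// DQ /F.
  by rewrite -[LHS]/(v * _); ring.
elim: k => [|k IH] w Q.
  move=> x; apply: (@continuous_comp _ _ _ A).
    apply: cvgD; last exact: cvg_cst.
    apply: cvgD; apply: cvgM; try exact: cvg_cst; [exact: cvg_fst|exact: cvg_snd].
  by apply/differentiable_continuous/derivable1_diffP; have [] := dF w Q (A x) 1.
move=> e; rewrite !inE => /orP[] /eqP ->; split.
- by move=> x; have [+ _] := derive_along (F w Q) (A1 x); apply; have [] := dF w Q (A x) a.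
- have -> : 'D_e1 (F w Q \o A) = F (w * a) ('X^2 * (Q - Q^`())) \o A => //.
  by apply/funext => x; have [_ ->] := derive_along (F w Q) (A1 x); have [] := dF w Q (A x) a.
- by move=> x; have [+ _] := derive_along (F w Q) (A2 x); apply; have [] := dF w Q (A x) b.
- have -> : 'D_e2 (F w Q \o A) = F (w * b) ('X^2 * (Q - Q^`())) \o A => //.
  by apply/funext => x; have [_ ->] := derive_along (F w Q) (A2 x); have [] := dF w Q (A x) b.
Qed.

Lemma flat_exp1_le1 (t : R) : 0 <= flat_exp 1 t <= 1.
Proof.
rewrite /flat_exp; case: ifP => t0; last by rewrite lexx ler01.
by rewrite hornerC mul1r expR_ge0 expR_le1 oppr_le0 invr_ge0 ltW.
Qed.

Lemma flat_exp_le0 P (t : R) : t <= 0 -> flat_exp P t = 0.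
Proof. by rewrite /flat_exp ltNge => ->. Qed.

Lemma flat_exp1_cvg (t : R) : 0 < t -> flat_exp 1 (n.+1%:R * t) @[n --> \oo] --> (1 : R).
Proof.
move=> t0; rewrite -[X in _ --> X]expR0.
have -> : (fun n : nat => flat_exp 1 (n.+1%:R * t)) =
    expR \o (fun n => - ((n.+1%:R)^-1 * t^-1)).
  apply/funext => n; rewrite /flat_exp mulr_gt0// hornerC mul1r /= invfM.
  by rewrite mulrC.
apply: continuous_cvg; first exact: continuous_expR.
rewrite -oppr0; apply: cvgN; rewrite -(mul0r t^-1); apply: cvgM; last exact: cvg_cst.
exact: cvg_harmonic.
Qed.

(** Each of the four sides of the box contributes a factor exp (- 1 / ((n + 1) t)), where t > 0 is
    the signed distance to that side. The functions are shaped for dominated convergence to the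
    indicator of the box. *)
Lemma obox_test_functions a b c d : exists phi : nat -> R * R -> R,
  [/\ forall n, test_function (phi n), forall n x, `|phi n x| <= 1,
      forall n x, ~ obox a b c d x -> phi n x = 0 &
      forall x, obox a b c d x -> phi n x @[n --> \oo] --> (1 : R)].
Proof.
pose l (p q r : R) (n : nat) (x : R * R) := flat_exp 1 (n.+1%:R * (p * x.1 + q * x.2 + r)).
have sl p q r n : smooth (l p q r n).
  have -> : l p q r n = fun x => flat_exp 1 (n.+1%:R * p * x.1 + n.+1%:R * q * x.2 + n.+1%:R * r).
    by apply/funext => x; rewrite /l; congr flat_exp; ring.
  exact: smooth_flat_exp.
pose phi n := (l 1 0 (- a) n * l (-1) 0 b n) * (l 0 1 (- c) n * l 0 (-1) d n).
have phiE n x : phi n x = flat_exp 1 (n.+1%:R * (x.1 - a)) * flat_exp 1 (n.+1%:R * (b - x.1)) *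
    (flat_exp 1 (n.+1%:R * (x.2 - c)) * flat_exp 1 (n.+1%:R * (d - x.2))).
  rewrite -[LHS]/(l 1 0 (- a) n x * l (-1) 0 b n x * (l 0 1 (- c) n x * l 0 (-1) d n x)) /l.
  by congr (flat_exp 1 (_ * _) * flat_exp 1 (_ * _) * (flat_exp 1 (_ * _) * flat_exp 1 (_ * _))); ring.
have phi0 n x : ~ obox a b c d x -> phi n x = 0.
  rewrite phiE => /in_obox; case: (ltP a x.1) => xa; last first.
    by rewrite flat_exp_le0 ?mul0r// pmulr_rle0// subr_le0.
  case: (ltP x.1 b) => xb; last first.
    by rewrite (@flat_exp_le0 _ (_ * (b - _))) ?mulr0 ?mul0r// pmulr_rle0// subr_le0.
  case: (ltP c x.2) => xc; last first.
    by rewrite (@flat_exp_le0 _ (_ * (x.2 - _))) ?mul0r ?mulr0// pmulr_rle0// subr_le0.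
  case: (ltP x.2 d) => xd; last first.
    by rewrite (@flat_exp_le0 _ (_ * (d - _))) ?mul0r ?mulr0// pmulr_rle0// subr_le0.
  by case; split.
exists phi; split=> //.
- move=> n; apply: (@test_functionP _ _ (`[a, b]%classic `*` `[c, d]%classic)).
  + by apply: smoothM; apply: smoothM.
  + by apply: compact_setX; exact: segment_compact.
  + move=> x nK; apply: phi0 => -[/= xab xcd]; apply: nK; split => /=.
    * by move: xab; rewrite !in_itv /= => /andP[/ltW -> /ltW ->].
    * by move: xcd; rewrite !in_itv /= => /andP[/ltW -> /ltW ->].
- move=> n x; rewrite phiE.
  have F (t : R) : `|flat_exp 1 t| <= 1 by have /andP[? ?] := flat_exp1_le1 t; rewrite ger0_norm.
  by rewrite !normrM !mulr_ile1// mulr_ge0.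
- move=> x /in_obox[xa xb xc xd].
  have -> : (fun n => phi n x) = (fun n : nat =>
      flat_exp 1 (n.+1%:R * (x.1 - a)) * flat_exp 1 (n.+1%:R * (b - x.1)) *
      (flat_exp 1 (n.+1%:R * (x.2 - c)) * flat_exp 1 (n.+1%:R * (d - x.2)))).
    by apply/funext => n; rewrite phiE.
  have F t : 0 < t -> flat_exp 1 (n.+1%:R * t) @[n --> \oo] --> (1 : R).
    exact: flat_exp1_cvg.
  have := cvgM (cvgM (F (x.1 - a) _) (F (b - x.1) _)) (cvgM (F (x.2 - c) _) (F (d - x.2) _)).
  by rewrite !mulr1 !subr_gt0; exact.
Qed.

End box_bump.

Section fundamental_lemma.
Context {R : realType}.
Let T : measurableType _ := (measurableTypeR R * measurableTypeR R)%type.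
Implicit Types (g phi : R * R -> R).

Lemma test_function_measurable phi : test_function phi ->
  measurable_fun (setT : set T) (phi : T -> R).
Proof. by move=> [sphi _]; apply: continuous_measurable_plane; exact: smooth_continuous. Qed.

Lemma continuous_bounded_on (phi : R * R -> R) (K : set (R * R)) :
  continuous phi -> compact K -> exists M : R, forall x, K x -> `|phi x| <= M.
Proof.
move=> cphi cK; have [->|K0] := eqVneq K set0; first by exists 0.
move/set0P in K0.
have cn : {within K, continuous (fun x => `|phi x|)}.
  by apply: continuous_subspaceT => y; apply: cvg_norm; exact: cphi.
have [x Kx H] := compact_EVT_max K0 cK cn.
by exists `|phi x| => y Ky; apply: H; rewrite inE.
Qed.

Lemma test_function_bounded phi : test_function phi -> exists M : R, forall x, `|phi x| <= M.
Proof.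
move=> tphi; have [K cK phiK] := test_function_support tphi.
have [M HM] := continuous_bounded_on (smooth_continuous tphi.1) cK.
exists (Num.max M 0) => x; have [Kx|nK] := pselect (K x).
  by rewrite le_max HM.
by rewrite phiK// normr0 le_max lexx orbT.
Qed.

Lemma integrable_locally_test g phi : locally_integrable2 g -> test_function phi ->
  (leb2 R).-integrable setT (fun x => (g x * phi x)%:E).
Proof.
move=> [mg ig] tphi; have [K cK phiK] := test_function_support tphi.
have mK := compact_measurable_plane cK.
have [M HM] := test_function_bounded tphi.
have mphi := test_function_measurable tphi.
have iK : (leb2 R).-integrable K (fun x => (g x * phi x)%:E).
  have -> : (fun x => (g x * phi x)%:E) = ((EFin \o phi) \* (EFin \o g))%E.
    by apply/funext => x; rewrite /= -EFinM mulrC.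
  apply: integrableMr => //; last exact: ig.
    exact: measurable_funTS.
  exists M; split => [|y My z _ /=]; first by rewrite num_real.
    by rewrite (le_trans (HM z))// ltW.
move/(integrable_mkcond _ mK) : iK; apply: eq_integrable => // x _.
rewrite /patch; case: ifPn => //; rewrite notin_setE => nK.
by rewrite phiK// mulr0.
Qed.

(** Dominated convergence along the functions of [obox_test_functions], with |g| on the box as
    dominating function. *)
Lemma integral_test_functions_box g a b c d : locally_integrable2 g ->
  (forall phi, test_function phi -> \int[leb2 R]_x (g x * phi x) = 0) ->
  (\int[leb2 R]_(x in obox a b c d) (g x)%:E = 0)%E.
Proof.
move=> lg g0; have [phi [tphi phi1 phi0 phic]] := obox_test_functions a b c d.
have mB := @measurable_obox R a b c d.
have iB : (leb2 R).-integrable (obox a b c d) (EFin \o g).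
  have cK : compact (`[a, b]%classic `*` `[c, d]%classic : set (R * R)).
    by apply: compact_setX; exact: segment_compact.
  apply: (integrableS _ _ _ (lg.2 _ cK)) => //; first exact: compact_measurable_plane.
  by apply: setSX; exact: subset_itv_oo_cc.
have mg := lg.1.
have mphi n := test_function_measurable (tphi n).
have mf n : measurable_fun (obox a b c d : set T) (fun x => (g x * phi n x)%:E).
  by apply/measurable_EFinP/measurable_funTS; exact: measurable_funM.
have mg' : measurable_fun (obox a b c d : set T) (EFin \o g).
  by apply/measurable_EFinP/measurable_funTS.
have cf : {ae leb2 R, forall x, obox a b c d x ->
    (g x * phi n x)%:E @[n --> \oo] --> (EFin \o g) x}.
  apply/aeW => x Bx; apply: cvg_EFin; first by near=> n.
  by rewrite /= -[X in _ --> X](mulr1 (g x)); apply: cvgM; [exact: cvg_cst|exact: phic].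
have df : {ae leb2 R, forall x n, obox a b c d x ->
    (`|(g x * phi n x)%:E| <= (abse \o (EFin \o g)) x)%E}.
  by apply/aeW => x n _; rewrite /= lee_fin normrM ler_piMr.
have [_ _] := dominated_convergence mB mf mg' cf (integrable_abse iB) df.
have -> : (fun n => \int[leb2 R]_(x in obox a b c d) (g x * phi n x)%:E)%E = cst 0%E.
  apply/funext => n /=.
  rewrite integral_mkcond.
  transitivity (\int[leb2 R]_x (g x * phi n x)%:E)%E.
    apply: eq_integral => x _; rewrite /patch; case: ifPn => //; rewrite notin_setE => nB.
    by rewrite phi0// mulr0.
  have := g0 _ (tphi n); rewrite /Rintegral => E.
  rewrite -[LHS]fineK ?E//; apply: integrable_fin_num => //.
  exact: integrable_locally_test.
by move/cvg_lim; rewrite lim_cst// => <-.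
Unshelve. all: by end_near. Qed.

(** As g is only locally integrable, the argument is run inside a fixed large box. There g has zero
    integral over the pi-system of open boxes, hence by Dynkin over every Borel subset, so it
    vanishes almost everywhere; the large boxes exhaust the plane. *)
Lemma ae_eq0_test_functions g : locally_integrable2 g ->
  (forall phi, test_function phi -> \int[leb2 R]_x (g x * phi x) = 0) ->
  {ae leb2 R, forall x, g x = 0}.
Proof.
move=> lg g0.
have box0 n : {ae leb2 R, forall x, obox (- n%:R) n%:R (- n%:R) n%:R x -> g x = 0}.
  set B := obox _ _ _ _; have mB : measurable (B : set T) by exact: measurable_obox.
  have iB : (leb2 R).-integrable B (EFin \o g).
    have cK : compact (`[- n%:R, n%:R]%classic `*` `[- n%:R, n%:R]%classic : set (R * R)).
      by apply: compact_setX; exact: segment_compact.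
    apply: (integrableS _ _ _ (lg.2 _ cK)) => //; first exact: compact_measurable_plane.
    by apply: setSX; exact: subset_itv_oo_cc.
  have P (S : set T) : measurable S -> (\int[leb2 R]_(x in S `&` B) (g x)%:E = 0)%E.
    rewrite measurable_oboxesE; move: S.
    apply: (@dynkin_induction _ T oboxes
      (fun S => (\int[leb2 R]_(x in S `&` B) (g x)%:E = 0)%E)).
    - exact: measurable_oboxesE.
    - exact: oboxes_setI.
    - by rewrite setTI; exact: integral_test_functions_box.
    - move=> C oC; have [|a [b [c [d ->]]]] := oboxes_setI oC (_ : oboxes B).
        by do 4 eexists.
      exact: integral_test_functions_box.
    - move=> S mS S0.
      have : (\int[leb2 R]_(x in (S `&` B) `|` (~` S `&` B)) (g x)%:E = 0)%E.
        rewrite -setIUl setUv setTI; exact: integral_test_functions_box.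
      rewrite integral_setU ?S0 ?add0e//.
      + exact: measurableI.
      + by apply: measurableI => //; exact: measurableC.
      + by apply/measurable_EFinP/measurable_funTS; exact: lg.1.
      + by rewrite disj_set2E setIACA setICr set0I.
    - move=> F mF tF F0; rewrite setI_bigcupl integral_bigcup.
      + by rewrite eseries0// => i _ _; rewrite F0.
      + by apply: trivIset_setIr.
      + by move=> k; apply: measurableI.
      + apply: (integrableS _ _ _ iB) => //.
          by apply: bigcupT_measurable => k; apply: measurableI.
        by move=> x [k _ []].
  have := @integral_ae_eq _ _ _ (leb2 R) B mB (cst 0%E) (EFin \o g) iB (measurable_cst _).
  have H E : E `<=` B -> measurable (E : set T) ->
    (\int[leb2 R]_(x in E) (EFin \o g) x = \int[leb2 R]_(x in E) cst 0 x)%E.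
    by move=> EB mE; rewrite integral0 -(setIidl EB); exact: P.
  by move=> /(_ H); apply: filterS => x /= + Bx => /(_ Bx) [].
have /ae_foralln := box0; apply: filterS => x H.
apply: (H (Num.truncn `|x|).+1); apply/in_obox.
have xl : `|x| < (Num.truncn `|x|).+1%:R by exact: truncnS_gt.
have : `|x.1| < (Num.truncn `|x|).+1%:R by rewrite (le_lt_trans _ xl)// [leRHS]prod_normE le_max lexx.
have : `|x.2| < (Num.truncn `|x|).+1%:R by rewrite (le_lt_trans _ xl)// [leRHS]prod_normE le_max lexx orbT.
by rewrite !ltr_norml => /andP[? ?] /andP[? ?].
Qed.

End fundamental_lemma.

(** * Square integrable functions and weak gradients *)

Section ae_plane.
Context {R : realType}.

Lemma ae2S (P Q : R * R -> Prop) : (forall x, P x -> Q x) ->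
  {ae leb2 R, forall x, P x} -> {ae leb2 R, forall x, Q x}.
Proof. by move=> PQ; exact: (@filterS _ _ (ae_filter_ringOfSetsType (leb2 R))). Qed.

Lemma ae2I (P Q : R * R -> Prop) : {ae leb2 R, forall x, P x} ->
  {ae leb2 R, forall x, Q x} -> {ae leb2 R, forall x, P x /\ Q x}.
Proof. exact: (@filterI _ _ (ae_filter_ringOfSetsType (leb2 R))). Qed.

End ae_plane.

Section L2_plane.
Context {R : realType}.
Let T : measurableType _ := (measurableTypeR R * measurableTypeR R)%type.
Local Notation mu := (leb2 R).
Implicit Types (f g u v phi : R * R -> R).

Lemma L2P f : L2 f <-> measurable_fun (setT : set T) (f : T -> R) /\
  (\int[mu]_x (f x ^+ 2)%:E < +oo)%E.
Proof.
split.
- move=> f2; split; first by move: f2; rewrite /L2 /= inE => /andP[]; rewrite inE.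
  have /integrableP[_] := Lfun2_integrable_sqr f2; apply: le_lt_trans.
  by apply: ge0_le_integral => //=; [move=> x _; rewrite lee_fin sqr_ge0|
    apply/measurable_EFinP/measurable_funX; move: f2; rewrite /L2 /= inE => /andP[]; rewrite inE|
    apply/measurable_EFinP/measurableT_comp => //; apply/measurable_funX; move: f2; rewrite /L2 /= inE => /andP[]; rewrite inE|
    move=> x _; rewrite lee_fin ler_norm].
- move=> [mf f2]; rewrite /L2 /= inE; apply/andP; split; rewrite inE//=.
  rewrite /finite_norm unlock; apply: poweR_lty.
  apply: le_lt_trans f2; rewrite le_eqVlt; apply/orP; left; apply/eqP.
  apply: eq_integral => x _; rewrite poweR_EFin; congr (_%:E).
  by rewrite powR_mulrn// real_normK// num_real.
Qed.

Lemma L2_measurable f : L2 f -> measurable_fun (setT : set T) (f : T -> R).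
Proof. by case/L2P. Qed.

Lemma L2_sqr_integrable f : L2 f -> mu.-integrable setT (fun x => (f x ^+ 2)%:E).
Proof. exact: Lfun2_integrable_sqr. Qed.

Lemma L2M_integrable f g : L2 f -> L2 g -> mu.-integrable setT (fun x => (f x * g x)%:E).
Proof. by move=> f2 g2; have /Lfun1_integrable := Lfun2_mul_Lfun1 f2 g2. Qed.

Lemma L2_le f g : measurable_fun (setT : set T) (f : T -> R) -> L2 g ->
  (forall x, `|f x| <= `|g x|) -> L2 f.
Proof.
move=> mf /L2P[mg g2] fg; apply/L2P; split=> //; apply: le_lt_trans g2.
apply: ge0_le_integral => //=.
- by move=> x _; rewrite lee_fin sqr_ge0.
- by apply/measurable_EFinP/measurable_funX.
- by apply/measurable_EFinP/measurable_funX.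
- move=> x _; rewrite lee_fin -(real_normK (num_real (f x))) -(real_normK (num_real (g x))).
  by rewrite ler_pXn2r// nnegrE.
Qed.

Lemma L2D f g : L2 f -> L2 g -> L2 (fun x => f x + g x).
Proof.
have l12 : (1 <= 2%:E :> \bar R)%E by rewrite lee_fin ler1n.
exact: (Lfun_addr_closed mu l12).2.
Qed.

Lemma L2Z (a : R) f : L2 f -> L2 (fun x => a * f x).
Proof.
have h12 : 1 <= 2 :> R by rewrite ler1n.
move=> f2; have -> : (fun x => a * f x) = a \o* f by apply/funext => x; rewrite /= mulrC.
exact: (Lfun_scale a h12 f2).
Qed.

Lemma L2B f g : L2 f -> L2 g -> L2 (fun x => f x - g x).
Proof.
move=> f2 g2; have := L2D f2 (L2Z (-1) g2).
by under [X in L2 X -> _]eq_fun do rewrite mulN1r.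
Qed.

Lemma L2_ae_eq f g : L2 f -> measurable_fun (setT : set T) (g : T -> R) ->
  {ae mu, forall x, f x = g x} -> L2 g.
Proof.
move=> /L2P[mf f2] mg fg; apply/L2P; split=> //; apply: le_lt_trans f2.
rewrite le_eqVlt; apply/orP; left; apply/eqP; apply: ae_eq_integral => //.
- by apply/measurable_EFinP/measurable_funX.
- by apply/measurable_EFinP/measurable_funX.
- by move: fg; apply: ae2S => x /= -> _.
Qed.

Lemma L2_measure_preserving f (A : R * R -> R * R) : measure_preserving mu A ->
  L2 f -> L2 (f \o A).
Proof.
move=> mpA /L2P[mf f2]; apply/L2P; split.
  by apply: measurableT_comp => //; have [] := mpA.
have := @integral_measure_preserving _ _ _ mu A (fun x => (f x ^+ 2)%:E) mpA.
by move=> -> //; apply/measurable_EFinP/measurable_funX.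
Qed.

Lemma compact_leb2_lty (K : set (R * R)) : compact K -> (mu K < +oo)%E.
Proof.
move=> cK; have mK := compact_measurable_plane cK.
have [M [Mr HM]] := compact_bounded cK.
pose N := Num.max M 0 + 1.
have KB : K `<=` obox (- N - 1) (N + 1) (- N - 1) (N + 1).
  move=> x Kx; have NM : M < N by rewrite /N (@le_lt_trans _ _ (Num.max M 0)) ?ltrDl// le_max lexx.
  have xN := HM _ NM _ Kx.
  apply/in_obox.
  have : `|x.1| <= N by rewrite (le_trans _ xN)// [leRHS]prod_normE le_max lexx.
  have : `|x.2| <= N by rewrite (le_trans _ xN)// [leRHS]prod_normE le_max lexx orbT.
  by rewrite !ler_norml => /andP[? ?] /andP[? ?]; split; lra.
apply: (@le_lt_trans _ _ (mu (obox (- N - 1) (N + 1) (- N - 1) (N + 1)))).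
  by apply: le_measure => //; rewrite inE//; exact: measurable_obox.
set I := `](- N - 1), (N + 1)[%classic.
have -> : mu (I `*` I) = (@lebesgue_measure R I * @lebesgue_measure R I)%E.
  by rewrite /leb2 [LHS]product_measure1E//; exact: measurable_itv.
by rewrite !lebesgue_measure_itv/=; case: ifP => _; rewrite ?mul0e// -EFinB -EFinM ltry.
Qed.

Lemma L2_locally_integrable f : L2 f -> locally_integrable2 f.
Proof.
move=> f2; split; first exact: (L2_measurable f2).
move=> K cK; have mK := compact_measurable_plane cK.
have mf := L2_measurable f2.
(* 1 + f^2 dominates |f| and is integrable on K because K has finite measure. *)
apply: (@le_integrable _ _ _ mu K mK _ (fun x => (1 + f x ^+ 2)%:E)).
- exact/measurable_EFinP/measurable_funTS.
- move=> x _; rewrite /= lee_fin (ger0_norm (_ : 0 <= 1 + f x ^+ 2)); last by rewrite addr_ge0// sqr_ge0.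
  by rewrite -(real_normK (num_real (f x))); have := normr_ge0 (f x); nra.
- under eq_fun do rewrite EFinD.
  apply: integrableD => //.
    apply/integrableP; split; first exact/measurable_EFinP/measurable_cst.
    by rewrite /= integral_cst//= normr1 mul1e; exact: compact_leb2_lty.
  by apply: (integrableS _ _ _ (L2_sqr_integrable f2)).
Qed.

Lemma L2_bounded_compact f (K : set (R * R)) (M : R) :
  measurable_fun (setT : set T) (f : T -> R) -> compact K ->
  (forall x, ~ K x -> f x = 0) -> (forall x, `|f x| <= M) -> L2 f.
Proof.
move=> mf cK fK fM; apply/L2P; split=> //.
have mK := compact_measurable_plane cK.
apply: (@le_lt_trans _ _ (\int[mu]_(x in K) (M ^+ 2)%:E)%E).
  rewrite [leRHS]integral_mkcond; apply: ge0_le_integral => //=.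
  - by move=> x _; rewrite lee_fin sqr_ge0.
  - by apply/measurable_EFinP/measurable_funX.
  - by apply/(measurable_restrictT _ mK).
  - move=> x _; rewrite /patch; case: ifPn => [_|].
      rewrite lee_fin -(real_normK (num_real (f x))) ler_pXn2r// nnegrE//.
      by rewrite (le_trans _ (fM x)).
    by rewrite notin_setE => /fK ->; rewrite expr0n.
rewrite integral_cst// lte_mul_pinfty ?lee_fin ?sqr_ge0//.
exact: compact_leb2_lty.
Qed.

Lemma test_function_L2 phi : test_function phi -> L2 phi.
Proof.
move=> tphi; have [K cK phiK] := test_function_support tphi.
have [M HM] := test_function_bounded tphi.
exact: L2_bounded_compact (test_function_measurable tphi) cK phiK HM.
Qed.

End L2_plane.

(* leb2 R is declared as a plain measure; this copy also carries the
   sigma-finite structure that Tonelli's theorem asks for. *)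
Definition plane_measure (R : realType) :
  set (measurableTypeR R * measurableTypeR R) -> \bar R := leb2 R.

HB.instance Definition _ (R : realType) := Measure.copy (@plane_measure R) (leb2 R).

Lemma sigma_finite_plane_measure (R : realType) : sigma_finite setT (@plane_measure R).
Proof.
exists (fun n => `](- n%:R), n%:R[%classic `*` `](- n%:R), n%:R[%classic).
  apply/esym; rewrite -subTset => x _; exists (Num.truncn `|x : R * R|).+1 => //.
  have xl : `|x : R * R| < (Num.truncn `|x : R * R|).+1%:R by exact: truncnS_gt.
  split; rewrite /= in_itv /= -ltr_norml (le_lt_trans _ xl)// [leRHS]prod_normE le_max lexx//.
  by rewrite orbT.
move=> n; split; first exact: measurableX.
rewrite /plane_measure /leb2.
set I := `](- n%:R), n%:R[%classic.
have -> : leb2 R (I `*` I) = (@lebesgue_measure R I * @lebesgue_measure R I)%E.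
  by rewrite /leb2 [LHS]product_measure1E//; exact: measurable_itv.
by rewrite !lebesgue_measure_itv/=; case: ifP => _; rewrite ?mul0e// -EFinB -EFinM ltry.
Qed.

HB.instance Definition _ (R : realType) :=
  Measure_isSigmaFinite.Build _ _ _ (@plane_measure R) (sigma_finite_plane_measure R).

(** * Weak partial derivatives and their behaviour under rotations *)

Section weak_partial.
Context {R : realType}.
Let T : measurableType _ := (measurableTypeR R * measurableTypeR R)%type.
Local Notation mu := (leb2 R).
Local Notation e1 := (@e1 R).
Local Notation e2 := (@e2 R).
Hint Resolve e1_in e2_in : core.
Implicit Types (f g h u v phi : R * R -> R).

Lemma eq_L2 f g : f =1 g -> L2 f -> L2 g.
Proof. by move=> /funext ->. Qed.

Lemma locally_integrable2_measurable f : locally_integrable2 f ->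
  measurable_fun (setT : set T) (f : T -> R).
Proof. by case. Qed.

Lemma measurable_dtheta g1 g2 : measurable_fun (setT : set T) (g1 : T -> R) ->
  measurable_fun (setT : set T) (g2 : T -> R) ->
  measurable_fun (setT : set T) ((fun x => x.1 * g2 x - x.2 * g1 x) : T -> R).
Proof.
have m1 : measurable_fun (setT : set T) (fst : T -> R) by exact: measurable_fst.
have m2 : measurable_fun (setT : set T) (snd : T -> R) by exact: measurable_snd.
move=> mg1 mg2.
exact: (measurable_funB (measurable_funM m1 mg2) (measurable_funM m2 mg1)).
Qed.

Lemma locally_integrable2_comb (a b : R) f g : locally_integrable2 f ->
  locally_integrable2 g -> locally_integrable2 (fun x => a * f x + b * g x).
Proof.
move=> [mf lf] [mg lg]; split.
  by apply: measurable_funD; apply: measurable_funM.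
move=> K cK; have mK := compact_measurable_plane cK.
have -> : EFin \o (fun x => a * f x + b * g x) =
    (fun x => a%:E * (f x)%:E + b%:E * (g x)%:E)%E.
  by apply/funext => x; rewrite /= EFinD !EFinM.
by apply: integrableD => //; apply: integrableZl => //; [exact: lf|exact: lg].
Qed.

Lemma integrable_EFinZl (a : R) f : mu.-integrable setT (EFin \o f) ->
  mu.-integrable setT (EFin \o (fun x => a * f x)).
Proof. by move=> ?; exact: (@integrableZl _ _ _ mu setT measurableT a (EFin \o f)). Qed.

Lemma Rintegral_comb_test (a b : R) f g phi : locally_integrable2 f ->
  locally_integrable2 g -> test_function phi ->
  \int[mu]_x ((a * f x + b * g x) * phi x) =
  a * \int[mu]_x (f x * phi x) + b * \int[mu]_x (g x * phi x).
Proof.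
move=> lf lg tphi.
have If := integrable_locally_test lf tphi.
have Ig := integrable_locally_test lg tphi.
under eq_Rintegral do rewrite mulrDl -!mulrA.
rewrite RintegralD//; last 2 first.
- exact: integrable_EFinZl.
- exact: integrable_EFinZl.
by rewrite !RintegralZl.
Qed.

Lemma is_weak_partial_comb e (a b : R) u v g h : e \in [:: e1; e2] ->
  is_weak_partial e u g ->
  is_weak_partial e v h ->
  is_weak_partial e (fun x => a * u x + b * v x) (fun x => a * g x + b * h x).
Proof.
move=> ein [lu lg ug] [lv lh vh]; split; try exact: locally_integrable2_comb.
move=> phi tphi.
by rewrite !Rintegral_comb_test ?ug ?vh//; [ring|exact: test_function_derive].
Qed.

Lemma is_weak_partialB e u v g h : e \in [:: e1; e2] ->
  is_weak_partial e u g -> is_weak_partial e v h ->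
  is_weak_partial e (fun x => u x - v x) (fun x => g x - h x).
Proof.
move=> ein ug vh; have := is_weak_partial_comb 1 (-1) ein ug vh.
have E (f f' : R * R -> R) : (fun x => 1 * f x + -1 * f' x) = (fun x => f x - f' x).
  by apply/funext => x; rewrite mul1r mulN1r.
by rewrite !E.
Qed.

Lemma is_weak_partial_unique e u g h :
  is_weak_partial e u g -> is_weak_partial e u h ->
  {ae mu, forall x, g x = h x}.
Proof.
move=> [lu lg ug] [_ lh uh].
have := @ae_eq0_test_functions _ (fun x => 1 * g x + -1 * h x)
  (locally_integrable2_comb 1 (-1) lg lh).
move=> H; apply: ae2S (H _).
  by move=> x /eqP; rewrite mul1r mulN1r subr_eq0 => /eqP.
move=> phi tphi; rewrite Rintegral_comb_test// mul1r mulN1r.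
by apply/eqP; rewrite subr_eq0 -eqr_opp -ug// -uh.
Qed.

Lemma weak_partialP e u g : is_weak_partial e u g ->
  is_weak_partial e u (weak_partial e u) /\
  {ae mu, forall x, weak_partial e u x = g x}.
Proof.
move=> ug; have H : is_weak_partial e u (weak_partial e u).
  by apply: (@xgetPex _ (cst 0) [set g | is_weak_partial e u g]); exists g.
by split=> //; exact: is_weak_partial_unique H ug.
Qed.

(** Membership in H with explicit representatives of the gradient. Rotations and differences
    transform these by exact formulas, whereas [weak_partial] follows such formulas only almost
    everywhere. *)
Definition has_H_gradient u g1 g2 : Prop :=
  [/\ L2 u, is_weak_partial e1 u g1, is_weak_partial e2 u g2,
      L2 g1 /\ L2 g2 & L2 (fun x => x.1 * g2 x - x.2 * g1 x)].

Lemma spaceH_gradient u : spaceH u ->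
  has_H_gradient u (weak_partial e1 u) (weak_partial e2 u).
Proof.
move=> [[u2 ug] du]; have [g1 ug1 g12] := ug _ e1_in; have [g2 ug2 g22] := ug _ e2_in.
have [w1 E1] := weak_partialP ug1; have [w2 E2] := weak_partialP ug2.
split=> //; split.
- apply: (L2_ae_eq g12); first by have [_ []] := w1.
  by apply: ae2S E1 => x ->.
- apply: (L2_ae_eq g22); first by have [_ []] := w2.
  by apply: ae2S E2 => x ->.
Qed.

Lemma has_H_gradient_spaceH u g1 g2 : has_H_gradient u g1 g2 -> spaceH u /\
  {ae mu, forall x, weak_partial e1 u x = g1 x /\ weak_partial e2 u x = g2 x}.
Proof.
move=> [u2 ug1 ug2 [g12 g22] th].
have [w1 E1] := weak_partialP ug1; have [w2 E2] := weak_partialP ug2.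
have E := ae2I E1 E2; split=> //; split.
  split=> // e; rewrite !inE => /orP[] /eqP ->; [by exists g1|by exists g2].
apply: (L2_ae_eq th).
  have [_ /locally_integrable2_measurable m1 _] := w1.
  have [_ /locally_integrable2_measurable m2 _] := w2.
  exact: measurable_dtheta.
by apply: ae2S E => x [E1' E2']; rewrite /dtheta E1' E2'.
Qed.

Lemma has_H_gradientB u v g1 g2 h1 h2 : has_H_gradient u g1 g2 ->
  has_H_gradient v h1 h2 ->
  has_H_gradient (fun x => u x - v x) (fun x => g1 x - h1 x) (fun x => g2 x - h2 x).
Proof.
move=> [u2 ug1 ug2 [g12 g22] thu] [v2 vh1 vh2 [h12 h22] thv].
split; [exact: L2B|exact: (is_weak_partialB e1_in ug1 vh1)|
  exact: (is_weak_partialB e2_in ug2 vh2)|by split; exact: L2B|].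
by apply: eq_L2 (L2B thu thv) => x; ring.
Qed.

Lemma Rintegral_measure_preserving f (A : R * R -> R * R) : measure_preserving mu A ->
  measurable_fun (setT : set T) (f : T -> R) ->
  \int[mu]_x f (A x) = \int[mu]_x f x.
Proof.
move=> mpA mf; rewrite /Rintegral; congr fine.
exact: (@integral_measure_preserving _ _ _ mu A (EFin \o f) mpA (measurableT_comp _ mf)).
Qed.

Section rotate.
Variables c s : R.
Hypothesis cs1 : c ^+ 2 + s ^+ 2 = 1.
Local Notation rot := (rotate c s).
Local Notation rot' := (rotate c (- s)).

Lemma rotateK : cancel rot rot'.
Proof.
move=> [x y]; rewrite /rotate /=; congr pair.
  by transitivity ((c ^+ 2 + s ^+ 2) * x); [ring|rewrite cs1 mul1r].
by transitivity ((c ^+ 2 + s ^+ 2) * y); [ring|rewrite cs1 mul1r].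
Qed.

Lemma rotate_e1 x (h : R) : rot (h *: e1 + x) = h *: (c, s) + rot x.
Proof.
rewrite scale_e1 /rotate /=; congr pair.
  by rewrite -[RHS]/(h * c + _) /=; ring.
by rewrite -[RHS]/(h * s + _) /=; ring.
Qed.

Lemma rotate_e2 x (h : R) : rot (h *: e2 + x) = h *: (- s, c) + rot x.
Proof.
rewrite scale_e2 /rotate /=; congr pair.
  by rewrite -[RHS]/(h * - s + _) /=; ring.
by rewrite -[RHS]/(h * c + _) /=; ring.
Qed.

Lemma continuous_rotate : continuous rot.
Proof.
move=> x.
have H1 : (c * y.1 - s * y.2) @[y --> x] --> c * x.1 - s * x.2.
  apply: cvgD; first by apply: cvgM; [exact: cvg_cst|exact: cvg_fst].
  by apply: cvgN; apply: cvgM; [exact: cvg_cst|exact: cvg_snd].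
have H2 : (s * y.1 + c * y.2) @[y --> x] --> s * x.1 + c * x.2.
  by apply: cvgD; apply: cvgM; [exact: cvg_cst|exact: cvg_fst|exact: cvg_cst|exact: cvg_snd].
exact: (cvg_pair H1 H2).
Qed.

Lemma derive_rotate phi : smooth phi ->
  'D_e1 (phi \o rot) = (fun x => c * 'D_e1 phi (rot x) + s * 'D_e2 phi (rot x)) /\
  'D_e2 (phi \o rot) = (fun x => - s * 'D_e1 phi (rot x) + c * 'D_e2 phi (rot x)).
Proof.
move=> sphi; split; apply/funext => x.
  by have [_ ->] := derive_along phi (rotate_e1 x); rewrite smooth_deriveE.
by have [_ ->] := derive_along phi (rotate_e2 x); rewrite smooth_deriveE.
Qed.

End rotate.

Lemma test_function_rotate phi c s : c ^+ 2 + s ^+ 2 = 1 -> test_function phi ->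
  test_function (phi \o rotate c s).
Proof.
move=> cs1 tphi; apply: (test_function_comp tphi (@continuous_rotate c s)
  (@continuous_rotate c (- s)) (rotateK cs1) (@rotate_e1 c s) (@rotate_e2 c s)).
Qed.

(** Change of variables moves the rotation onto the test function; p and q in [main] are the
    coordinates of the rotated axis, so that both axes are treated at once. *)
Lemma is_weak_partial_rotate u g1 g2 c s : c ^+ 2 + s ^+ 2 = 1 -> L2 u -> L2 g1 -> L2 g2 ->
  is_weak_partial e1 u g1 -> is_weak_partial e2 u g2 ->
  is_weak_partial e1 (u \o rotate c s) (fun x => c * g1 (rotate c s x) + s * g2 (rotate c s x)) /\
  is_weak_partial e2 (u \o rotate c s) (fun x => - s * g1 (rotate c s x) + c * g2 (rotate c s x)).
Proof.
move=> cs1 u2 g12 g22 ug1 ug2; have mp := measure_preserving_rotate cs1.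
have cs1' : c ^+ 2 + (- s) ^+ 2 = 1 by rewrite sqrrN.
have main e p q :
    (forall psi, smooth psi -> 'D_e (psi \o rotate c s) =
       (fun x => p * 'D_e1 psi (rotate c s x) + q * 'D_e2 psi (rotate c s x))) ->
    is_weak_partial e (u \o rotate c s)
      (fun x => p * g1 (rotate c s x) + q * g2 (rotate c s x)).
  move=> De; have comb2 : L2 (fun x => p * g1 x + q * g2 x) by apply: L2D; exact: L2Z.
  have mcomb := L2_measurable comb2; have mu_ := L2_measurable u2.
  split.
  - exact/L2_locally_integrable/L2_measure_preserving.
  - exact: (L2_locally_integrable (L2_measure_preserving mp comb2)).
  move=> phi tphi; pose psi := phi \o rotate c (- s).
  have tpsi : test_function psi by exact: test_function_rotate.
  have phiE : phi = psi \o rotate c s.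
    by apply/funext => x; rewrite /psi /= rotateK.
  have mpsi := test_function_measurable tpsi.
  have td1 := test_function_derive tpsi e1_in.
  have td2 := test_function_derive tpsi e2_in.
  have md1 := test_function_measurable td1.
  have md2 := test_function_measurable td2.
  have De' x : 'D_e phi x = p * 'D_e1 psi (rotate c s x) + q * 'D_e2 psi (rotate c s x).
    by rewrite [in LHS]phiE; have /(congr1 (@^~ x)) := De _ tpsi.1.
  under eq_Rintegral do rewrite De'.
  rewrite (@Rintegral_measure_preserving
    (fun x => u x * (p * 'D_e1 psi x + q * 'D_e2 psi x)) _ mp); last first.
    have m1 := measurable_funM (measurable_cst p) md1.
    have m2 := measurable_funM (measurable_cst q) md2.
    exact: (measurable_funM mu_ (measurable_funD m1 m2)).
  transitivity (- \int[mu]_x ((p * g1 x + q * g2 x) * psi x)); last first.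
    congr (- _); rewrite phiE.
    rewrite (@Rintegral_measure_preserving
      (fun x => (p * g1 x + q * g2 x) * psi x) _ mp)//.
    exact: measurable_funM.
  have [_ lg1 E1] := ug1; have [_ lg2 E2] := ug2.
  rewrite Rintegral_comb_test//.
  have Iu f : test_function f -> mu.-integrable setT (EFin \o (fun x => u x * f x)).
    by move=> tf; apply: integrable_locally_test => //; exact: L2_locally_integrable.
  have I1 := Iu _ td1; have I2 := Iu _ td2.
  transitivity (\int[mu]_x (p * (u x * 'D_e1 psi x) + q * (u x * 'D_e2 psi x))).
    by apply: eq_Rintegral => x _; rewrite mulrDr !(mulrCA (u x)).
  rewrite (RintegralD measurableT (integrable_EFinZl p I1) (integrable_EFinZl q I2)).
  rewrite (RintegralZl p measurableT I1) (RintegralZl q measurableT I2).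
  by rewrite (E1 _ tpsi) (E2 _ tpsi) !mulrN opprD.
by split; apply: main => psi spsi; have [] := derive_rotate c s spsi.
Qed.

Lemma has_H_gradient_rotate u g1 g2 c s : c ^+ 2 + s ^+ 2 = 1 -> has_H_gradient u g1 g2 ->
  has_H_gradient (u \o rotate c s)
    (fun x => c * g1 (rotate c s x) + s * g2 (rotate c s x))
    (fun x => - s * g1 (rotate c s x) + c * g2 (rotate c s x)).
Proof.
move=> cs1 [u2 ug1 ug2 [g12 g22] thu]; have mp := measure_preserving_rotate cs1.
have [w1 w2] := is_weak_partial_rotate cs1 u2 g12 g22 ug1 ug2.
split=> //.
- exact: L2_measure_preserving.
- have g12' := L2_measure_preserving mp g12; have g22' := L2_measure_preserving mp g22.
  by split; apply: L2D; exact: L2Z.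
(* Rotations commute with the angular derivative: the angular derivative of the rotated function is
   the rotated angular derivative. *)
- by apply: eq_L2 (L2_measure_preserving mp thu) => x; rewrite /rotate /=; ring.
Qed.

End weak_partial.

(** * Weak derivatives along flows *)

Section flow.
Context {R : realType}.
Let T : measurableType _ := (measurableTypeR R * measurableTypeR R)%type.
Let R1 : measurableType _ := measurableTypeR R.
Local Notation leb := (@lebesgue_measure R).
Local Notation mus := (@plane_measure R).
Local Notation mu := (leb2 R).
Implicit Types (f g h u v phi a : R * R -> R) (s t : R).

(** Time integrals over [0, s] are written over the whole line against the indicator of this set, so
    that Tonelli and Fubini apply on a full product space. *)
Definition window s : set R := `[0, s]%classic.

Lemma measurable_window s : measurable (window s : set R1).
Proof. exact: measurable_itv. Qed.

Lemma integral_window s (f : R -> R) :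
  (\int[leb]_t (\1_(window s) t * f t)%:E = \int[leb]_(t in `[0%R, s]) (f t)%:E)%E.
Proof.
rewrite [RHS]integral_mkcond; apply: eq_integral => t _.
rewrite /patch indicE /window; case: ifPn => _; first by rewrite mul1r.
by rewrite mul0r.
Qed.

Lemma lebesgue_window s : 0 <= s -> leb (window s) = s%:E.
Proof.
move=> s0; have -> := lebesgue_measure_itv `[0, s]; rewrite /= lte_fin.
case: ltP; first by rewrite sube0.
by move=> s0'; rewrite (@le_anti _ _ s 0) // s0 s0'.
Qed.

(** The product is bounded by a^2 + (g \o Psi t)^2. As each Psi t preserves measure, every time
    slice contributes at most the same finite amount A + B, and the window has length s. *)
Lemma flow_integrable (Psi : R -> R * R -> R * R) a g s :
  measurable_fun (setT : set (T * R1)) ((fun p => Psi p.2 p.1) : T * R1 -> T) ->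
  (forall t, measure_preserving mu (Psi t)) -> 0 <= s -> L2 a -> L2 g ->
  (mus \x leb)%E.-integrable setT
    (fun p => (a p.1 * (\1_(window s) p.2 * g (Psi p.2 p.1)))%:E).
Proof.
move=> mPsi mpPsi s0 a2 g2.
have ma := L2_measurable a2; have mg := L2_measurable g2.
have mW := measurable_window s.
have mF : measurable_fun (setT : set (T * R1))
    (fun p => (a p.1 * (\1_(window s) p.2 * g (Psi p.2 p.1)))%:E).
  apply/measurable_EFinP; apply: measurable_funM.
    exact: (measurableT_comp ma measurable_fst).
  apply: measurable_funM; last exact: (measurableT_comp mg mPsi).
  exact: (measurableT_comp (measurable_indic mW) measurable_snd).
have fin := @integrable21ltyP _ _ T R1 R mus leb _ mF. apply/fin.
pose A := (\int[mu]_x (a x ^+ 2)%:E)%E; pose B := (\int[mu]_x (g x ^+ 2)%:E)%E.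
have A0 : (0 <= A)%E by apply: integral_ge0 => x _; rewrite lee_fin sqr_ge0.
have B0 : (0 <= B)%E by apply: integral_ge0 => x _; rewrite lee_fin sqr_ge0.
have Aoo : (A < +oo)%E by have /L2P[] := a2.
have Boo : (B < +oo)%E by have /L2P[] := g2.
apply: (@le_lt_trans _ _ (\int[leb]_(t in window s) (A + B))%E); last first.
  have ABfin : (A + B)%E \is a fin_num by rewrite fin_numD !ge0_fin_numE ?Aoo ?Boo.
  have -> : (\int[leb]_(t in window s) (A + B) = (A + B) * s%:E)%E.
    by rewrite integral_cst//; congr (_ * _)%E; exact: lebesgue_window.
  by rewrite -(fineK ABfin) -EFinM ltry.
rewrite [leRHS]integral_mkcond; apply: ge0_le_integral => //=.
- by move=> t _; apply: integral_ge0 => x _.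
- pose H := (abse \o (fun p : T * R1 => (a p.1 * (\1_(window s) p.2 * g (Psi p.2 p.1)))%:E)).
  have mH : measurable_fun setT H by exact: measurableT_comp.
  have H0 x : (0 <= H x)%E by exact: abse_ge0.
  exact: (@measurable_fun_fubini_tonelli_G _ _ T R1 R mus H mH H0).
- by apply/(measurable_restrictT _ mW).
move=> t _; rewrite /patch indicE; case: ifPn => tw; last first.
  by rewrite integral0_eq// => x _; rewrite mul0r mulr0 normr0.
have -> : B = (\int[mu]_x (g (Psi t x) ^+ 2)%:E)%E.
  rewrite (@integral_measure_preserving _ _ _ mu (Psi t) (fun x => (g x ^+ 2)%:E))//.
  exact/measurable_EFinP/measurable_funX.
have mgt : measurable_fun (setT : set T) ((fun x => g (Psi t x)) : T -> R).
  by apply: (measurableT_comp mg); have [] := mpPsi t.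
rewrite -ge0_integralD//; last 4 first.
- by move=> x _; rewrite lee_fin sqr_ge0.
- by apply/measurable_EFinP/measurable_funX.
- by move=> x _; rewrite lee_fin sqr_ge0.
- by apply/measurable_EFinP/measurable_funX.
apply: ge0_le_integral => //=.
- apply/measurable_EFinP/measurableT_comp => //.
  by apply: measurable_funM => //; apply: measurable_funM.
- by apply: emeasurable_funD; apply/measurable_EFinP/measurable_funX.
- move=> x _; rewrite mul1r normrM -EFinD lee_fin.
  rewrite -(real_normK (num_real (a x))) -(real_normK (num_real (g _))).
  have := sqr_ge0 (`|a x| - `|g (Psi t x)|).
  have := normr_ge0 (a x); have := normr_ge0 (g (Psi t x)); nra.
Qed.

(* Phi is the flow of the vector field acting on test functions as X. *)
Record plane_flow (Phi : R -> R * R -> R * R) (X : (R * R -> R) -> R * R -> R) : Prop := {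
  flow_measurable :
    measurable_fun (setT : set (T * R1)) ((fun p => Phi p.2 p.1) : T * R1 -> T) ;
  flow_preserving : forall t, measure_preserving mu (Phi t) ;
  flowK : forall t, cancel (Phi t) (Phi (- t)) ;
  flow0 : forall x, Phi 0 x = x ;
  flow_test : forall phi t, test_function phi -> test_function (phi \o Phi t) ;
  field_test : forall phi, test_function phi -> test_function (X phi) ;
  field_flow : forall phi t x, test_function phi -> X (phi \o Phi t) x = X phi (Phi t x) ;
  flow_is_derive : forall phi x t, test_function phi ->
    is_derive t 1 (fun t => phi (Phi t x)) (X phi (Phi t x)) }.

Section flow_FTC.
Variables (Phi : R -> R * R -> R * R) (X : (R * R -> R) -> R * R -> R).
Hypothesis flowP : plane_flow Phi X.

(** The flow runs backwards because, in the weak formula, the flow of g is moved onto the test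
    function. *)
Lemma flow_FTC phi x s : 0 < s -> test_function phi ->
  (\int[leb]_t (\1_(window s) t * X phi (Phi (- t) x))%:E =
    (phi x - phi (Phi (- s) x))%:E)%E.
Proof.
move=> s0 tphi; rewrite integral_window.
pose F t := - phi (Phi (- t) x).
have dF t : is_derive t 1 F (X phi (Phi (- t) x)).
  have d1 := flow_is_derive flowP x (- t) tphi.
  have d2 : is_derive t 1 ((fun t => phi (Phi t x)) \o -%R) (X phi (Phi (- t) x) * -1).
    exact: is_derive1_comp.
  apply: (is_derive_eq (is_deriveN d2)).
  by rewrite mulrN1 opprK.
have cX : continuous (fun t => X phi (Phi (- t) x)).
  move=> t; apply: (@continuous_comp _ _ _ -%R (fun t => X phi (Phi t x))).
    exact: opp_continuous.
  apply/differentiable_continuous/derivable1_diffP.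
  by have [] := flow_is_derive flowP x (- t) (field_test flowP tphi).
have cF : continuous F.
  by move=> t; apply/differentiable_continuous/derivable1_diffP; have [] := dF t.
rewrite (@continuous_FTC2 _ (fun t => X phi (Phi (- t) x)) F 0 s s0); first last.
- by move=> t _; rewrite derive1E; have [] := dF t.
- split; first by move=> t _; have [] := dF t.
  + exact/cvg_at_right_filter/cF.
  + exact/cvg_at_left_filter/cF.
- exact: continuous_subspaceT.
by rewrite /F oppr0 (flow0 flowP) -EFinB opprK addrC.
Qed.

End flow_FTC.
End flow.

Section measurable_parametric_integral.
Context {d1 d2 : measure_display} {T1 : measurableType d1} {T2 : measurableType d2} {R : realType}.
Variable m2 : {sigma_finite_measure set T2 -> \bar R}.

(** Tonelli handles the positive and the negative part separately, and [fine] is measurable, so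
    sections of infinite integral do no harm. *)
Lemma measurable_Rintegral_section (F : T1 * T2 -> R) :
  measurable_fun (setT : set (T1 * T2)) F ->
  measurable_fun (setT : set T1) (fun x => \int[m2]_y F (x, y)).
Proof.
move=> mF; rewrite /Rintegral.
have mF' : measurable_fun (setT : set (T1 * T2)) (EFin \o F) by exact/measurable_EFinP.
have mfine : measurable_fun setT (fun x : T1 => \int[m2]_y (F (x, y))%:E)%E.
  have -> : (fun x : T1 => \int[m2]_y (F (x, y))%:E)%E =
     (fun x => \int[m2]_y ((EFin \o F)^\+ (x, y)) - \int[m2]_y ((EFin \o F)^\- (x, y)))%E.
    apply/funext => x; rewrite integralE; congr (_ - _)%E.
    - by apply: eq_integral => t _; rewrite !funeposE.
    - by apply: eq_integral => t _; rewrite !funenegE.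
  apply: emeasurable_funB.
  - have H0 p : (0 <= (EFin \o F)^\+ p)%E by [].
    exact: (@measurable_fun_fubini_tonelli_F _ _ T1 T2 R m2 _ (measurable_funepos mF') H0).
  - have H0 p : (0 <= (EFin \o F)^\- p)%E by [].
    exact: (@measurable_fun_fubini_tonelli_F _ _ T1 T2 R m2 _ (measurable_funeneg mF') H0).
exact: (measurableT_comp (fine_measurable measurableT) mfine).
Qed.

End measurable_parametric_integral.

(** * Time averages along a measure-preserving family of maps *)

Section flow_formula.
Context {R : realType}.
Let T : measurableType _ := (measurableTypeR R * measurableTypeR R)%type.
Let R1 : measurableType _ := measurableTypeR R.
Local Notation leb := (@lebesgue_measure R).
Local Notation mus := (@plane_measure R).
Local Notation mu := (leb2 R).
Implicit Types (f g h u v phi a : R * R -> R) (s t : R).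

Lemma L2M_EFin f g : L2 f -> L2 g ->
  (\int[mu]_x (f x * g x)%:E)%E = (\int[mu]_x (f x * g x))%:E.
Proof.
move=> f2 g2; rewrite /Rintegral fineK//; apply: integrable_fin_num => //.
exact: L2M_integrable.
Qed.

Lemma integral_indic_window s : 0 <= s -> (\int[leb]_t (\1_(window s) t)%:E = s%:E)%E.
Proof.
have mW := measurable_window s.
by move=> s0; rewrite integral_indic// setIT; exact: lebesgue_window.
Qed.

(** Cauchy-Schwarz on a window of length s, in the form that the variance of f on the window is
    nonnegative. *)
Lemma integral_window_sqr (s : R) (f : R -> R) : 0 < s ->
  measurable_fun (setT : set R1) (f : R1 -> R) ->
  (((\int[leb]_t (\1_(window s) t * f t)) ^+ 2)%:E <=
    s%:E * \int[leb]_t (\1_(window s) t * f t ^+ 2)%:E)%E.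
Proof.
move=> s0 mf; set I := (\int[leb]_t _)%E.
have mW := measurable_window s.
have mk : measurable_fun (setT : set R1) ((\1_(window s)) : R1 -> R) by exact: measurable_indic.
have mkf2 : measurable_fun (setT : set R1) (fun t : R1 => (\1_(window s) t * f t ^+ 2)%:E).
  by apply/measurable_EFinP/measurable_funM => //; exact: measurable_funX.
have k0 t : 0 <= \1_(window s) t :> R by rewrite indicE.
have I0 : (0 <= I)%E by apply: integral_ge0 => t _; rewrite lee_fin mulr_ge0// sqr_ge0.
have [Ioo|] := eqVneq I +oo%E; first by rewrite Ioo gt0_muley ?lte_fin// leey.
rewrite -ltey => Ioo.
have If2 : leb.-integrable setT (EFin \o (fun t => \1_(window s) t * f t ^+ 2)).
  apply/integrableP; split => //; apply: le_lt_trans Ioo.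
  apply: ge0_le_integral => //; first exact: measurableT_comp.
  by move=> t _; rewrite /= lee_fin ger0_norm// mulr_ge0// sqr_ge0.
have Ik : leb.-integrable setT (EFin \o (\1_(window s) : R -> R)).
  apply/integrableP; split; first exact/measurable_EFinP.
  under eq_integral do rewrite /= (ger0_norm (k0 _)).
  by rewrite integral_indic_window ?ltW// ltry.
have Zl (c : R) (h : R -> R) : leb.-integrable setT (EFin \o h) ->
   leb.-integrable setT (EFin \o (fun t => c * h t)).
  by move=> ih; exact: (@integrableZl _ _ _ leb setT measurableT c (EFin \o h)).
have Dl (h1 h2 : R -> R) : leb.-integrable setT (EFin \o h1) -> leb.-integrable setT (EFin \o h2) ->
   leb.-integrable setT (EFin \o (fun t => h1 t + h2 t)).
  by move=> ih1 ih2; exact: (@integrableD _ _ _ leb setT measurableT (EFin \o h1) (EFin \o h2)).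
have Ikf : leb.-integrable setT (EFin \o (fun t => \1_(window s) t * f t)).
  apply: (le_integrable measurableT _ _ (Dl _ _ Ik If2)).
  - by apply/measurable_EFinP/measurable_funM.
  - move=> t _; rewrite /= lee_fin (ger0_norm (addr_ge0 (k0 t) (mulr_ge0 (k0 t) (sqr_ge0 (f t))))).
    rewrite normrM (ger0_norm (k0 t)) -[X in _ <= X + _]mulr1 -mulrDr ler_wpM2l//.
    by rewrite -(real_normK (num_real (f t))); have := normr_ge0 (f t); nra.
set a := \int[leb]_t _.
have Ir : I = (\int[leb]_t (\1_(window s) t * f t ^+ 2))%:E.
  by rewrite /Rintegral fineK//; exact: integrable_fin_num.
set b := \int[leb]_t (\1_(window s) t * f t ^+ 2) in Ir.
rewrite Ir -EFinM lee_fin.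
have s1 : \int[leb]_t (\1_(window s) t) = s.
  rewrite /Rintegral; by rewrite integral_indic_window// ltW.
(* With a / s the mean of f, this is the integral of (f - a / s)^2 over the window, expanded. *)
have : 0 <= \int[leb]_t ((a / s) ^+ 2 * \1_(window s) t +
   ((- 2 * (a / s)) * (\1_(window s) t * f t) + \1_(window s) t * f t ^+ 2)).
  apply: Rintegral_ge0 => t _.
  have -> : (a / s) ^+ 2 * \1_(window s) t +
     ((- 2 * (a / s)) * (\1_(window s) t * f t) + \1_(window s) t * f t ^+ 2) =
     \1_(window s) t * (f t - a / s) ^+ 2 by ring.
  by rewrite mulr_ge0// sqr_ge0.
rewrite (RintegralD measurableT (Zl _ _ Ik) (Dl _ _ (Zl _ _ Ikf) If2)).
rewrite (RintegralD measurableT (Zl _ _ Ikf) If2).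
rewrite (RintegralZl _ measurableT Ik) (RintegralZl _ measurableT Ikf) s1 -/a -/b.
have -> : (a / s) ^+ 2 * s + (- 2 * (a / s) * a + b) = b - a ^+ 2 / s.
  by field; rewrite gt_eqF.
by rewrite subr_ge0 ler_pdivrMr// mulrC.
Qed.

Section average.
Variable Psi : R -> R * R -> R * R.
Hypothesis mPsi : measurable_fun (setT : set (T * R1)) ((fun p => Psi p.2 p.1) : T * R1 -> T).
Hypothesis mpPsi : forall t, measure_preserving mu (Psi t).

Lemma measurable_flow_average g s : measurable_fun (setT : set T) (g : T -> R) ->
  measurable_fun (setT : set T)
    ((fun x => \int[leb]_t (\1_(window s) t * g (Psi t x))) : T -> R).
Proof.
move=> mg; have mW := measurable_window s.
apply: (measurable_Rintegral_section leb (F := fun p : T * R1 => \1_(window s) p.2 * g (Psi p.2 p.1))).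
apply: measurable_funM; last exact: (measurableT_comp mg mPsi).
exact: (measurableT_comp (measurable_indic mW) measurable_snd).
Qed.

(** One factor s comes from Cauchy-Schwarz in time. Tonelli gives the other: all time slices have
    the same square norm, since each map preserves measure. *)
Lemma flow_average_sqr g s : 0 < s -> measurable_fun (setT : set T) (g : T -> R) ->
  (\int[mu]_x ((\int[leb]_t (\1_(window s) t * g (Psi t x))) ^+ 2)%:E <=
    (s ^+ 2)%:E * \int[mu]_x (g x ^+ 2)%:E)%E.
Proof.
move=> s0 mg.
have mW := measurable_window s.
pose F (p : T * R1) : \bar R := (\1_(window s) p.2 * g (Psi p.2 p.1) ^+ 2)%:E.
have mF : measurable_fun setT F.
  apply/measurable_EFinP; apply: measurable_funM.
    exact: (measurableT_comp (measurable_indic mW) measurable_snd).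
  by apply: measurable_funX; exact: (measurableT_comp mg mPsi).
have F0 p : (0 <= F p)%E by rewrite lee_fin mulr_ge0 ?sqr_ge0 ?indicE.
have mgx x : measurable_fun (setT : set R1) ((fun t => g (Psi t x)) : R1 -> R).
  apply: (measurableT_comp mg).
  exact: (measurableT_comp mPsi (pair1_measurable (x : T))).
have mFF := @measurable_fun_fubini_tonelli_F _ _ T R1 R leb F mF F0.
apply: (@le_trans _ _ (\int[mu]_x (s%:E * \int[leb]_t F (x, t)))%E).
  apply: ge0_le_integral => //.
  - by move=> x _; rewrite lee_fin sqr_ge0.
  - by apply/measurable_EFinP/measurable_funX; exact: measurable_flow_average.
  - by apply: measurable_funeM.
  - move=> x _; exact: integral_window_sqr.
rewrite ge0_integralZl//; last 2 first.
- by move=> x _; apply: integral_ge0 => t _.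
- by rewrite lee_fin ltW.
have -> : (\int[mu]_x \int[leb]_t F (x, t) = s%:E * \int[mu]_x (g x ^+ 2)%:E)%E.
  have -> : (\int[mu]_x \int[leb]_t F (x, t) = \int[mus]_x \int[leb]_t F (x, t))%E by [].
  rewrite (@fubini_tonelli _ _ T R1 R mus leb F mF F0).
  pose B := (\int[mu]_x (g x ^+ 2)%:E)%E.
  transitivity (\int[leb]_(t in window s) B)%E; last first.
    rewrite integral_cst// [LHS]muleC; congr (_ * _)%E; exact: lebesgue_window (ltW s0).
  rewrite [RHS]integral_mkcond; apply: eq_integral => t _.
  rewrite /patch; case: ifPn => tw; rewrite /F /= indicE.
    rewrite tw; under eq_integral do rewrite mul1r.
    apply: (@integral_measure_preserving _ _ _ mu (Psi t) (fun x => (g x ^+ 2)%:E)) => //.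
    exact/measurable_EFinP/measurable_funX.
  by rewrite (negbTE tw) integral0_eq// => x _; rewrite mul0r.
by rewrite muleA -EFinM expr2.
Qed.

Lemma L2_flow_average g s : 0 < s -> L2 g ->
  L2 (fun x => \int[leb]_t (\1_(window s) t * g (Psi t x))).
Proof.
move=> s0 /L2P[mg g2]; apply/L2P; split; first exact: measurable_flow_average.
apply: le_lt_trans (flow_average_sqr s0 mg) _.
have B0 : (0 <= \int[mu]_x (g x ^+ 2)%:E)%E.
  by apply: integral_ge0 => x _; rewrite lee_fin sqr_ge0.
have Bfin : (\int[mu]_x (g x ^+ 2)%:E)%E \is a fin_num by rewrite ge0_fin_numE.
by rewrite -(fineK Bfin) -EFinM ltry.
Qed.

End average.
End flow_formula.

Lemma integral_EFin_preserving (R : realType) (A : R * R -> R * R) (f : R * R -> R) :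
  measure_preserving (leb2 R) A ->
  measurable_fun (setT : set (measurableTypeR R * measurableTypeR R)%type)
    (f : measurableTypeR R * measurableTypeR R -> R) ->
  (\int[leb2 R]_x (f (A x))%:E = \int[leb2 R]_x (f x)%:E)%E.
Proof.
move=> mpA mf; apply: (@integral_measure_preserving _ _ _ (leb2 R) A (fun x => (f x)%:E) mpA).
exact/measurable_EFinP.
Qed.

(** * Increments along a flow as time integrals of a weak derivative *)

Section weak_flow.
Context {R : realType}.
Let T : measurableType _ := (measurableTypeR R * measurableTypeR R)%type.
Let R1 : measurableType _ := measurableTypeR R.
Local Notation leb := (@lebesgue_measure R).
Local Notation mus := (@plane_measure R).
Local Notation mu := (leb2 R).
Variables (Phi : R -> R * R -> R * R) (X : (R * R -> R) -> R * R -> R).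
Hypothesis flowP : plane_flow Phi X.
Variables (u g : R * R -> R).
Hypothesis u2 : L2 u.
Hypothesis g2 : L2 g.
Hypothesis weak_X : forall phi, test_function phi ->
  \int[mu]_x (u x * X phi x) = - \int[mu]_x (g x * phi x).
Implicit Types (phi : R * R -> R) (s t : R).

Let flow_measurableN :
  measurable_fun (setT : set (T * R1)) ((fun p => Phi (- p.2) p.1) : T * R1 -> T).
Proof.
have mswap : measurable_fun (setT : set (T * R1)) (fun p => (p.1, - p.2) : T * R1).
  apply: measurable_fun_pair; first exact: measurable_fst.
  by apply: measurableT_comp => //; exact: measurable_snd.
exact: (measurableT_comp (flow_measurable flowP) mswap).
Qed.

(** The weak identity for the test function phi \o Phi (- t), after a measure-preserving change of
    variables. The factor -1 stays beside u to match the integrand [F2] of [weak_flow_test]. *)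
Lemma weak_flow_slice phi t : test_function phi ->
  (\int[mu]_x (phi x * g (Phi t x))%:E =
    \int[mu]_x (-1 * u x * X phi (Phi (- t) x))%:E)%E.
Proof.
move=> tphi.
pose psi := phi \o Phi (- t).
have tpsi : test_function psi by exact: (flow_test flowP).
have psi2 := test_function_L2 tpsi.
have Xpsi2 := test_function_L2 (field_test flowP tpsi).
transitivity (\int[mu]_x (g x * psi x)%:E)%E.
  rewrite -(integral_EFin_preserving (f := fun x => g x * psi x) (flow_preserving flowP t)).
    by apply: eq_integral => x _; rewrite /psi /= (flowK flowP) mulrC.
  exact: (measurable_funM (L2_measurable g2) (L2_measurable psi2)).
rewrite L2M_EFin// -[\int[mu]_x (g x * psi x)]opprK -weak_X//.
transitivity (\int[mu]_x ((-1)%:E * (u x * X psi x)%:E))%E.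
  rewrite (integralZl measurableT (L2M_integrable u2 Xpsi2)) L2M_EFin//.
  by rewrite -EFinM mulN1r.
by apply: eq_integral => x _; rewrite (field_flow flowP)// -EFinM mulrA.
Qed.

(** Integrate [weak_flow_slice] over the times in the window and exchange the integrals by Fubini.
    On the side of the test function the time integral is then an increment by [flow_FTC], and a
    change of variables returns it to u. *)
Lemma weak_flow_test phi s : 0 < s -> test_function phi ->
  \int[mu]_x (phi x * \int[leb]_t (\1_(window s) t * g (Phi t x))) =
  \int[mu]_x (u (Phi s x) * phi x) - \int[mu]_x (u x * phi x).
Proof.
move=> s0 tphi; have s0' := ltW s0.
have phi2 := test_function_L2 tphi.
have Xphi2 := test_function_L2 (field_test flowP tphi).
have mpN t : measure_preserving mu (Phi (- t)) := flow_preserving flowP (- t).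
have G2 := L2_flow_average (flow_measurable flowP) (flow_preserving flowP) s0 g2.
have mg := L2_measurable g2.
pose nu x := -1 * u x; have nu2 : L2 nu := L2Z (-1) u2.
pose F1 (p : T * R1) : \bar R := (phi p.1 * (\1_(window s) p.2 * g (Phi p.2 p.1)))%:E.
pose F2 (p : T * R1) : \bar R := (nu p.1 * (\1_(window s) p.2 * X phi (Phi (- p.2) p.1)))%:E.
have I1 : (mus \x leb)%E.-integrable setT F1.
  exact: (flow_integrable (flow_measurable flowP) (flow_preserving flowP) s0' phi2 g2).
have I2 : (mus \x leb)%E.-integrable setT F2.
  exact: (@flow_integrable _ (fun t => Phi (- t)) _ _ _ flow_measurableN mpN s0' nu2 Xphi2).
have E1 : (\int[mu]_x (phi x * \int[leb]_t (\1_(window s) t * g (Phi t x)))%:E =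
    \int[mus]_x \int[leb]_t F1 (x, t))%E.
  have ae1 := @ae_integrable1 _ _ T R1 R mus leb F1 I1.
  apply: ae_eq_integral => //.
  - apply/measurable_EFinP/measurable_funM; exact: L2_measurable.
  - exact: (@measurable_fubini_F _ _ T R1 R mus leb F1 I1).
  - apply: ae2S ae1 => x Ix _.
    (* Where phi x is nonzero, dividing by it turns the integrability of the section of [F1] into
       that of g along the orbit; elsewhere both sides are 0. *)
    have [p0|p0] := eqVneq (phi x) 0.
      by rewrite p0 mul0r integral0_eq// => t _; rewrite /F1 /= p0 mul0r.
    have Ig : leb.-integrable setT (EFin \o (fun t => \1_(window s) t * g (Phi t x))).
      have := @integrableZl _ _ _ leb setT measurableT (phi x)^-1 _ Ix.
      apply: eq_integrable => // t _; rewrite /F1 /= -EFinM mulrA mulVf// mul1r//.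
    transitivity (\int[leb]_t ((phi x)%:E * (\1_(window s) t * g (Phi t x))%:E))%E.
      rewrite integralZl// EFinM /Rintegral fineK//; exact: integrable_fin_num.
    by apply: eq_integral => t _; rewrite /F1 /= EFinM.
have E2 : (\int[mus]_x \int[leb]_t F2 (x, t) = \int[mu]_x (nu x * (phi x - phi (Phi (- s) x)))%:E)%E.
  apply: eq_integral => x _.
  transitivity (\int[leb]_t ((nu x)%:E * (\1_(window s) t * X phi (Phi (- t) x))%:E))%E.
    by apply: eq_integral => t _; rewrite /F2 /= EFinM.
  have F := flow_FTC flowP x s0 tphi.
  rewrite integralZl// ?F ?EFinM//.
  have cX : measurable_fun (setT : set R1) ((fun t => X phi (Phi (- t) x)) : R1 -> R).
    have mX := test_function_measurable (field_test flowP tphi).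
    apply: (measurableT_comp mX).
    exact: (measurableT_comp flow_measurableN (pair1_measurable (x : T))).
  have [M HM] := test_function_bounded (field_test flowP tphi).
  have mW := measurable_window s.
  apply: (@le_integrable _ _ _ leb setT measurableT _ (fun t => (M * \1_(window s) t)%:E)).
  - apply/measurable_EFinP/measurable_funM => //; exact: measurable_indic.
  - move=> t _; rewrite /= lee_fin normrM mulrC.
    have k0 : 0 <= \1_(window s) t :> R by rewrite indicE.
    have M0 : 0 <= M by apply: le_trans (HM x).
    by rewrite (ger0_norm (mulr_ge0 M0 k0)) (ger0_norm k0) ler_wpM2r.
  - have -> : (fun t => (M * \1_(window s) t)%:E) = (fun t => M%:E * (\1_(window s) t)%:E)%E.
      by apply/funext => t; rewrite EFinM.
    apply: integrableZl => //; apply/integrableP; split.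
      apply/measurable_EFinP; exact: measurable_indic.
    under eq_integral do rewrite /= ger0_norm ?indicE//.
    by rewrite [ltLHS](integral_indic_window s0') ltry.
have E3 : (\int[mus]_x \int[leb]_t F1 (x, t) = \int[mus]_x \int[leb]_t F2 (x, t))%E.
  rewrite (@Fubini _ _ T R1 R mus leb F1 I1) (@Fubini _ _ T R1 R mus leb F2 I2).
  apply: eq_integral => t _; rewrite /F1 /F2 /=.
  have Xt2 := L2_measure_preserving (mpN t) Xphi2.
  have gt2 := L2_measure_preserving (flow_preserving flowP t) g2.
  transitivity (\int[mu]_x ((\1_(window s) t)%:E * (phi x * g (Phi t x))%:E))%E.
    by apply: eq_integral => x _; rewrite -EFinM mulrCA.
  rewrite (integralZl measurableT (L2M_integrable phi2 gt2)) weak_flow_slice//.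
  rewrite -(integralZl measurableT (L2M_integrable nu2 Xt2)).
  by apply: eq_integral => x _; rewrite -EFinM mulrCA.
have E : (\int[mu]_x (phi x * \int[leb]_t (\1_(window s) t * g (Phi t x)))%:E =
    \int[mu]_x (nu x * (phi x - phi (Phi (- s) x)))%:E)%E by rewrite E1 E3 E2.
have uphi := L2M_integrable u2 phi2.
have phis2 := L2_measure_preserving (flow_preserving flowP (- s)) phi2.
have mps := flow_preserving flowP s.
have -> : \int[mu]_x (u (Phi s x) * phi x) = \int[mu]_x (u x * phi (Phi (- s) x)).
  rewrite -(Rintegral_measure_preserving mps (f := fun x => u x * phi (Phi (- s) x))).
    by apply: eq_Rintegral => x _; rewrite (flowK flowP).
  by apply: measurable_funM; exact: L2_measurable.
rewrite (L2M_EFin phi2 G2) (L2M_EFin nu2 (L2B phi2 phis2)) in E.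
case: E => ->.
rewrite -(RintegralB measurableT (L2M_integrable u2 phis2) uphi).
by apply: eq_Rintegral => x _; rewrite /nu /=; ring.
Qed.

(** Both sides are square integrable and agree against every test function, so the fundamental lemma
    applies. The exceptional set depends on s. *)
Lemma weak_flow_formula s : 0 < s ->
  {ae mu, forall x, u (Phi s x) - u x = \int[leb]_t (\1_(window s) t * g (Phi t x))}.
Proof.
move=> s0; pose G x := \int[leb]_t (\1_(window s) t * g (Phi t x)).
have G2 : L2 G := L2_flow_average (flow_measurable flowP) (flow_preserving flowP) s0 g2.
have us2 := L2_measure_preserving (flow_preserving flowP s) u2.
have v2 := L2B (L2B us2 u2) G2.
have := @ae_eq0_test_functions _ _ (L2_locally_integrable v2).
move=> H; apply: ae2S (H _) => [x /eqP|phi tphi]; first by rewrite subr_eq0 => /eqP.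
have phi2 := test_function_L2 tphi.
have Iu := L2M_integrable u2 phi2; have Ius := L2M_integrable us2 phi2.
have IG := L2M_integrable G2 phi2.
under eq_Rintegral do rewrite !mulrBl.
have IB : mu.-integrable setT (EFin \o (fun x => (u \o Phi s) x * phi x - u x * phi x)).
  exact: (@integrableB _ _ _ mu setT measurableT _ _ Ius Iu).
rewrite (RintegralB measurableT IB IG) (RintegralB measurableT Ius Iu).
under [X in _ - X]eq_Rintegral do rewrite mulrC.
by rewrite weak_flow_test// subrr.
Qed.

Lemma weak_flow_bound s : 0 <= s ->
  (\int[mu]_x ((u (Phi s x) - u x) ^+ 2)%:E <= (s ^+ 2)%:E * \int[mu]_x (g x ^+ 2)%:E)%E.
Proof.
rewrite le_eqVlt => /predU1P[<-|s0].
  rewrite expr0n mul0e integral0_eq// => x _.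
  by rewrite (flow0 flowP) subrr expr0n.
apply: le_trans (flow_average_sqr (flow_measurable flowP) (flow_preserving flowP) s0 (L2_measurable g2)).
rewrite le_eqVlt; apply/orP; left; apply/eqP; apply: ae_eq_integral => //.
- apply/measurable_EFinP/measurable_funX/measurable_funB; last exact: L2_measurable.
  exact: (L2_measurable (L2_measure_preserving (flow_preserving flowP s) u2)).
- apply/measurable_EFinP/measurable_funX.
  exact: (measurable_flow_average (flow_measurable flowP) _ (L2_measurable g2)).
- by apply: ae2S (weak_flow_formula s0) => x -> _.
Qed.

End weak_flow.

(** * Rotations and translations as flows *)

Section flows.
Context {R : realType}.
Let T : measurableType _ := (measurableTypeR R * measurableTypeR R)%type.
Let R1 : measurableType _ := measurableTypeR R.
Local Notation mu := (leb2 R).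
Local Notation e1 := (@e1 R).
Local Notation e2 := (@e2 R).
Hint Resolve e1_in e2_in : core.
Implicit Types (f g h u v phi : R * R -> R) (s t : R).

Definition rotation t : R * R -> R * R := rotate (cos t) (sin t).

Definition angular_field phi x : R := x.1 * 'D_e2 phi x - x.2 * 'D_e1 phi x.

Lemma rotationD s t x : rotation (s + t) x = rotation s (rotation t x).
Proof. by rewrite /rotation /rotate cosD sinD /=; congr pair; ring. Qed.

Lemma rotation0 x : rotation 0 x = x.
Proof.
by rewrite /rotation /rotate cos0 sin0 !mul1r !mul0r subr0 add0r -surjective_pairing.
Qed.

Lemma smooth_angular_field phi : smooth phi -> smooth (angular_field phi).
Proof.
move=> sphi.
have -> : angular_field phi = (fst : R * R -> R) * ('D_e2 phi) +
    cst (-1) * ((snd : R * R -> R) * 'D_e1 phi).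
  apply/funext => x; rewrite /angular_field.
  by rewrite -[RHS]/(x.1 * 'D_e2 phi x + -1 * (x.2 * 'D_e1 phi x)) mulN1r.
apply: smoothD; first by apply: smoothM; [exact: smooth_fst|exact: smooth_derive].
by apply: smoothM; [exact: smooth_cst|apply: smoothM; [exact: smooth_snd|exact: smooth_derive]].
Qed.

Lemma angular_field_test phi : test_function phi -> test_function (angular_field phi).
Proof.
move=> tphi.
have [K1 cK1 D1] := test_function_support (test_function_derive tphi e1_in).
have [K2 cK2 D2] := test_function_support (test_function_derive tphi e2_in).
apply: (test_functionP _ (compactU cK1 cK2)); first exact: smooth_angular_field tphi.1.
by move=> x /not_orP[/D1 E1 /D2 E2]; rewrite /angular_field E1 E2 !mulr0 subr0.
Qed.

Lemma rotation_flow : plane_flow rotation angular_field.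
Proof.
split.
- have mc : measurable_fun (setT : set (T * R1)) ((fun p => cos p.2) : T * R1 -> R).
    apply: (measurableT_comp _ measurable_snd); exact: continuous_measurable_fun (@continuous_cos R).
  have ms : measurable_fun (setT : set (T * R1)) ((fun p => sin p.2) : T * R1 -> R).
    apply: (measurableT_comp _ measurable_snd); exact: continuous_measurable_fun (@continuous_sin R).
  have m1 : measurable_fun (setT : set (T * R1)) ((fun p => p.1.1) : T * R1 -> R).
    exact: (measurableT_comp measurable_fst measurable_fst).
  have m2 : measurable_fun (setT : set (T * R1)) ((fun p => p.1.2) : T * R1 -> R).
    exact: (measurableT_comp measurable_snd measurable_fst).
  apply: measurable_fun_pair.
  + exact: (measurable_funB (measurable_funM mc m1) (measurable_funM ms m2)).
  + exact: (measurable_funD (measurable_funM ms m1) (measurable_funM mc m2)).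
- by move=> t; apply: measure_preserving_rotate; rewrite cos2Dsin2.
- move=> t x; rewrite -rotationD addNr; exact: rotation0.
- exact: rotation0.
- by move=> phi t tphi; apply: test_function_rotate; rewrite ?cos2Dsin2.
- exact: angular_field_test.
- move=> phi t x [sphi _]; rewrite /angular_field.
  have [D1 D2] := derive_rotate (cos t) (sin t) sphi.
  have -> := congr1 (@^~ x) D1; have -> := congr1 (@^~ x) D2.
  rewrite /rotation /rotate /=; ring.
- move=> phi x t [sphi _].
  have d1 : is_derive t 1 (fun t => cos t * x.1 - sin t * x.2) (- (rotation t x).2).
    have H := is_deriveB (is_deriveM (is_derive_cos t) (is_derive_cst x.1 t 1))
      (is_deriveM (is_derive_sin t) (is_derive_cst x.2 t 1)).
    apply: (is_derive_eq H); rewrite /rotation /rotate /= !scaler0 -![_ *: _]/(_ * _) ; ring.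
  have d2 : is_derive t 1 (fun t => sin t * x.1 + cos t * x.2) (rotation t x).1.
    have H := is_deriveD (is_deriveM (is_derive_sin t) (is_derive_cst x.1 t 1))
      (is_deriveM (is_derive_cos t) (is_derive_cst x.2 t 1)).
    apply: (is_derive_eq H); rewrite /rotation /rotate /= !scaler0 -![_ *: _]/(_ * _) ; ring.
  apply: (is_derive_eq (smooth_is_derive_curve sphi d1 d2)).
  rewrite /angular_field /rotation /rotate /=; ring.
Qed.

(** x.1 does not depend on the second coordinate, nor x.2 on the first, so these coefficients can be
    absorbed into the test function before the weak partial derivatives are used. *)
Lemma weak_angular u g1 g2 phi : has_H_gradient u g1 g2 -> test_function phi ->
  \int[mu]_x (u x * angular_field phi x) = - \int[mu]_x ((x.1 * g2 x - x.2 * g1 x) * phi x).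
Proof.
move=> [u2 [_ lg1 E1] [_ lg2 E2] [g12 g22] th] tphi.
have sphi := tphi.1.
have t1 := test_functionMl smooth_fst tphi.
have t2 := test_functionMl smooth_snd tphi.
have D2 x : 'D_e2 ((fst : R * R -> R) * phi) x = x.1 * 'D_e2 phi x.
  rewrite deriveM; [|exact: (@smooth_derivable _ _ _ x smooth_fst)|exact: smooth_derivable].
  by rewrite derive_fst /= scaler0 addr0.
have D1 x : 'D_e1 ((snd : R * R -> R) * phi) x = x.2 * 'D_e1 phi x.
  rewrite deriveM; [|exact: (@smooth_derivable _ _ _ x smooth_snd)|exact: smooth_derivable].
  by rewrite derive_snd /= scaler0 addr0.
have lu := L2_locally_integrable u2.
have I1 := integrable_locally_test lu (test_function_derive t1 e2_in).
have I2 := integrable_locally_test lu (test_function_derive t2 e1_in).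
have J1 := integrable_locally_test lg2 t1.
have J2 := integrable_locally_test lg1 t2.
transitivity (\int[mu]_x (u x * 'D_e2 ((fst : R * R -> R) * phi) x -
    u x * 'D_e1 ((snd : R * R -> R) * phi) x)).
  by apply: eq_Rintegral => x _; rewrite D1 D2 /angular_field mulrBr.
rewrite (RintegralB measurableT I1 I2) (E2 _ t1) (E1 _ t2) -opprD.
congr (- _).
transitivity (\int[mu]_x (g2 x * ((fst : R * R -> R) * phi) x - g1 x * ((snd : R * R -> R) * phi) x)).
  by rewrite (RintegralB measurableT J1 J2).
apply: eq_Rintegral => x _.
rewrite -[((fst : R * R -> R) * phi) x]/(x.1 * phi x) -[((snd : R * R -> R) * phi) x]/(x.2 * phi x).
ring.
Qed.

Lemma rotation_increment_bound u g1 g2 s : has_H_gradient u g1 g2 -> 0 <= s ->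
  (\int[mu]_x ((u (rotation s x) - u x) ^+ 2)%:E <=
    (s ^+ 2)%:E * \int[mu]_x ((x.1 * g2 x - x.2 * g1 x) ^+ 2)%:E)%E.
Proof.
move=> uH; have [u2 _ _ _ th] := uH.
by apply: (weak_flow_bound rotation_flow u2 th) => phi; exact: weak_angular.
Qed.

Lemma translate1_flow : plane_flow translate1 (fun phi => 'D_e1 phi).
Proof.
have AE t e (x : R * R) (h : R) : translate1 t (h *: e + x) = h *: e + translate1 t x.
  by rewrite /translate1 [RHS]surjective_pairing /= addrA.
have ct t : continuous (translate1 t : R * R -> R * R).
  move=> x; have H1 : (y.1 + t) @[y --> x] --> x.1 + t.
    by apply: cvgD; [exact: cvg_fst|exact: cvg_cst].
  have H2 : y.2 @[y --> x] --> x.2 by exact: cvg_snd.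
  exact: (cvg_pair H1 H2).
have K t : cancel (translate1 t) (translate1 (- t) : R * R -> R * R).
  by move=> [x y]; rewrite /translate1 /= addrK.
split.
- have m1 : measurable_fun (setT : set (T * R1)) ((fun p => p.1.1) : T * R1 -> R).
    exact: (measurableT_comp measurable_fst measurable_fst).
  apply: measurable_fun_pair; first exact: (measurable_funD m1 measurable_snd).
  exact: (measurableT_comp measurable_snd measurable_fst).
- exact: measure_preserving_translate1.
- exact: K.
- by move=> [x y]; rewrite /translate1 addr0.
- move=> phi t tphi.
  exact: (test_function_comp tphi (ct t) (ct (- t)) (K t) (AE t e1) (AE t e2)).
- by move=> phi tphi; exact: test_function_derive.
- by move=> phi t x tphi; have [_ ->] := derive_along phi (AE t e1 x).
- move=> phi x t [sphi _].
  have d1 : is_derive t 1 (fun t => x.1 + t) 1.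
    by apply: (is_derive_eq (is_deriveD (is_derive_cst x.1 t 1) (is_derive_id t 1))); rewrite add0r.
  have d2 : is_derive t 1 (fun t : R => x.2) 0 by exact: is_derive_cst.
  apply: (is_derive_eq (smooth_is_derive_curve sphi d1 d2)).
  by rewrite mul1r mul0r addr0.
Qed.

Lemma translate2_flow : plane_flow translate2 (fun phi => 'D_e2 phi).
Proof.
have AE t e (x : R * R) (h : R) : translate2 t (h *: e + x) = h *: e + translate2 t x.
  by rewrite /translate2 [RHS]surjective_pairing /= addrA.
have ct t : continuous (translate2 t : R * R -> R * R).
  move=> x; have H1 : y.1 @[y --> x] --> x.1 by exact: cvg_fst.
  have H2 : (y.2 + t) @[y --> x] --> x.2 + t.
    by apply: cvgD; [exact: cvg_snd|exact: cvg_cst].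
  exact: (cvg_pair H1 H2).
have K t : cancel (translate2 t) (translate2 (- t) : R * R -> R * R).
  by move=> [x y]; rewrite /translate2 /= addrK.
split.
- have m2 : measurable_fun (setT : set (T * R1)) ((fun p => p.1.2) : T * R1 -> R).
    exact: (measurableT_comp measurable_snd measurable_fst).
  apply: measurable_fun_pair; last exact: (measurable_funD m2 measurable_snd).
  exact: (measurableT_comp measurable_fst measurable_fst).
- exact: measure_preserving_translate2.
- exact: K.
- by move=> [x y]; rewrite /translate2 addr0.
- move=> phi t tphi.
  exact: (test_function_comp tphi (ct t) (ct (- t)) (K t) (AE t e1) (AE t e2)).
- by move=> phi tphi; exact: test_function_derive.
- by move=> phi t x tphi; have [_ ->] := derive_along phi (AE t e2 x).
- move=> phi x t [sphi _].
  have d1 : is_derive t 1 (fun t => x.2 + t) 1.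
    by apply: (is_derive_eq (is_deriveD (is_derive_cst x.2 t 1) (is_derive_id t 1))); rewrite add0r.
  have d2 : is_derive t 1 (fun t : R => x.1) 0 by exact: is_derive_cst.
  apply: (is_derive_eq (smooth_is_derive_curve sphi d2 d1)).
  by rewrite mul1r mul0r add0r.
Qed.

End flows.

(** * The angular Wirtinger inequality *)

Section discrete_wirtinger.
Context {R : realType}.
Variable N : nat.
Hypothesis N0 : (0 < N)%N.
Implicit Types (v w : nat -> R).
Local Notation h := (2 * pi / N%:R : R).

(* Found by field among the hypotheses. *)
Let Nr0 : N%:R != 0 :> R. Proof. by rewrite pnatr_eq0 -lt0n. Qed.

Lemma cosD_nat2pi (x : R) (n : nat) : cos (x + n%:R * (2 * pi)) = cos x.
Proof.
have -> : n%:R * (2 * pi) = (pi *+ 2) *+ n :> R by rewrite -[pi *+ 2]mulr_natl -[RHS]mulr_natl.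
exact: (periodicn (@cosD2pi R)).
Qed.

Lemma sinD_nat2pi (x : R) (n : nat) : sin (x + n%:R * (2 * pi)) = sin x.
Proof.
have -> : n%:R * (2 * pi) = (pi *+ 2) *+ n :> R by rewrite -[pi *+ 2]mulr_natl -[RHS]mulr_natl.
exact: (periodicn (@sinD2pi R)).
Qed.

Lemma sin_pi_frac_ge0 (m : nat) : (m <= N)%N -> 0 <= sin (m%:R * h / 2).
Proof.
move=> mN; apply: sin_ge0_pi; apply/andP; split.
  by rewrite !mulr_ge0 ?invr_ge0 ?pi_ge0.
have -> : m%:R * h / 2 = (m%:R / N%:R) * pi by field.
by rewrite ler_piMl ?pi_ge0// ler_pdivrMr ?mul1r ?ler_nat// ltr0n.
Qed.

Lemma sum_cos_frac (m : nat) : (0 < m < N)%N -> \sum_(n < N) cos (n%:R * (m%:R * h)) = 0.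
Proof.
move=> /andP[m0 mN]; set t := m%:R * h.
have st0 : sin (t / 2) != 0.
  rewrite gt_eqF//; apply: sin_gt0_pi.
  have -> : t / 2 = (m%:R / N%:R) * pi by rewrite /t; field.
  apply/andP; split; first by rewrite !mulr_gt0 ?invr_gt0 ?pi_gt0 ?ltr0n.
  by rewrite gtr_pMl ?pi_gt0// ltr_pdivrMr ?ltr0n// mul1r ltr_nat.
(* Telescoping with 2 sin (t / 2) cos (n t) = sin (n t + t / 2) - sin (n t - t / 2). For M = N the
   right-hand side vanishes by periodicity. *)
have tele M : 2 * sin (t / 2) * \sum_(n < M) cos (n%:R * t) =
    sin (M%:R * t - t / 2) + sin (t / 2).
  elim: M => [|M IH]; first by rewrite big_ord0 mulr0 mul0r sub0r sinN addNr.
  rewrite big_ord_recr /= mulrDr IH.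
  have -> : M.+1%:R * t - t / 2 = M%:R * t + t / 2.
    by rewrite -natr1; field.
  rewrite (sinB (_ * t)) (sinD (_ * t)); ring.
have := tele N.
have -> : N%:R * t - t / 2 = - (t / 2) + m%:R * (2 * pi) by rewrite /t; field.
rewrite sinD_nat2pi sinN addNr => /eqP; rewrite !mulf_eq0 (negbTE st0) orbF.
by rewrite pnatr_eq0 /= => /eqP.
Qed.

(** With [dft_sin], the real and imaginary parts, up to sign, of the discrete Fourier transform on
    the cyclic group of order N. *)
Definition dft_cos v n : R := \sum_(k < N) v k * cos (n%:R * (k%:R * h)).
Definition dft_sin v n : R := \sum_(k < N) v k * sin (n%:R * (k%:R * h)).

(** In the expanded double sum the terms with k <> l cancel after summation over n, by
    [sum_cos_frac] applied to |k - l|. *)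
Lemma dft_parseval v :
  \sum_(n < N) (dft_cos v n ^+ 2 + dft_sin v n ^+ 2) = N%:R * \sum_(k < N) v k ^+ 2.
Proof.
have E n : dft_cos v n ^+ 2 + dft_sin v n ^+ 2 =
    \sum_(k < N) \sum_(l < N) v k * v l * cos (n%:R * (k%:R * h) - n%:R * (l%:R * h)).
  rewrite !expr2 /dft_cos /dft_sin !big_distrlr /= -big_split /=.
  apply: eq_bigr => k _; rewrite -big_split /=; apply: eq_bigr => l _.
  by rewrite cosB; ring.
under eq_bigr do rewrite E.
rewrite exchange_big /= mulr_sumr; apply: eq_bigr => k _.
rewrite exchange_big /= (bigD1 k)//= [X in _ + X]big1 ?addr0.
  under eq_bigr do rewrite subrr cos0 mulr1.
  by rewrite sumr_const card_ord -expr2 mulr_natl.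
move=> l lk; rewrite -mulr_sumr.
have [kl|kl] := ltnP l k.
  under eq_bigr => n _.
    have -> : n%:R * (k%:R * h) - n%:R * (l%:R * h) = n%:R * ((k - l)%:R * h).
      by rewrite natrB ?(ltnW kl)//; ring.
    over.
  rewrite sum_cos_frac ?mulr0// subn_gt0 kl /=.
  by apply: leq_ltn_trans (ltn_ord k); rewrite leq_subr.
have {}kl : (k < l)%N by rewrite ltn_neqAle kl andbT eq_sym.
under eq_bigr => n _.
  rewrite -cosN opprB.
  have -> : n%:R * (l%:R * h) - n%:R * (k%:R * h) = n%:R * ((l - k)%:R * h).
    by rewrite natrB ?(ltnW kl)//; ring.
  over.
rewrite sum_cos_frac ?mulr0// subn_gt0 kl /=.
by apply: leq_ltn_trans (ltn_ord l); rewrite leq_subr.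
Qed.

Lemma sum_periodic_shift (f : nat -> R) : f N = f 0%N ->
  \sum_(k < N) f k.+1 = \sum_(k < N) f k.
Proof.
move=> fN; apply/eqP; rewrite -subr_eq0 -sumrB.
by rewrite -(big_mkord xpredT (fun k => f k.+1 - f k)) telescope_sumr// fN subrr.
Qed.

(** A shift multiplies the n-th Fourier coefficient by a phase of angle a = n h, so a difference
    multiplies its squared modulus by |e^(i a) - 1|^2 = 2 - 2 cos a. *)
Lemma dft_difference w n : w N = w 0%N ->
  dft_cos (fun k => w k.+1 - w k) n ^+ 2 + dft_sin (fun k => w k.+1 - w k) n ^+ 2 =
  (2 - 2 * cos (n%:R * h)) * (dft_cos w n ^+ 2 + dft_sin w n ^+ 2).
Proof.
move=> wN; set a := n%:R * h.
have nk k : n%:R * (k.+1%:R * h) - a = n%:R * (k%:R * h) by rewrite /a -natr1; ring.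
have Nh : n%:R * (N%:R * h) - a = - a + n%:R * (2 * pi) by rewrite /a; field.
have Ec : dft_cos (fun k => w k.+1 - w k) n = cos a * dft_cos w n + sin a * dft_sin w n - dft_cos w n.
  rewrite /dft_cos /dft_sin; under eq_bigr do rewrite mulrBl -nk.
  rewrite sumrB (sum_periodic_shift (f := fun k => w k * cos (n%:R * (k%:R * h) - a))); last first.
    by rewrite Nh cosD_nat2pi wN mul0r mulr0 sub0r.
  congr (_ - _); last by apply: eq_bigr => k _; rewrite nk.
  rewrite !mulr_sumr -big_split /=; apply: eq_bigr => k _.
  by rewrite cosB; ring.
have Es : dft_sin (fun k => w k.+1 - w k) n = cos a * dft_sin w n - sin a * dft_cos w n - dft_sin w n.
  rewrite /dft_cos /dft_sin; under eq_bigr do rewrite mulrBl -nk.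
  rewrite sumrB (sum_periodic_shift (f := fun k => w k * sin (n%:R * (k%:R * h) - a))); last first.
    by rewrite Nh sinD_nat2pi wN mul0r mulr0 sub0r.
  congr (_ - _); last by apply: eq_bigr => k _; rewrite nk.
  rewrite !mulr_sumr -sumrB /=; apply: eq_bigr => k _.
  by rewrite sinB; ring.
rewrite Ec Es.
have cs := cos2Dsin2 a.
set A := dft_cos w n; set B := dft_sin w n.
transitivity ((cos a ^+ 2 + sin a ^+ 2 + 1 - 2 * cos a) * (A ^+ 2 + B ^+ 2)); first by ring.
by rewrite cs; ring.
Qed.

(** By Parseval it is enough to compare the two sides mode by mode. *)
Lemma discrete_wirtinger w : w N = w 0%N -> \sum_(k < N) w k = 0 ->
  (2 - 2 * cos h) * \sum_(k < N) w k ^+ 2 <= \sum_(k < N) (w k.+1 - w k) ^+ 2.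
Proof.
move=> wN w0.
have Np : 0 < N%:R :> R by rewrite ltr0n.
rewrite -(ler_pM2l Np) mulrCA -(dft_parseval w) -(dft_parseval (fun k => w k.+1 - w k)) mulr_sumr.
apply: ler_sum => n _; rewrite (dft_difference _ wN).
(* Mode 0 is the sum of w, which is zero. *)
have [->|n0] := posnP n.
  have -> : dft_cos w 0 ^+ 2 + dft_sin w 0 ^+ 2 = 0; last by rewrite !mulr0.
  have -> : dft_cos w 0 = 0.
    by rewrite /dft_cos -[RHS]w0; apply: eq_bigr => k _; rewrite mul0r cos0 mulr1.
  rewrite /dft_sin big1 ?expr0n ?addr0// => k _; by rewrite mul0r sin0 mulr0.
apply: ler_wpM2r; first by rewrite addr_ge0 ?sqr_ge0.
rewrite lerB// ler_wpM2l//.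
(* For 1 <= n < N the claim is cos (n h) <= cos h. The difference is 2 sin ((n + 1) h / 2) sin ((n -
   1) h / 2), and both angles lie in [0, pi]. *)
have H1 := @sin_pi_frac_ge0 n.+1 (ltn_ord n).
have H2 := @sin_pi_frac_ge0 n.-1 (leq_trans (leq_pred n) (ltnW (ltn_ord n))).
have n1 : (n.+1)%:R = n%:R + 1 :> R by rewrite -natr1.
have n2 : (n.-1)%:R = n%:R - 1 :> R by rewrite -subn1 natrB.
have Ea : n%:R * h = n.+1%:R * h / 2 + n.-1%:R * h / 2 by rewrite n1 n2; field.
have Eb : h = n.+1%:R * h / 2 - n.-1%:R * h / 2 by rewrite n1 n2; field.
rewrite Ea [X in _ <= cos X]Eb.
rewrite cosD cosB -subr_ge0.
have -> : forall a b : R, a + b - (a - b) = 2 * b by move=> a b; ring.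
by rewrite !mulr_ge0.
Qed.

End discrete_wirtinger.

Section angular_wirtinger.
Context {R : realType}.
Let T : measurableType _ := (measurableTypeR R * measurableTypeR R)%type.
Local Notation mu := (leb2 R).
Implicit Types (f g u v w : R * R -> R) (s t : R).

Definition sqnorm f : R := \int[mu]_x (f x ^+ 2).

Lemma sqnormE f : L2 f -> (\int[mu]_x (f x ^+ 2)%:E)%E = (sqnorm f)%:E.
Proof.
by move=> f2; rewrite /sqnorm /Rintegral fineK//; apply: integrable_fin_num => //;
  exact: L2_sqr_integrable.
Qed.

Lemma sqnorm_ge0 f : 0 <= sqnorm f.
Proof. by apply: Rintegral_ge0 => x _; exact: sqr_ge0. Qed.

Lemma sqnorm_preserving f (A : R * R -> R * R) : measure_preserving mu A -> L2 f ->
  sqnorm (f \o A) = sqnorm f.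
Proof.
move=> mpA f2; have m2 := measurable_funX 2 (L2_measurable f2).
exact: (Rintegral_measure_preserving (f := fun x => f x ^+ 2) mpA m2).
Qed.

Lemma sqnorm_eq0 f : L2 f -> sqnorm f = 0 -> {ae mu, forall x, f x = 0}.
Proof.
move=> f2 f0; have mf := L2_measurable f2.
pose F (x : T) := (f x ^+ 2)%:E.
have m2 : measurable_fun (setT : set T) F by exact/measurable_EFinP/measurable_funX.
have H : (\int[mu]_x `|F x| = 0)%E.
  transitivity (\int[mu]_x (f x ^+ 2)%:E)%E; last by rewrite sqnormE// f0.
  by apply: eq_integral => x _; rewrite /= ger0_norm// sqr_ge0.
move/(ae_eq_integral_abs mu measurableT m2) : H.
by apply: ae2S => x /(_ I) [] /eqP; rewrite sqrf_eq0 => /eqP.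
Qed.

Lemma measure_preserving_rotation t : measure_preserving mu (rotation t).
Proof. by apply: measure_preserving_rotate; rewrite cos2Dsin2. Qed.

Lemma L2_rotation f t : L2 f -> L2 (f \o rotation t).
Proof. exact: L2_measure_preserving (measure_preserving_rotation t). Qed.

Lemma rotation_2pi (x : R * R) : rotation (2 * pi) x = x.
Proof.
have := rotation0 x; rewrite /rotation; have -> : 2 * pi = pi *+ 2 :> R by rewrite mulr_natl.
by rewrite cos2pi sin2pi cos0 sin0.
Qed.

Lemma rotation_increment_sqnorm u g1 g2 s : has_H_gradient u g1 g2 -> 0 <= s ->
  sqnorm (fun x => u (rotation s x) - u x) <=
    s ^+ 2 * sqnorm (fun x => x.1 * g2 x - x.2 * g1 x).
Proof.
move=> uH s0; have [u2 _ _ _ th] := uH.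
have := rotation_increment_bound uH s0.
by rewrite (sqnormE (L2B (L2_rotation s u2) u2)) (sqnormE th) -EFinM lee_fin.
Qed.

Lemma sum_rotation_sqnorm w (N : nat) (a : R) : L2 w ->
  (\int[mu]_x (\sum_(k < N) (w (rotation (k%:R * a) x)) ^+ 2)%:E = (N%:R * sqnorm w)%:E)%E.
Proof.
move=> w2.
transitivity (\int[mu]_x (\sum_(k < N) ((w (rotation (k%:R * a) x)) ^+ 2)%:E))%E.
  by apply: eq_integral => x _; rewrite sumEFin.
rewrite ge0_integral_sum//.
- transitivity (\sum_(k < N) (sqnorm w)%:E)%E.
    apply: eq_bigr => k _; have wk := L2_rotation (k%:R * a) w2.
    by rewrite (sqnormE wk) (sqnorm_preserving (measure_preserving_rotation _) w2).
  by rewrite sumEFin sumr_const card_ord mulr_natl.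
- move=> k; apply/measurable_EFinP/measurable_funX.
  exact: (L2_measurable (L2_rotation (k%:R * a) w2)).
- by move=> k x _; rewrite lee_fin sqr_ge0.
Qed.

(** Along the orbit of x, the values of w form an N-periodic sequence with telescoping sum 0, to
    which [discrete_wirtinger] applies. Integrated over x, the N rotated copies contribute equally,
    so N cancels. The second difference d that remains is at most h times the angular derivative of
    w in norm, which is the source of h^2. *)
Lemma angular_wirtinger u g1 g2 (N : nat) : (0 < N)%N -> has_H_gradient u g1 g2 ->
  let h := 2 * pi / N%:R in
  let w := fun x => u (rotation h x) - u x in
  forall h1 h2, has_H_gradient w h1 h2 ->
  (2 - 2 * cos h) * sqnorm w <= h ^+ 2 * sqnorm (fun x => x.1 * h2 x - x.2 * h1 x).
Proof.
move=> N0 uH h w h1 h2 wH; have [u2 _ _ _ _] := uH; have [w2 _ _ _ _] := wH.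
have Np : 0 < N%:R :> R by rewrite ltr0n.
have h0 : 0 <= h by rewrite /h !mulr_ge0 ?invr_ge0 ?pi_ge0 ?ler0n.
apply: le_trans (rotation_increment_sqnorm wH h0).
pose d x := w (rotation h x) - w x.
have d2 : L2 d by apply: L2B => //; exact: L2_rotation.
rewrite -(ler_pM2l Np) mulrCA -lee_fin EFinM -(sum_rotation_sqnorm N h w2).
rewrite -(sum_rotation_sqnorm N h d2).
have c0 : 0 <= 2 - 2 * cos h :> R by rewrite subr_ge0 ler_piMr// cos_le1.
have mw k : measurable_fun (setT : set T) ((fun x => w (rotation (k%:R * h) x)) : T -> R).
  exact: (L2_measurable (L2_rotation (k%:R * h) w2)).
have md k : measurable_fun (setT : set T) ((fun x => d (rotation (k%:R * h) x)) : T -> R).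
  exact: (L2_measurable (L2_rotation (k%:R * h) d2)).
have ms (f : nat -> R * R -> R) : (forall k, measurable_fun (setT : set T) (f k : T -> R)) ->
    measurable_fun (setT : set T) ((fun x => \sum_(k < N) f k x ^+ 2) : T -> R).
  by move=> mf; apply: measurable_sum => k; exact: measurable_funX.
have mS := ms _ mw; have mSd := ms _ md.
rewrite -ge0_integralZl//; last 2 first.
- exact/measurable_EFinP.
- by move=> x _; rewrite lee_fin sumr_ge0// => k _; rewrite sqr_ge0.
apply: ge0_le_integral => //.
- by move=> x _; rewrite -EFinM lee_fin mulr_ge0// sumr_ge0// => k _; rewrite sqr_ge0.
- by apply: measurable_funeM; exact/measurable_EFinP.
- exact/measurable_EFinP.
move=> x _; rewrite -EFinM lee_fin.
pose v k := w (rotation (k%:R * h) x).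
have vE k : v k = u (rotation (k.+1%:R * h) x) - u (rotation (k%:R * h) x).
  by rewrite /v /w -rotationD -natr1 mulrDl mul1r [h + _]addrC.
have NhE : N%:R * h = 2 * pi by rewrite /h; field; rewrite gt_eqF.
have vN : v N = v 0%N by rewrite /v NhE rotation_2pi mul0r rotation0.
have v0 : \sum_(k < N) v k = 0.
  under eq_bigr do rewrite vE.
  rewrite -(big_mkord xpredT (fun k => u (rotation (k.+1%:R * h) x) - u (rotation (k%:R * h) x))).
  by rewrite telescope_sumr// NhE rotation_2pi mul0r rotation0 subrr.
have := discrete_wirtinger N0 vN v0.
congr (_ <= _); apply: eq_bigr => k _.
by rewrite /d /v -rotationD -natr1 mulrDl mul1r [h + _]addrC.
Qed.

End angular_wirtinger.

(** * The Gagliardo-Nirenberg inequality in the plane *)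

Section growth.
Context {R : realType}.
Implicit Types (a b : R).

(** Factor out a - b and bound each of the k + 1 remaining monomials by the k-th power of the
    maximum. *)
Lemma subr_expS_le a b k : 0 <= a -> 0 <= b ->
  a ^+ k.+1 - b ^+ k.+1 <= k.+1%:R * Num.max a b ^+ k * `|a - b|.
Proof.
move=> a0 b0; have m0 : 0 <= Num.max a b by rewrite le_max a0.
rewrite subrXX; apply: le_trans (ler_norm _) _.
rewrite normrM mulrC ler_wpM2r// ger0_norm; last first.
  by apply: sumr_ge0 => i _; rewrite mulr_ge0 ?exprn_ge0.
apply: (@le_trans _ _ (\sum_(i < k.+1) Num.max a b ^+ k)); last first.
  by rewrite sumr_const card_ord mulr_natl.
apply: ler_sum => i _.
have ik : (i <= k)%N by rewrite -ltnS.
rewrite /= -[X in _ <= _ ^+ X](subnK ik) exprD.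
by apply: ler_pM; rewrite ?exprn_ge0//; apply: lerXn2r; rewrite ?nnegrE// le_max lexx ?orbT.
Qed.

(* U is continuous with increments controlled by the indefinite integral A of
   |g|, and V is the indefinite integral of |U|^k |g|; a supremum argument
   replaces the chain rule for the absolutely continuous function |U|^(k+1). *)
Lemma power_growth (U A V : R -> R) (k : nat) (S : R) : 0 <= S ->
  (forall s, 0 <= s <= S -> forall e, 0 < e -> exists2 d, 0 < d &
    forall t, 0 <= t <= S -> `|t - s| < d -> `|U t - U s| <= e) ->
  (forall s t, 0 <= s -> s <= t -> t <= S -> `|U t - U s| <= A t - A s) ->
  (forall s t, 0 <= s -> s <= t -> t <= S -> 0 <= V t - V s) ->
  (forall s t m, 0 <= s -> s <= t -> t <= S ->
    (forall r, s <= r -> r <= t -> m <= `|U r| ^+ k) -> m * (A t - A s) <= V t - V s) ->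
  `|U 0| ^+ k.+1 <= `|U S| ^+ k.+1 + k.+1%:R * (V S - V 0).
Proof.
move=> S0 cU UA V0 mV.
have A0 s t : 0 <= s -> s <= t -> t <= S -> 0 <= A t - A s.
  by move=> s0 st tS; apply: le_trans (UA _ _ s0 st tS).
have kp : 0 <= k.+1%:R :> R by [].
(* The extra term pays for freezing |U|^k on short intervals, at a cost of 2 eps per unit of A; it
   disappears as eps tends to 0. *)
suff H eps : 0 < eps -> `|U 0| ^+ k.+1 <=
    `|U S| ^+ k.+1 + k.+1%:R * (V S - V 0) + k.+1%:R * (2 * eps) * (A S - A 0).
  apply/ler_addgt0Pr => e e0.
  have AS := A0 _ _ (lexx 0) S0 (lexx S).
  pose c := k.+1%:R * 2 * (A S - A 0) + 1.
  have c0 : 0 < c by rewrite /c ltr_wpDl// !mulr_ge0.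
  apply: le_trans (H (e / c) (divr_gt0 e0 c0)) _; rewrite lerD2l.
  have -> : k.+1%:R * (2 * (e / c)) * (A S - A 0) = e * ((c - 1) / c).
    have -> : c - 1 = k.+1%:R * 2 * (A S - A 0) by rewrite /c addrK.
    by field; rewrite gt_eqF.
  rewrite ger_pMr// ler_pdivrMr// mul1r lerBlDr lerDl//.
move=> eps0.
pose D s := `|U s| ^+ k.+1 + k.+1%:R * (V s - V 0) + k.+1%:R * (2 * eps) * (A s - A 0).
(* The times at which the estimate with slack holds. The aim is to show that the supremum z of P is
   S. *)
pose P := [set s | 0 <= s <= S /\ `|U 0| ^+ k.+1 <= D s].
have P0 : P 0 by split; [rewrite lexx|rewrite /D !subrr !mulr0 !addr0].
have supP : has_sup P by split; [exists 0|exists S => s [/andP[]]].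
pose z := sup P.
have z0 : 0 <= z by apply: sup_upper_bound.
have zS : z <= S by apply: ge_sup; [exists 0|move=> s [/andP[]]].
have cUn s (j : nat) : 0 <= s <= S -> forall e, 0 < e -> exists2 d, 0 < d &
    forall t, 0 <= t <= S -> `|t - s| < d -> `| `|U t| ^+ j - `|U s| ^+ j | <= e.
  move=> sS e e0.
  have cj : (`|y| ^+ j) @[y --> U s] --> `|U s| ^+ j.
    apply: (@continuous_comp _ _ _ (fun y : R => `|y|) (fun y : R => y ^+ j)).
      exact: norm_continuous.
    exact: exprn_continuous.
  move/cvgrPdist_le : cj => /(_ _ e0)/nbhs_ballP[d1 /= d10 Hd1].
  have d120 : 0 < d1 / 2 by rewrite divr_gt0.
  have [d d0 Hd] := cU _ sS _ d120.
  exists d => // t tS td; rewrite distrC; apply: Hd1; rewrite /ball /= distrC.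
  by apply: le_lt_trans (Hd _ tS td) _; rewrite ltr_pdivrMr// ltr_pMr// ltr1n.
(* U is continuous while V and A are nondecreasing, so the estimate passes from times just below z
   to z. *)
have Pz : `|U 0| ^+ k.+1 <= D z.
  apply/ler_addgt0Pr => e e0.
  have [d d0 Hd] := cUn z k.+1 (introT andP (conj z0 zS)) e e0.
  have [s [/andP[s0 sS] Ps] sz] := sup_adherent d0 supP.
  have {}sz : z - d < s by [].
  have sz' : s <= z by apply: sup_upper_bound => //; split => //; apply/andP.
  apply: le_trans Ps _; rewrite /D.
  have /ler_normlP[_] : `| `|U s| ^+ k.+1 - `|U z| ^+ k.+1 | <= e.
    by apply: Hd; rewrite ?s0 ?sS// ler0_norm ?subr_le0// opprB ltrBlDr -ltrBlDl.
  have Vm : k.+1%:R * (V s - V 0) <= k.+1%:R * (V z - V 0).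
    by rewrite ler_wpM2l// lerD2r -subr_ge0; exact: V0.
  have Am : k.+1%:R * (2 * eps) * (A s - A 0) <= k.+1%:R * (2 * eps) * (A z - A 0).
    have Km : 0 <= k.+1%:R * (2 * eps) by apply: mulr_ge0 => //; rewrite mulr_ge0// ltW.
    by rewrite ler_wpM2l// lerD2r -subr_ge0; exact: A0.
  by move: Vm Am; lra.
have [<-|zneS] := eqVneq z S; first exact: Pz.
have {}zS : z < S by rewrite lt_neqAle zneS.
exfalso.
have [d1 d10 Hd1] := cUn z k (introT andP (conj z0 (ltW zS))) eps eps0.
have [d2 d20 Hd2] := cUn z 1%N (introT andP (conj z0 (ltW zS))) eps eps0.
(* Up to t, |U|^k stays within eps of its value at z. So |U|^(k+1) drops by at most (k+1) (|U z|^k +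
   eps) (A t - A z), while V gains at least (|U z|^k - eps) (A t - A z). The gap of 2 eps is the
   slack in D, and t lies in P beyond its supremum. *)
pose t := Num.min S (z + d1 / 2).
have zt : z < t by rewrite lt_min zS ltrDl divr_gt0.
have tS : t <= S by rewrite ge_min lexx.
have td : t <= z + d1 / 2 by rewrite ge_min lexx orbT.
have t0 : 0 <= t by apply: le_trans z0 (ltW zt).
have near r : z <= r -> r <= t -> `| `|U r| ^+ k - `|U z| ^+ k | <= eps.
  move=> zr rt; apply: Hd1.
    by rewrite (le_trans z0 zr) (le_trans rt tS).
  rewrite ger0_norm ?subr_ge0//; have := le_trans rt td; have : d1 / 2 < d1 by lra.
  lra.
suff Pt : P t by have := sup_upper_bound supP Pt; rewrite leNgt -/z zt.
split; first by rewrite t0 tS.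
apply: le_trans Pz _.
have At := A0 _ _ z0 (ltW zt) tS.
have low : (`|U z| ^+ k - eps) * (A t - A z) <= V t - V z.
  apply: mV => //; first exact: ltW.
  by move=> r zr rt; have := near r zr rt; rewrite ler_norml => /andP[+ _]; lra.
have up : `|U z| ^+ k.+1 - `|U t| ^+ k.+1 <= k.+1%:R * ((`|U z| ^+ k + eps) * (A t - A z)).
  apply: le_trans (subr_expS_le _ _ _) _ => //.
  rewrite -mulrA ler_wpM2l//; apply: ler_pM => //.
  - have := near t (ltW zt) (lexx t); rewrite ler_norml => /andP[_ H].
    rewrite /Num.max; case: ifP => _; last by rewrite lerDl ltW.
    by move: H; lra.
  - rewrite distrC; apply: le_trans (ler_dist_dist _ _) _.
    exact: UA z0 (ltW zt) tS.
have : k.+1%:R * (`|U z| ^+ k - eps) * (A t - A z) <= k.+1%:R * (V t - V z).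
  by rewrite -mulrA ler_wpM2l.
rewrite /D; move: up; set a := `|U z| ^+ k; set b := _ ^+ k.+1; set c := _ ^+ k.+1.
set K := k.+1%:R.
nra.
Qed.

End growth.

(** * The one-dimensional estimate on a line *)

Section sobolev_line.
Context {R : realType}.
Let R1 : measurableType _ := measurableTypeR R.
Local Notation leb := (@lebesgue_measure R).
Implicit Types (s t S : R).

Lemma ae1S (P Q : R -> Prop) : (forall x, P x -> Q x) ->
  {ae leb, forall x, P x} -> {ae leb, forall x, Q x}.
Proof. by move=> PQ; exact: (@filterS _ _ (ae_filter_ringOfSetsType leb)). Qed.

Lemma ae1I (P Q : R -> Prop) : {ae leb, forall x, P x} ->
  {ae leb, forall x, Q x} -> {ae leb, forall x, P x /\ Q x}.
Proof. exact: (@filterI _ _ (ae_filter_ringOfSetsType leb)). Qed.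

Lemma ae1_neq (a : R) : {ae leb, forall x, x != a}.
Proof.
exists [set a]; split; [exact: measurable_set1|exact: lebesgue_measure_set1|].
by move=> x /= /negP; rewrite negbK => /eqP.
Qed.

Section interval_integrals.
Variables (f : R -> R) (S : R).
Hypothesis If : leb.-integrable `[0, S] (EFin \o f).

Lemma integrable_subitv s t (b1 b2 : bool) : 0 <= s -> t <= S ->
  leb.-integrable [set` Interval (BSide b1 s) (BSide b2 t)] (EFin \o f).
Proof.
move=> s0 tS; apply: integrableS If => //; apply: subset_itv.
  by case: b1; rewrite bnd_simp.
by case: b2; rewrite bnd_simp.
Qed.

Lemma Rintegral_interval_sub s t : 0 <= s -> s <= t -> t <= S ->
  \int[leb]_(r in `[0, t]) f r - \int[leb]_(r in `[0, s]) f r = \int[leb]_(r in `]s, t]) f r.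
Proof.
move=> s0 st tS; rewrite (@Rintegral_itvB _ f (BLeft 0) (BRight t) s)//; first exact: integrable_subitv.
Qed.

Lemma Rintegral_interval_continuous s : 0 <= s <= S -> forall e, 0 < e -> exists2 d, 0 < d &
    forall t, 0 <= t <= S -> `|t - s| < d ->
      `|\int[leb]_(r in `[0, t]) f r - \int[leb]_(r in `[0, s]) f r| <= e.
Proof.
move=> sS e e0; have S0 : 0 <= S by case/andP: sS => /le_trans; apply.
have := parameterized_integral_continuous S0 If.
move/subspace_continuousP => /(_ s); rewrite /= in_itv /= => /(_ sS) /cvgrPdist_le /(_ _ e0).
move=> /nbhs_ballP[d /= d0 H]; exists d => // t tS td.
by rewrite distrC; apply: H => //=; rewrite /ball /= distrC.
Qed.

End interval_integrals.

Lemma sqr_integrable_interval (g : R -> R) S : measurable_fun (setT : set R1) (g : R1 -> R) ->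
  (\int[leb]_t (g t ^+ 2)%:E < +oo)%E -> leb.-integrable `[0, S] (EFin \o g).
Proof.
move=> mg g2; have mI : measurable (`[0, S]%classic : set R1) by exact: measurable_itv.
have I1 : leb.-integrable (`[0, S]%classic : set R1) (EFin \o (fun=> 1)).
  apply/integrableP; split; first exact/measurable_EFinP/measurable_cst.
  rewrite /= normr1 integral_cst//= mul1e.
  by rewrite lebesgue_measure_itv/=; case: ifP => _; rewrite ?ltry// -EFinB ltry.
have I2 : leb.-integrable (`[0, S]%classic : set R1) (EFin \o (fun t => g t ^+ 2)).
  apply: (integrableS (E := setT)) => //; apply/integrableP; split.
    exact/measurable_EFinP/measurable_funX.
  by under eq_integral do rewrite /= ger0_norm ?sqr_ge0//.
apply: (le_integrable mI _ _ (integrableD mI I1 I2)) => //.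
  exact/measurable_EFinP/measurable_funTS.
move=> t _; rewrite /= lee_fin (ger0_norm (addr_ge0 ler01 (sqr_ge0 (g t)))).
by rewrite -(real_normK (num_real (g t))); have := normr_ge0 (g t); nra.
Qed.

(** Replaces decay at infinity: a square integrable function cannot exceed e in modulus at almost
    all positive times. Q transports an almost sure property to the time that is found. *)
Lemma exists_small (u : R -> R) (Q : R -> Prop) (e : R) :
  measurable_fun (setT : set R1) (u : R1 -> R) ->
  (\int[leb]_t (u t ^+ 2)%:E < +oo)%E -> {ae leb, forall s, 0 < s -> Q s} ->
  0 < e -> exists S, [/\ 0 < S, Q S & `|u S| <= e].
Proof.
move=> mu u2 aeQ e0; apply: contrapT => nS.
have big s : 0 < s -> Q s -> e < `|u s|.
  move=> s0 Qs; rewrite ltNge; apply/negP => us; apply: nS.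
  by exists s; split.
have I0 : (0 <= \int[leb]_t (u t ^+ 2)%:E)%E.
  by apply: integral_ge0 => t _; rewrite lee_fin sqr_ge0.
have Ifin : (\int[leb]_t (u t ^+ 2)%:E)%E \is a fin_num by rewrite ge0_fin_numE.
pose M := fine (\int[leb]_t (u t ^+ 2)%:E)%E.
have M0 : 0 <= M by rewrite fine_ge0.
(* Chosen so that e^2 L = M + e^2 exceeds the whole integral M. *)
pose L := M / e ^+ 2 + 1.
have e20 : 0 < e ^+ 2 by rewrite exprn_gt0.
have L0 : 0 < L by rewrite ltr_wpDl// divr_ge0// ltW.
have mI : measurable (`]0, L]%classic : set R1) by exact: measurable_itv.
have : (\int[leb]_(t in `]0%R, L]) (e ^+ 2)%:E <= \int[leb]_t (u t ^+ 2)%:E)%E.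
  apply: (@le_trans _ _ (\int[leb]_(t in `]0%R, L]) (u t ^+ 2)%:E)%E).
    apply: ae_ge0_le_integral => //.
    - by move=> t _; rewrite lee_fin ltW.
    - by move=> t _; rewrite lee_fin sqr_ge0.
    - by apply/measurable_EFinP/measurable_funTS/measurable_funX.
    - apply: ae1S aeQ => t Qt; rewrite /= in_itv /= => /andP[t0 _].
      rewrite lee_fin -(real_normK (num_real (u t))).
      by apply: lerXn2r; rewrite ?nnegrE// ltW//; apply: big => //; exact: Qt.
  apply: ge0_subset_integral => //; first exact/measurable_EFinP/measurable_funX.
  by move=> t _; rewrite lee_fin sqr_ge0.
rewrite -(fineK Ifin) -/M integral_cst//=.
rewrite lebesgue_measure_itv/= lte_fin L0 sube0 -EFinM lee_fin.
rewrite /L mulrDr mulr1 mulrCA divff ?gt_eqF// mulr1 gerDl.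
by rewrite leNgt e20.
Qed.

(** Apply [power_growth] on [0, S], where S is a time at which u is small; the integral over the
    whole line dominates the one over [0, S]. The formula is anchored at u 0 because in the plane it
    holds from almost every starting point. *)
Lemma sobolev_line0 (u g : R -> R) (k : nat) :
  measurable_fun (setT : set R1) (u : R1 -> R) -> measurable_fun (setT : set R1) (g : R1 -> R) ->
  (\int[leb]_t (u t ^+ 2)%:E < +oo)%E -> (\int[leb]_t (g t ^+ 2)%:E < +oo)%E ->
  {ae leb, forall s, 0 < s -> u s - u 0 = \int[leb]_(t in `[0, s]) g t} ->
  ((`|u 0| ^+ k.+1)%:E <= k.+1%:R%:E * \int[leb]_t (`|u t| ^+ k * `|g t|)%:E)%E.
Proof.
move=> mu mg u2 g2 aeu; set I := (\int[leb]_t _)%E.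
have mF : measurable_fun (setT : set R1) (fun t : R1 => (`|u t| ^+ k * `|g t|)%:E).
  apply/measurable_EFinP/measurable_funM; last exact: measurableT_comp.
  by apply: measurable_funX; exact: measurableT_comp.
have F0 t : (0 <= (`|u t| ^+ k * `|g t|)%:E)%E by rewrite lee_fin mulr_ge0.
have I0 : (0 <= I)%E by exact: integral_ge0.
have [->|] := eqVneq I +oo%E; first by rewrite gt0_muley ?lte_fin ?ltr0n// leey.
rewrite -ltey => Ioo.
have Ifin : I \is a fin_num by rewrite ge0_fin_numE.
rewrite -(fineK Ifin) -EFinM lee_fin.
apply/ler_addgt0Pr => e e0.
have de : exists2 d : R, 0 < d & d ^+ k.+1 <= e.
  exists (Num.min 1 e); first by rewrite lt_min ltr01.
  rewrite exprS (@le_trans _ _ (Num.min 1 e * 1))//.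
    have m0 : 0 <= Num.min 1 e by rewrite le_min ler01 ltW.
    by rewrite ler_wpM2l// exprn_ile1// ge_min lexx.
  by rewrite mulr1 ge_min lexx orbT.
have [d d0 dke] := de.
have [S [S0 uS uSd]] := exists_small mu u2 aeu d0.
have S0' := ltW S0.
(* The continuous representative of u on [0, S]. It equals u at the two end points, and almost
   everywhere in between. *)
pose U s := u 0 + \int[leb]_(t in `[0, s]) g t.
have US : U S = u S by rewrite /U -uS addrC subrK.
have U0 : U 0 = u 0.
  rewrite /U /Rintegral (@integral_Sset1 R (EFin \o g) `[0, 0] 0) ?addr0//.
  by move=> t /=; rewrite in_itv /= => /andP[t0 t0']; apply/eqP; rewrite eq_le t0 t0'.
have Ig := sqr_integrable_interval S mg g2.
have Ing : leb.-integrable `[0, S] (EFin \o (fun t => `|g t|)) by exact: integrable_norm.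
pose A s := \int[leb]_(t in `[0, s]) `|g t|.
have mI : measurable (`[0, S]%classic : set R1) by exact: measurable_itv.
have UA s t : 0 <= s -> s <= t -> t <= S -> `|U t - U s| <= A t - A s.
  move=> s0 st tS; rewrite /U /A opprD addrACA subrr add0r.
  rewrite (Rintegral_interval_sub Ig s0 st tS) (Rintegral_interval_sub Ing s0 st tS).
  apply: le_normr_Rintegral; first exact: measurable_itv.
  exact: (integrable_subitv Ig).
have cU s : 0 <= s <= S -> forall e, 0 < e -> exists2 d, 0 < d &
    forall t, 0 <= t <= S -> `|t - s| < d -> `|U t - U s| <= e.
  move=> sS e' e'0; have [d' d'0 H] := Rintegral_interval_continuous Ig sS e'0.
  exists d' => // t tS td; rewrite /U opprD addrACA subrr add0r.
  exact: H.
pose M := `|u 0| + A S.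
have A00 : 0 <= A 0 by apply: Rintegral_ge0 => t _.
have UM s : 0 <= s -> s <= S -> `|U s| <= M.
  move=> s0 sS; rewrite -(subrK (U 0) (U s)) addrC; apply: le_trans (ler_normD _ _) _.
  rewrite U0 /M lerD2l -U0; apply: le_trans (UA _ _ (lexx 0) s0 sS) _.
  have : 0 <= A S - A s by apply: le_trans (UA _ _ s0 sS (lexx S)).
  lra.
have mU : measurable_fun (`[0, S]%classic : set R1) (U : R1 -> R).
  apply: subspace_continuous_measurable_fun => //.
  apply/subspace_continuousP => s; rewrite /= in_itv /= => sS.
  apply/cvgrPdist_le => e' e'0; have [d' d'0 H] := cU s sS e' e'0.
  apply/nbhs_ballP; exists d' => //= t; rewrite /ball /= => td; rewrite in_itv /= => tS.
  by rewrite distrC; apply: H => //; rewrite distrC.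
have mUk : measurable_fun (`[0, S]%classic : set R1) ((fun t => `|U t| ^+ k) : R1 -> R).
  by apply: measurable_funX; exact: measurableT_comp.
have M0 : 0 <= M by apply: le_trans (UM 0 (lexx 0) S0').
have IV : leb.-integrable `[0, S] (EFin \o (fun t => `|U t| ^+ k * `|g t|)).
  apply: (le_integrable mI _ _ (integrableZl mI (M ^+ k) Ing)).
  - apply/measurable_EFinP/measurable_funM => //.
    by apply/measurable_funTS; exact: measurableT_comp.
  - move=> t; rewrite /= in_itv /= => /andP[t0 tS]; rewrite lee_fin.
    have Mk : 0 <= M ^+ k by rewrite exprn_ge0.
    rewrite /= !normrM normrX !normr_id (ger0_norm Mk).
    by rewrite ler_wpM2r// lerXn2r ?nnegrE//; exact: UM.
pose V s := \int[leb]_(t in `[0, s]) (`|U t| ^+ k * `|g t|).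
have V0 s t : 0 <= s -> s <= t -> t <= S -> 0 <= V t - V s.
  move=> s0 st tS; rewrite (Rintegral_interval_sub IV s0 st tS).
  by apply: Rintegral_ge0 => r _; rewrite mulr_ge0 ?exprn_ge0.
have mV s t m : 0 <= s -> s <= t -> t <= S ->
    (forall r, s <= r -> r <= t -> m <= `|U r| ^+ k) -> m * (A t - A s) <= V t - V s.
  move=> s0 st tS mm; rewrite (Rintegral_interval_sub IV s0 st tS) (Rintegral_interval_sub Ing s0 st tS).
  have I1 := integrable_subitv Ing false false s0 tS.
  have I2 := integrable_subitv IV false false s0 tS.
  have mst : measurable (`]s, t]%classic : set R1) by exact: measurable_itv.
  rewrite -(RintegralZl m mst I1); apply: le_Rintegral => //.
    exact: (@integrableZl _ _ _ leb _ mst m _ I1).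
  by move=> r; rewrite /= in_itv /= => /andP[sr rt]; rewrite ler_wpM2r// mm// ltW.
have main := power_growth S0' cU UA V0 mV.
rewrite U0 US in main.
apply: le_trans main _; rewrite addrC; apply: lerD; last first.
  by apply: le_trans dke; apply: lerXn2r; rewrite ?nnegrE// ltW.
rewrite ler_wpM2l//.
have V00 : 0 <= V 0 by apply: Rintegral_ge0 => t _; rewrite mulr_ge0 ?exprn_ge0.
apply: (@le_trans _ _ (V S)); first by rewrite gerBl.
have IVfin := integrable_fin_num mI IV.
rewrite -lee_fin /V /Rintegral !fineK//.
apply: (@le_trans _ _ (\int[leb]_(t in `[0%R, S]) (`|u t| ^+ k * `|g t|)%:E)%E); last first.
  exact: ge0_subset_integral.
rewrite le_eqVlt; apply/orP; left; apply/eqP; apply: ae_eq_integral => //.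
- exact: (measurable_int leb IV).
- exact: measurable_funTS.
(* The formula for u concerns positive times, so the time 0 is discarded as a null set. *)
- apply: ae1S (ae1I aeu (ae1_neq 0)) => t [Ht t0]; rewrite /= in_itv /= => /andP[t0' _].
  by rewrite /= /U -Ht ?lt_neqAle 1?eq_sym ?t0//= addrC subrK.
Qed.

End sobolev_line.

(** * Exchanging almost everywhere quantifiers *)

Section fubini_ae.
Context {d1 d2 : measure_display} {T1 : measurableType d1} {T2 : measurableType d2} {R : realType}.
Variables (m1 : {sigma_finite_measure set T1 -> \bar R}) (m2 : {sigma_finite_measure set T2 -> \bar R}).

(** Tonelli for the indicator of the complement of E: both iterated integrals are equal, and one is
    zero. *)
Lemma ae_swap (E : set (T1 * T2)) : measurable E ->
  {ae m2, forall y, {ae m1, forall x, E (x, y)}} ->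
  {ae m1, forall x, {ae m2, forall y, E (x, y)}}.
Proof.
move=> mE aeE; pose F (p : T1 * T2) : \bar R := (\1_(~` E) p)%:E.
have mF : measurable_fun setT F.
  by apply/measurable_EFinP; apply: measurable_indic; exact: measurableC.
have F0 p : (0 <= F p)%E by rewrite lee_fin indicE.
have mF1 := @measurable_fun_fubini_tonelli_F _ _ T1 T2 R m2 F mF F0.
have mF2 := @measurable_fun_fubini_tonelli_G _ _ T1 T2 R m1 F mF F0.
have FE p : F p = 0%E -> E p.
  rewrite /F indicE => -[] H; apply: contrapT => nE; move: H.
  by rewrite mem_set// => /eqP; rewrite oner_eq0.
have EF p : E p -> F p = 0%E by move=> Ep; rewrite /F indicE memNset//; exact.
have I0 : (\int[m1]_x `|\int[m2]_y F (x, y)| = 0)%E.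
  transitivity (\int[m1]_x \int[m2]_y F (x, y))%E.
    by apply: eq_integral => x _; rewrite gee0_abs//; exact: integral_ge0.
  rewrite (@fubini_tonelli _ _ T1 T2 R m1 m2 F mF F0).
  transitivity (\int[m2]_y (cst 0 y))%E; last by rewrite integral0.
  apply: ae_eq_integral => //.
  apply: (@filterS _ _ (ae_filter_ringOfSetsType m2)) aeE => y aey _.
  transitivity (\int[m1]_x (cst 0 x))%E; last by rewrite integral0.
  apply: ae_eq_integral => //; first exact: (measurableT_comp mF (pair2_measurable y)).
  by apply: (@filterS _ _ (ae_filter_ringOfSetsType m1)) aey => x Exy _; rewrite EF.
move/(ae_eq_integral_abs m1 measurableT mF1) : I0.
apply: (@filterS _ _ (ae_filter_ringOfSetsType m1)) => x /(_ I) Fx.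
have mFx := measurableT_comp mF (pair1_measurable x).
have : (\int[m2]_y `|F (x, y)| = 0)%E.
  by rewrite -[RHS]Fx; apply: eq_integral => y _; rewrite gee0_abs.
move/(ae_eq_integral_abs m2 measurableT mFx).
by apply: (@filterS _ _ (ae_filter_ringOfSetsType m2)) => y /(_ I); exact: FE.
Qed.

End fubini_ae.

Section plane_ae.
Context {R : realType}.
Let R1 : measurableType _ := measurableTypeR R.
Let T : measurableType _ := (R1 * R1)%type.
Local Notation leb := (@lebesgue_measure R).
Local Notation mu := (leb2 R).

Lemma ae_fst (P : R -> Prop) : {ae leb, forall x, P x} -> {ae mu, forall x, P x.1}.
Proof.
move=> [N [mN N0 PN]]; exists (N `*` setT); split.
- exact: measurableX.
- have := @product_measure1E _ _ R1 R1 R leb leb N setT mN measurableT.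
  by rewrite [X in (X * _)%E](_ : _ = 0%E)// mul0e.
- by move=> x /= nP; split => //; exact: PN.
Qed.

Lemma ae_snd (P : R -> Prop) : {ae leb, forall x, P x} -> {ae mu, forall x, P x.2}.
Proof.
move=> [N [mN N0 PN]]; exists (setT `*` N); split.
- exact: measurableX.
- have := @product_measure1E _ _ R1 R1 R leb leb setT N measurableT mN.
  by rewrite [X in (_ * X)%E](_ : _ = 0%E)// mule0.
- by move=> x /= nP; split => //; exact: PN.
Qed.

Lemma ae_lty_fst (F : R * R -> \bar R) : measurable_fun (setT : set T) (F : T -> \bar R) ->
  (forall x, 0 <= F x)%E -> (\int[mu]_x F x < +oo)%E ->
  {ae mu, forall x, (\int[leb]_y F (x.1, y) < +oo)%E}.
Proof.
move=> mF F0 Ioo; apply: (@ae_fst (fun a => \int[leb]_y F (a, y) < +oo)%E).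
have mG := @measurable_fun_fubini_tonelli_F _ _ R1 R1 R leb F mF F0.
have IE := @fubini_tonelli1 _ _ R1 R1 R leb leb F mF F0.
have : leb.-integrable setT (fubini_F leb F).
  apply/integrableP; split => //; apply: le_lt_trans Ioo.
  rewrite [leRHS]IE le_eqVlt; apply/orP; left; apply/eqP.
  by apply: eq_integral => x _; rewrite gee0_abs//; exact: integral_ge0.
move/(integrable_ae measurableT); apply: ae1S => x /(_ I).
by rewrite ge0_fin_numE//; exact: integral_ge0.
Qed.

Lemma ae_lty_snd (F : R * R -> \bar R) : measurable_fun (setT : set T) (F : T -> \bar R) ->
  (forall x, 0 <= F x)%E -> (\int[mu]_x F x < +oo)%E ->
  {ae mu, forall x, (\int[leb]_y F (y, x.2) < +oo)%E}.
Proof.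
move=> mF F0 Ioo; apply: (@ae_snd (fun a => \int[leb]_y F (y, a) < +oo)%E).
have mG := @measurable_fun_fubini_tonelli_G _ _ R1 R1 R leb F mF F0.
have IE := @fubini_tonelli2 _ _ R1 R1 R leb leb F mF F0.
have : leb.-integrable setT (fubini_G leb F).
  apply/integrableP; split => //; apply: le_lt_trans Ioo.
  rewrite [leRHS]IE le_eqVlt; apply/orP; left; apply/eqP.
  by apply: eq_integral => x _; rewrite gee0_abs//; exact: integral_ge0.
move/(integrable_ae measurableT); apply: ae1S => x /(_ I).
by rewrite ge0_fin_numE//; exact: integral_ge0.
Qed.

End plane_ae.

Section flow_sobolev.
Context {R : realType}.
Let R1 : measurableType _ := measurableTypeR R.
Let T : measurableType _ := (R1 * R1)%type.
Local Notation leb := (@lebesgue_measure R).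
Local Notation mus := (@plane_measure R).
Local Notation mu := (leb2 R).
Variables (Phi : R -> R * R -> R * R) (X : (R * R -> R) -> R * R -> R).
Hypothesis flowP : plane_flow Phi X.
Variables (u g : R * R -> R).
Hypothesis u2 : L2 u.
Hypothesis g2 : L2 g.
Hypothesis weak_X : forall phi, test_function phi ->
  \int[mu]_x (u x * X phi x) = - \int[mu]_x (g x * phi x).

Let mflow : measurable_fun (setT : set (T * R1)) ((fun p => Phi p.2 p.1) : T * R1 -> T)
  := flow_measurable flowP.

(** In [weak_flow_formula] the null set of points depends on s. After the exchange of quantifiers,
    one null set of points is discarded and the formula holds along each remaining orbit at almost
    every time. *)
Lemma weak_flow_formula_ae :
  {ae mu, forall x, {ae leb, forall s, 0 < s ->
     u (Phi s x) - u x = \int[leb]_(t in `[0, s]) g (Phi t x)}}.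
Proof.
have mu' := L2_measurable u2; have mg := L2_measurable g2.
(* For q = ((x, s), t) this is the condition 0 <= t <= s, as one measurable set; it makes the
   integral over [0, s] jointly measurable in x and s. *)
pose W : set (T * R1 * R1) := (snd @^-1` `[0, +oo[%classic) `&`
  ((fun q => q.1.2 - q.2) @^-1` `[0, +oo[%classic).
have m2 : measurable_fun (setT : set (T * R1 * R1)) (snd : _ -> R1) by exact: measurable_snd.
have m12 : measurable_fun (setT : set (T * R1 * R1)) ((fun q => q.1.2) : _ -> R1).
  exact: (measurableT_comp measurable_snd measurable_fst).
have m11 : measurable_fun (setT : set (T * R1 * R1)) ((fun q => q.1.1) : _ -> T).
  exact: (measurableT_comp measurable_fst measurable_fst).
have mI : measurable (`[0, +oo[%classic : set R1) by exact: measurable_itv.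
have mW : measurable W.
  apply: measurableI; rewrite -[X in measurable X]setTI; first exact: m2.
  exact: (measurable_funB m12 m2).
pose F (q : T * R1 * R1) : R := \1_W q * g (Phi q.2 q.1.1).
have mF : measurable_fun (setT : set (T * R1 * R1)) F.
  apply: measurable_funM; first exact: measurable_indic.
  apply: (measurableT_comp mg); exact: (measurableT_comp mflow (measurable_fun_pair m11 m2)).
have mG := measurable_Rintegral_section leb mF.
pose D (p : T * R1) : R := u (Phi p.2 p.1) - u p.1 - \int[leb]_t F (p, t).
have mD : measurable_fun (setT : set (T * R1)) D.
  apply: measurable_funB => //; apply: measurable_funB; first exact: (measurableT_comp mu' mflow).
  exact: (measurableT_comp mu' measurable_fst).
have GE p : \int[leb]_t F (p, t) = \int[leb]_(t in `[0, p.2]) g (Phi t p.1).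
  rewrite /Rintegral -integral_window; congr fine; apply: eq_integral => t _.
  rewrite /F /window; congr ((_ * _)%:E); rewrite !indicE; congr ((_ : bool)%:R).
  apply/idP/idP; rewrite !inE /W /= !in_itv /= !andbT subr_ge0.
    by move=> [-> ->].
  by move=> /andP[].
pose E : set (T * R1) := (snd @^-1` `]-oo, 0]%classic) `|` (D @^-1` [set 0]).
have mE : measurable E.
  apply: measurableU; rewrite -[X in measurable X]setTI.
    by apply: measurable_snd => //; exact: measurable_itv.
  by apply: mD => //; exact: measurable_set1.
have H : {ae mus, forall x, {ae leb, forall s, E (x, s)}}.
  apply: (ae_swap mE); apply: aeW => s.
  have [s0|s0] := leP s 0.
    by apply: aeW => x; left; rewrite /= in_itv.
  apply: ae2S (weak_flow_formula flowP u2 g2 weak_X s0) => x Ex; right.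
  rewrite /D /= Ex GE /= -[RHS](subrr (\int[leb]_(t in `[0, s]) g (Phi t x))); congr (_ - _).
  by rewrite /Rintegral integral_window.
apply: ae2S H => x; apply: ae1S => s [|].
  by rewrite /= in_itv /= leNgt => /negP.
by rewrite /D /= GE /= => /eqP; rewrite subr_eq0 => /eqP.
Qed.

Lemma weak_flow_sobolev k :
  {ae mu, forall x, (\int[leb]_t (u (Phi t x) ^+ 2)%:E < +oo)%E} ->
  {ae mu, forall x, (\int[leb]_t (g (Phi t x) ^+ 2)%:E < +oo)%E} ->
  {ae mu, forall x, ((`|u x| ^+ k.+1)%:E <=
     k.+1%:R%:E * \int[leb]_t (`|u (Phi t x)| ^+ k * `|g (Phi t x)|)%:E)%E}.
Proof.
move=> Hu Hg; apply: ae2S (ae2I (ae2I Hu Hg) weak_flow_formula_ae) => x [[Ux Gx] Ex].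
have mP : measurable_fun (setT : set R1) ((fun t => Phi t x) : R1 -> T).
  exact: (measurableT_comp mflow (pair1_measurable (x : T))).
have mu' := measurableT_comp (L2_measurable u2) mP.
have mg := measurableT_comp (L2_measurable g2) mP.
rewrite -{1}(flow0 flowP x).
apply: (@sobolev_line0 _ (fun t => u (Phi t x)) (fun t => g (Phi t x)) k mu' mg Ux Gx).
by apply: ae1S Ex => s H s0; rewrite /= (flow0 flowP); exact: H.
Qed.

End flow_sobolev.

(** * Gagliardo's inequality and the even moments *)

Section gagliardo.
Context {R : realType}.
Let R1 : measurableType _ := measurableTypeR R.
Let T : measurableType _ := (R1 * R1)%type.
Local Notation leb := (@lebesgue_measure R).
Local Notation mu := (leb2 R).
Implicit Types (u g : R * R -> R).

Lemma integral_line_translate (f : R -> R) (a : R) :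
  measurable_fun (setT : set R1) (f : R1 -> R) ->
  (\int[leb]_t (f (a + t))%:E = \int[leb]_t (f t)%:E)%E.
Proof.
move=> mf; under eq_integral do rewrite addrC.
apply: (@integral_measure_preserving _ _ _ leb (fun t => t + a) (fun t => (f t)%:E)).
  exact: measure_preserving_addr.
exact/measurable_EFinP.
Qed.

Let measurable_sect1 (f : R * R -> R) (a : R) : measurable_fun (setT : set T) (f : T -> R) ->
  measurable_fun (setT : set R1) ((fun t => f (t, a)) : R1 -> R).
Proof. by move=> mf; exact: (measurableT_comp mf (pair2_measurable a)). Qed.

Let measurable_sect2 (f : R * R -> R) (a : R) : measurable_fun (setT : set T) (f : T -> R) ->
  measurable_fun (setT : set R1) ((fun t => f (a, t)) : R1 -> R).
Proof. by move=> mf; exact: (measurableT_comp mf (pair1_measurable a)). Qed.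

(** At almost every point, |u|^(k+1) is bounded by (k+1) times a line integral in each coordinate
    direction. Multiplying the two bounds gives |u|^(2k+2) on the left and (k+1)^2 on the right. *)
Lemma gagliardo_prod u g1 g2 k : has_H_gradient u g1 g2 ->
  (\int[mu]_x (`|u x| ^+ (2 * k.+1))%:E <= (k.+1%:R ^+ 2)%:E *
     ((\int[mu]_x (`|u x| ^+ k * `|g1 x|)%:E) * \int[mu]_x (`|u x| ^+ k * `|g2 x|)%:E))%E.
Proof.
move=> [u2 [_ _ w1] [_ _ w2] [g12 g22] _].
have mu' := L2_measurable u2; have mg1 := L2_measurable g12; have mg2 := L2_measurable g22.
have sq f : L2 f -> measurable_fun (setT : set T) (fun x => (f x ^+ 2)%:E) /\
    (\int[mu]_x (f x ^+ 2)%:E < +oo)%E.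
  by move=> /L2P[mf If]; split => //; apply/measurable_EFinP/measurable_funX.
have sq0 (f : R * R -> R) (x : R * R) : (0 <= (f x ^+ 2)%:E)%E by rewrite lee_fin sqr_ge0.
have fin1 f : L2 f -> {ae mu, forall x, (\int[leb]_t (f (translate1 t x) ^+ 2)%:E < +oo)%E}.
  move=> f2; have [mf2 If2] := sq f f2.
  apply: ae2S (ae_lty_snd mf2 (sq0 f) If2) => x.
  rewrite -(integral_line_translate x.1)//.
  by apply: measurable_funX; apply: measurable_sect1; exact: L2_measurable.
have fin2 f : L2 f -> {ae mu, forall x, (\int[leb]_t (f (translate2 t x) ^+ 2)%:E < +oo)%E}.
  move=> f2; have [mf2 If2] := sq f f2.
  apply: ae2S (ae_lty_fst mf2 (sq0 f) If2) => x.
  rewrite -(integral_line_translate x.2)//.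
  by apply: measurable_funX; apply: measurable_sect2; exact: L2_measurable.
have S1 := weak_flow_sobolev translate1_flow u2 g12 w1 k (fin1 _ u2) (fin1 _ g12).
have S2 := weak_flow_sobolev translate2_flow u2 g22 w2 k (fin2 _ u2) (fin2 _ g22).
pose H1 (x : T) : \bar R := (`|u x| ^+ k * `|g1 x|)%:E.
pose H2 (x : T) : \bar R := (`|u x| ^+ k * `|g2 x|)%:E.
have mHr (g : T -> R) : measurable_fun setT g -> measurable_fun (setT : set T) (fun x => `|u x| ^+ k * `|g x|).
  move=> mg; apply: measurable_funM; last exact: measurableT_comp.
  by apply: measurable_funX; exact: measurableT_comp.
have mH1 : measurable_fun setT H1 by apply/measurable_EFinP; exact: (mHr _ mg1).
have mH2 : measurable_fun setT H2 by apply/measurable_EFinP; exact: (mHr _ mg2).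
have H10 x : (0 <= H1 x)%E by rewrite lee_fin mulr_ge0 ?exprn_ge0.
have H20 x : (0 <= H2 x)%E by rewrite lee_fin mulr_ge0 ?exprn_ge0.
pose F1 b := (\int[leb]_t H1 (t, b))%E; pose F2 a := (\int[leb]_t H2 (a, t))%E.
have F10 b : (0 <= F1 b)%E by exact: integral_ge0.
have F20 a : (0 <= F2 a)%E by exact: integral_ge0.
have mF1 : measurable_fun (setT : set R1) (F1 : R1 -> \bar R).
  exact: (@measurable_fun_fubini_tonelli_G _ _ R1 R1 R leb H1 mH1 H10).
have mF2 : measurable_fun (setT : set R1) (F2 : R1 -> \bar R).
  exact: (@measurable_fun_fubini_tonelli_F _ _ R1 R1 R leb H2 mH2 H20).
(* The horizontal line integral depends on x.2 alone and the vertical one on x.1 alone, so the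
   integral of the product is the product of the integrals. *)
pose P (x : T) := (F1 x.2 * F2 x.1)%E.
have mP : measurable_fun setT P.
  apply: emeasurable_funM; first exact: (measurableT_comp mF1 measurable_snd).
  exact: (measurableT_comp mF2 measurable_fst).
have P0 x : (0 <= P x)%E by exact: mule_ge0.
have K0 : 0 <= k.+1%:R ^+ 2 :> R by rewrite sqr_ge0.
apply: (@le_trans _ _ (\int[mu]_x ((k.+1%:R ^+ 2)%:E * P x))%E).
  apply: ae_ge0_le_integral.
  - exact: measurableT.
  - by move=> x _; rewrite lee_fin exprn_ge0.
  - by apply/measurable_EFinP/measurable_funX; exact: measurableT_comp.
  - by move=> x _; apply: mule_ge0 => //.
  - by apply: measurable_funeM.
  - apply: ae2S (ae2I S1 S2) => x [E1 E2] _.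
    have -> : ((`|u x| ^+ (2 * k.+1))%:E = (`|u x| ^+ k.+1)%:E * (`|u x| ^+ k.+1)%:E)%E.
      by rewrite -EFinM -exprD addnn mul2n.
    have -> : ((k.+1%:R ^+ 2)%:E * P x = (k.+1%:R%:E * F1 x.2) * (k.+1%:R%:E * F2 x.1))%E.
      by rewrite expr2 EFinM muleACA.
    apply: lee_pmul; rewrite ?lee_fin ?exprn_ge0//.
    + apply: le_trans E1 _; rewrite le_eqVlt; apply/orP; left; apply/eqP; congr (_ * _)%E.
      exact: (integral_line_translate x.1 (measurable_sect1 x.2 (mHr _ mg1))).
    + apply: le_trans E2 _; rewrite le_eqVlt; apply/orP; left; apply/eqP; congr (_ * _)%E.
      exact: (integral_line_translate x.2 (measurable_sect2 x.1 (mHr _ mg2))).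
rewrite ge0_integralZl//; apply: lee_wpmul2l => //.
have -> : (\int[mu]_x P x = \int[leb]_a \int[leb]_b P (a, b))%E.
  exact: (@fubini_tonelli1 _ _ R1 R1 R leb leb P mP P0).
have -> : (\int[leb]_a \int[leb]_b P (a, b) = \int[leb]_a ((\int[leb]_b F1 b) * F2 a))%E.
  apply: eq_integral => a _; rewrite /P /=.
  by rewrite ge0_integralZr.
rewrite ge0_integralZl//; last by exact: integral_ge0.
rewrite le_eqVlt; apply/orP; left; apply/eqP; congr (_ * _)%E.
  exact/esym/(@fubini_tonelli2 _ _ R1 R1 R leb leb H1 mH1 H10).
exact/esym/(@fubini_tonelli1 _ _ R1 R1 R leb leb H2 mH2 H20).
Qed.

End gagliardo.

Section moments.
Context {R : realType}.
Let R1 : measurableType _ := measurableTypeR R.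
Let T : measurableType _ := (R1 * R1)%type.
Local Notation mu := (leb2 R).
Implicit Types (u f g : R * R -> R).

Lemma L2M_Rintegrable f g : L2 f -> L2 g -> mu.-integrable setT (EFin \o (fun x => f x * g x)).
Proof. exact: L2M_integrable. Qed.

Lemma sqnorm_comb (a : R) f g : L2 f -> L2 g ->
  sqnorm (fun x => f x + a * g x) =
  sqnorm f + 2 * a * (\int[mu]_x (f x * g x)) + a ^+ 2 * sqnorm g.
Proof.
move=> f2 g2; have Iff := L2M_Rintegrable f2 f2; have Igg := L2M_Rintegrable g2 g2.
have Ifg := L2M_Rintegrable f2 g2.
have I1 := integrable_EFinZl (2 * a) Ifg; have I2 := integrable_EFinZl (a ^+ 2) Igg.
have I3 : mu.-integrable setT (EFin \o (fun x => f x * f x + 2 * a * (f x * g x))).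
  exact: (@integrableD _ _ _ mu setT measurableT _ _ Iff I1).
transitivity (\int[mu]_x (f x * f x + 2 * a * (f x * g x) + a ^+ 2 * (g x * g x))).
  by apply: eq_Rintegral => x _; ring.
rewrite (RintegralD measurableT I3 I2) (RintegralD measurableT Iff I1).
by rewrite (RintegralZl _ measurableT Ifg) (RintegralZl _ measurableT Igg).
Qed.

Lemma cauchy_schwarz f g : L2 f -> L2 g ->
  \int[mu]_x (f x * g x) <= Num.sqrt (sqnorm f) * Num.sqrt (sqnorm g).
Proof.
move=> f2 g2; set I := \int[mu]_x _; rewrite -sqrtrM ?sqnorm_ge0//.
have [I0|I0] := leP I 0; first by apply: le_trans I0 _; exact: sqrtr_ge0.
rewrite -(ger0_norm (ltW I0)) -sqrtr_sqr; apply: ler_wsqrtr.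
have H a : 0 <= sqnorm f + 2 * a * I + a ^+ 2 * sqnorm g.
  by rewrite -sqnorm_comb//; exact: sqnorm_ge0.
have := sqnorm_ge0 g; rewrite le_eqVlt => /predU1P[G0|G0].
  (* If g has norm 0, the polynomial in a is affine with slope 2 I; this a gives it the value -1, a
     contradiction. *)
  have := H (- (sqnorm f + 1) / (2 * I)); rewrite -G0 mulr0 addr0.
  have -> : 2 * (- (sqnorm f + 1) / (2 * I)) * I = - (sqnorm f + 1).
    by field; rewrite gt_eqF.
  lra.
(* The minimum of the quadratic polynomial in a. *)
have := H (- I / sqnorm g).
have -> : sqnorm f + 2 * (- I / sqnorm g) * I + (- I / sqnorm g) ^+ 2 * sqnorm g =
    (sqnorm f * sqnorm g - I ^+ 2) / sqnorm g by field; rewrite gt_eqF.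
by rewrite pmulr_lge0 ?invr_gt0// subr_ge0.
Qed.

Lemma L2_norm f : L2 f -> L2 (fun x => `|f x|).
Proof.
move=> f2; apply: (L2_le _ f2); last by move=> x; rewrite normr_id.
by apply: measurableT_comp => //; exact: L2_measurable.
Qed.

Lemma sqnorm_norm f : sqnorm (fun x => `|f x|) = sqnorm f.
Proof. by apply: eq_Rintegral => x _; rewrite real_normK// num_real. Qed.

(** Cauchy-Schwarz in both factors of [gagliardo_prod]. It raises the square integrable power by
    one, and applies to solutions and to increments alike. *)
Lemma L2_power_step u g1 g2 k : has_H_gradient u g1 g2 -> L2 (fun x => `|u x| ^+ k) ->
  L2 (fun x => `|u x| ^+ k.+1) /\
  sqnorm (fun x => `|u x| ^+ k.+1) <= k.+1%:R ^+ 2 *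
    (sqnorm (fun x => `|u x| ^+ k) * (Num.sqrt (sqnorm g1) * Num.sqrt (sqnorm g2))).
Proof.
move=> uH uk2; have [u2 _ _ [g12 g22] _] := uH.
have m : measurable_fun (setT : set T) ((fun x => `|u x| ^+ k.+1) : T -> R).
  by apply: measurable_funX; apply: measurableT_comp => //; exact: L2_measurable.
have E g : L2 g -> (\int[mu]_x (`|u x| ^+ k * `|g x|)%:E)%E = (\int[mu]_x (`|u x| ^+ k * `|g x|))%:E.
  by move=> g2'; rewrite (L2M_EFin uk2 (L2_norm g2')).
have := gagliardo_prod k uH; rewrite !E// -!EFinM => G.
have EP x : (`|u x| ^+ (2 * k.+1))%:E = ((`|u x| ^+ k.+1) ^+ 2)%:E.
  by rewrite -exprM mulnC.
have G' : (\int[mu]_x ((`|u x| ^+ k.+1) ^+ 2)%:E < +oo)%E.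
  by apply: le_lt_trans (ltry _); apply: le_trans G; under eq_integral do rewrite -EP.
have L : L2 (fun x => `|u x| ^+ k.+1) by apply/L2P.
split => //; rewrite -lee_fin -sqnormE//.
under eq_integral do rewrite -EP.
apply: le_trans G _; rewrite lee_fin ler_wpM2l ?sqr_ge0//.
have S0 := sqnorm_ge0 (fun x => `|u x| ^+ k).
rewrite -[X in _ <= X * _](sqr_sqrtr S0) expr2 mulrACA.
have C g : L2 g -> \int[mu]_x (`|u x| ^+ k * `|g x|) <=
    Num.sqrt (sqnorm (fun x => `|u x| ^+ k)) * Num.sqrt (sqnorm g).
  by move=> g2'; rewrite -(sqnorm_norm g); exact: (cauchy_schwarz uk2 (L2_norm g2')).
by apply: ler_pM; rewrite ?C//; apply: Rintegral_ge0 => x _; rewrite mulr_ge0 ?exprn_ge0.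
Qed.

(** The step from |u|^(k+1) to |u|^(k+2) costs a factor (k+2)^2 B, whence the squared factorial. *)
Lemma moment_bound u g1 g2 (B : R) k : has_H_gradient u g1 g2 ->
  sqnorm u <= B -> sqnorm g1 <= B -> sqnorm g2 <= B ->
  L2 (fun x => `|u x| ^+ k.+1) /\ sqnorm (fun x => `|u x| ^+ k.+1) <= k.+1`!%:R ^+ 2 * B ^+ k.+1.
Proof.
move=> uH uB g1B g2B; have [u2 _ _ _ _] := uH.
have B0 : 0 <= B by apply: le_trans uB; exact: sqnorm_ge0.
elim: k => [|k [IL IB]].
  rewrite !expr1n mul1r; split; first exact: L2_norm.
  by apply: le_trans uB; rewrite le_eqVlt -(sqnorm_norm u) eqxx.
have [L S] := L2_power_step uH IL; split => //.
apply: le_trans S _.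
have -> : k.+2`!%:R ^+ 2 * B ^+ k.+2 = k.+2%:R ^+ 2 * (k.+1`!%:R ^+ 2 * B ^+ k.+1 * B).
  by rewrite factS natrM exprMn [B ^+ k.+2]exprSr !mulrA.
rewrite ler_wpM2l ?sqr_ge0//; apply: ler_pM => //; first exact: sqnorm_ge0.
rewrite -[leRHS](sqr_sqrtr B0) expr2.
by apply: ler_pM; rewrite ?sqrtr_ge0//; exact: ler_wsqrtr.
Qed.

End moments.

(** * Increments of weak solutions under rotations *)

Section inner_product.
Context {R : realType}.
Let R1 : measurableType _ := measurableTypeR R.
Let T : measurableType _ := (R1 * R1)%type.
Local Notation mu := (leb2 R).
Implicit Types (u v w f g : R * R -> R) (lam p : R).

(** The integrand of [innerH] with the gradients as arguments, so that the explicit gradients of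
    rotated functions and of differences can be inserted. *)
Definition inner_density lam u g1 g2 v h1 h2 (x : R * R) : R :=
  g1 x * h1 x + g2 x * h2 x
  + (lam ^+ 2)^-1 * ((x.1 * g2 x - x.2 * g1 x) * (x.1 * h2 x - x.2 * h1 x)) + u x * v x.

Lemma inner_density_integrable lam u g1 g2 v h1 h2 :
  has_H_gradient u g1 g2 -> has_H_gradient v h1 h2 ->
  mu.-integrable setT (EFin \o inner_density lam u g1 g2 v h1 h2).
Proof.
move=> [u2 _ _ [g12 g22] gt] [v2 _ _ [h12 h22] ht].
have D (f g : R * R -> R) : mu.-integrable setT (EFin \o f) -> mu.-integrable setT (EFin \o g) ->
    mu.-integrable setT (EFin \o (fun x => f x + g x)).
  by move=> If Ig; exact: (@integrableD _ _ _ mu setT measurableT _ _ If Ig).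
apply: (D _ _); last exact: L2M_Rintegrable.
apply: (D _ _); last by apply: integrable_EFinZl; exact: L2M_Rintegrable gt ht.
by apply: (D _ _); exact: L2M_Rintegrable.
Qed.

Lemma innerHE lam u g1 g2 v h1 h2 : has_H_gradient u g1 g2 -> has_H_gradient v h1 h2 ->
  innerH lam u v = \int[mu]_x inner_density lam u g1 g2 v h1 h2 x.
Proof.
move=> uH vH; have [uS aeu] := has_H_gradient_spaceH uH; have [vS aev] := has_H_gradient_spaceH vH.
have I1 := inner_density_integrable lam (spaceH_gradient uS) (spaceH_gradient vS).
have I2 := inner_density_integrable lam uH vH.
rewrite /innerH /Rintegral; congr fine; apply: ae_eq_integral => //.
- exact: (measurable_int mu I1).
- exact: (measurable_int mu I2).
- apply: ae2S (ae2I aeu aev) => x [[E1 E2] [F1 F2]] _.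
  by rewrite /inner_density /grad_dot /dtheta E1 E2 F1 F2.
Qed.

Lemma innerHBl lam u v w g1 g2 h1 h2 k1 k2 :
  has_H_gradient u g1 g2 -> has_H_gradient v h1 h2 -> has_H_gradient w k1 k2 ->
  innerH lam (fun x => u x - v x) w = innerH lam u w - innerH lam v w.
Proof.
move=> uH vH wH; rewrite (innerHE lam (has_H_gradientB uH vH) wH) (innerHE lam uH wH) (innerHE lam vH wH).
have I1 := inner_density_integrable lam uH wH; have I2 := inner_density_integrable lam vH wH.
rewrite -(RintegralB measurableT I1 I2); apply: eq_Rintegral => x _; rewrite /inner_density; ring.
Qed.

Lemma innerH_sqnorm lam u g1 g2 : has_H_gradient u g1 g2 ->
  innerH lam u u = sqnorm g1 + sqnorm g2
    + (lam ^+ 2)^-1 * sqnorm (fun x => x.1 * g2 x - x.2 * g1 x) + sqnorm u.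
Proof.
move=> uH; have [u2 _ _ [g12 g22] gt] := uH; rewrite (innerHE lam uH uH) /inner_density.
have D (f g : R * R -> R) : mu.-integrable setT (EFin \o f) -> mu.-integrable setT (EFin \o g) ->
    mu.-integrable setT (EFin \o (fun x => f x + g x)).
  by move=> If Ig; exact: (@integrableD _ _ _ mu setT measurableT _ _ If Ig).
have I1 := L2M_Rintegrable g12 g12; have I2 := L2M_Rintegrable g22 g22.
have I3 := L2M_Rintegrable gt gt; have I4 := L2M_Rintegrable u2 u2.
have I3' := integrable_EFinZl (lam ^+ 2)^-1 I3.
rewrite (RintegralD measurableT (D _ _ (D _ _ I1 I2) I3') I4).
rewrite (RintegralD measurableT (D _ _ I1 I2) I3') (RintegralD measurableT I1 I2).
by rewrite (RintegralZl _ measurableT I3).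
Qed.

Lemma innerH_rotate lam u v g1 g2 h1 h2 c s : c ^+ 2 + s ^+ 2 = 1 ->
  has_H_gradient u g1 g2 -> has_H_gradient v h1 h2 ->
  innerH lam (u \o rotate c s) (v \o rotate c s) = innerH lam u v.
Proof.
move=> cs uH vH; have uR := has_H_gradient_rotate cs uH; have vR := has_H_gradient_rotate cs vH.
rewrite (innerHE lam uR vR) (innerHE lam uH vH).
have I := inner_density_integrable lam uH vH.
have mI : measurable_fun (setT : set T) (inner_density lam u g1 g2 v h1 h2 : T -> R).
  by apply/measurable_EFinP; exact: (measurable_int mu I).
rewrite -(Rintegral_measure_preserving (measure_preserving_rotate cs) mI).
apply: eq_Rintegral => x _; rewrite /inner_density /=.
set y := rotate c s x.
have -> : g1 y * h1 y + g2 y * h2 y = (c ^+ 2 + s ^+ 2) * (g1 y * h1 y + g2 y * h2 y).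
  by rewrite cs mul1r.
ring.
Qed.

(** Test the equation for u with v \o rotate c (- s) and rotate both integrals. *)
Lemma weak_solution_rotate p lam u c s : c ^+ 2 + s ^+ 2 = 1 ->
  measurable_fun (setT : set T) ((fun x => `|u x| `^ (p - 2) * u x) : T -> R) ->
  weak_solution p lam u -> weak_solution p lam (u \o rotate c s).
Proof.
move=> cs mf [uS Hu]; have uH := spaceH_gradient uS.
have [uRS _] := has_H_gradient_spaceH (has_H_gradient_rotate cs uH).
split => // v vS; have vH := spaceH_gradient vS.
have cs' : c ^+ 2 + (- s) ^+ 2 = 1 by rewrite sqrrN.
have vH' := has_H_gradient_rotate cs' vH.
have [vS' _] := has_H_gradient_spaceH vH'.
have vK : (v \o rotate c (- s)) \o rotate c s = v.
  by apply/funext => x /=; rewrite (rotateK cs).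
rewrite -{1}vK (innerH_rotate lam cs uH vH') (Hu _ vS').
have [v2' _ _ _ _] := vH'; have mv := measurable_funM mf (L2_measurable v2').
rewrite -(Rintegral_measure_preserving (measure_preserving_rotate cs) mv).
by apply: eq_Rintegral => x _ /=; rewrite (rotateK cs).
Qed.

End inner_product.

(** * The nonlinearity |t|^(p-2) t *)

Section nonlinearity.
Context {R : realType}.
Let R1 : measurableType _ := measurableTypeR R.
Let T : measurableType _ := (R1 * R1)%type.
Local Notation mu := (leb2 R).
Variable p : R.
Hypothesis p2 : 2 < p.
Implicit Types (a b : R) (u : R * R -> R).

Definition nonlin a : R := `|a| `^ (p - 2) * a.

Let q0 : 0 < p - 2. Proof. by rewrite subr_gt0. Qed.

Lemma powR_mul_self a : 0 <= a -> a `^ (p - 2) * a = a `^ (p - 1).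
Proof.
rewrite le_eqVlt => /predU1P[<-|a0].
  by rewrite mulr0 powR0// gt_eqF//; move: p2; lra.
have -> : p - 1 = (p - 2) + 1 by ring.
by rewrite (@powRD _ a (p - 2) 1) ?powRr1 ?(ltW a0)// (gt_eqF a0) implybT.
Qed.

(** The convex function t^(p-1) lies above its tangent at a. This is Young's inequality for b and
    a^(p-2) with exponents p - 1 and (p - 1) / (p - 2). *)
Lemma powR_tangent a b : 0 <= a -> 0 <= b ->
  a `^ (p - 1) - b `^ (p - 1) <= (p - 1) * a `^ (p - 2) * (a - b).
Proof.
move=> a0 b0; have r0 : 0 < p - 1 by move: p2; lra.
have rq : (p - 1)^-1 + ((p - 1) / (p - 2))^-1 = 1.
  by rewrite invf_div; field; rewrite !gt_eqF.
have := conjugate_powR b0 (powR_ge0 a (p - 2)) r0 (divr_gt0 r0 q0) rq.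
rewrite -powRrM mulrCA divff ?gt_eqF// mulr1 -(powR_mul_self a0) => Y.
have {Y} : (p - 1) * (b * a `^ (p - 2)) <= b `^ (p - 1) + (p - 2) * (a `^ (p - 2) * a).
  have -> : b `^ (p - 1) + (p - 2) * (a `^ (p - 2) * a) =
     (p - 1) * (b `^ (p - 1) / (p - 1) + a `^ (p - 2) * a / ((p - 1) / (p - 2))).
    by field; rewrite !gt_eqF.
  by rewrite ler_pM2l.
move: (a `^ _) (b `^ _) => A B; lra.
Qed.

Lemma nonlinN a : nonlin (- a) = - nonlin a.
Proof. by rewrite /nonlin normrN mulrN. Qed.

Lemma nonlin_ge0 a : 0 <= a -> nonlin a = a `^ (p - 1).
Proof. by move=> a0; rewrite /nonlin ger0_norm// powR_mul_self. Qed.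

(** The constant is the maximum of the derivative on [-M, M], exactly the one in the hypothesis of
    (i). For equal signs the bound is [powR_tangent] at the point of larger modulus. *)
Lemma nonlin_lipschitz (M a b : R) : `|a| <= M -> `|b| <= M ->
  `|nonlin a - nonlin b| <= (p - 1) * M `^ (p - 2) * `|a - b|.
Proof.
have mono x y : 0 <= x -> x <= y -> x `^ (p - 2) <= y `^ (p - 2).
  by move=> x0 xy; apply: ge0_ler_powR; rewrite ?nnegrE ?(ltW q0)//; exact: le_trans xy.
have p1 : 1 <= p - 1 by move: p2; lra.
have same x y : 0 <= y -> y <= x -> x <= M ->
    `|nonlin x - nonlin y| <= (p - 1) * M `^ (p - 2) * `|x - y|.
  move=> y0 yx xM; have x0 := le_trans y0 yx.
  rewrite !nonlin_ge0// (@ger0_norm _ (x - y)) ?subr_ge0// ger0_norm; last first.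
    by rewrite subr_ge0; apply: ge0_ler_powR; rewrite ?nnegrE//; apply: le_trans p1.
  apply: le_trans (powR_tangent x0 y0) _; rewrite ler_wpM2r ?subr_ge0// ler_wpM2l ?mono//.
  exact: le_trans p1.
have nonneg x y : 0 <= x -> 0 <= y -> x <= M -> y <= M ->
    `|nonlin x - nonlin y| <= (p - 1) * M `^ (p - 2) * `|x - y|.
  move=> x0 y0 xM yM; have [yx|/ltW xy] := leP y x; first exact: same.
  by rewrite distrC (distrC x); exact: same.
(* Opposite signs: |nonlin x + nonlin y| is at most M^(p-2) (x + y), and 1 <= p - 1 leaves room. *)
have opp x y : 0 <= x -> 0 <= y -> x <= M -> y <= M ->
    `|nonlin x + nonlin y| <= (p - 1) * M `^ (p - 2) * `|x + y|.
  move=> x0 y0 xM yM; have Mq := powR_ge0 M (p - 2).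
  rewrite (ger0_norm (addr_ge0 x0 y0)) /nonlin !ger0_norm//; last first.
    by rewrite addr_ge0// mulr_ge0// powR_ge0.
  apply: (@le_trans _ _ (M `^ (p - 2) * (x + y))); last first.
    by rewrite ler_wpM2r ?addr_ge0// ler_peMl.
  by rewrite mulrDr; apply: lerD; rewrite ler_wpM2r// mono.
move=> aM bM; have aM' := le_trans (ler_norm a) aM; have bM' := le_trans (ler_norm b) bM.
have naM : - a <= M by apply: le_trans (ler_norm _) _; rewrite normrN.
have nbM : - b <= M by apply: le_trans (ler_norm _) _; rewrite normrN.
have [a0|/ltW a0] := leP 0 a; have [b0|/ltW b0] := leP 0 b.
- exact: nonneg.
- by have := opp a (- b) a0; rewrite nonlinN oppr_ge0; apply.
- by rewrite distrC (distrC a); have := opp b (- a) b0; rewrite nonlinN oppr_ge0; apply.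
- have := nonneg (- a) (- b); rewrite !nonlinN !oppr_ge0 -!opprD !normrN; exact.
Qed.

(** Moments are bounded for natural powers, so the real exponent p - 2 is traded for a natural one;
    the summand 1 covers a <= 1. *)
Lemma powR_le_expr (m : nat) a : p - 2 <= m%:R -> 0 <= a -> a `^ (p - 2) <= 1 + a ^+ m.
Proof.
move=> pm a0; have am : 0 <= a ^+ m by rewrite exprn_ge0.
have [a1|/ltW a1] := leP a 1.
  apply: (@le_trans _ _ (1 `^ (p - 2))); last by rewrite powR1 lerDl.
  by apply: ge0_ler_powR; rewrite ?nnegrE// ltW.
apply: (@le_trans _ _ (a ^+ m)); last by rewrite lerDr.
by rewrite -powR_mulrn//; exact: ler_powR.
Qed.

Lemma nonlin_growth (m : nat) a b : p - 2 <= m%:R ->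
  (nonlin a - nonlin b) * (a - b) <= (p - 1) * (1 + `|a| ^+ m + `|b| ^+ m) * (a - b) ^+ 2.
Proof.
move=> pm; pose M := Num.max `|a| `|b|.
have aM : `|a| <= M by rewrite le_max lexx.
have bM : `|b| <= M by rewrite le_max lexx orbT.
have M0 : 0 <= M by apply: le_trans aM.
apply: le_trans (ler_norm _) _; rewrite normrM -(real_normK (num_real (a - b))) expr2 mulrA.
rewrite ler_wpM2r//; apply: le_trans (nonlin_lipschitz aM bM) _.
rewrite ler_wpM2r// ler_wpM2l//; first by move: p2; lra.
apply: le_trans (powR_le_expr pm M0) _; rewrite -addrA lerD2l /M.
by case: (leP `|a| `|b|) => _; [rewrite lerDr|rewrite lerDl]; exact: exprn_ge0.
Qed.

Lemma measurable_nonlin u : measurable_fun (setT : set T) (u : T -> R) ->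
  measurable_fun (setT : set T) ((fun x => nonlin (u x)) : T -> R).
Proof.
move=> mu'; apply: measurable_funM => //.
apply: (measurableT_comp (measurable_powR (p - 2))).
exact: measurableT_comp.
Qed.

Lemma L2_nonlin (m : nat) u : p - 2 <= m%:R -> L2 u -> L2 (fun x => `|u x| ^+ m.+1) ->
  L2 (fun x => nonlin (u x)).
Proof.
move=> pm u2 um2; have G2 := L2D (L2_norm u2) um2.
apply: (L2_le (measurable_nonlin (L2_measurable u2)) G2) => x.
rewrite /nonlin normrM (ger0_norm (powR_ge0 _ _)) exprSr.
have -> : `|u x| + `|u x| ^+ m * `|u x| = (1 + `|u x| ^+ m) * `|u x| by ring.
rewrite normrM normr_id ler_wpM2r// (le_trans (powR_le_expr pm (normr_ge0 _)))//.
exact: ler_norm.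
Qed.

Lemma nonlin_mul a : nonlin a * a = `|a| `^ p.
Proof.
rewrite /nonlin -mulrA -expr2 -(real_normK (num_real a)) expr2 mulrA powR_mul_self//.
have [->|a0] := eqVneq `|a| 0.
  by rewrite mulr0 powR0// gt_eqF//; move: p2; lra.
have {2}-> : p = (p - 1) + 1 by ring.
by rewrite (@powRD _ _ (p - 1) 1) ?powRr1// a0 implybT.
Qed.

End nonlinearity.

(** * From rotation invariance to radial symmetry *)

Section radial.
Context {R : realType}.
Let R1 : measurableType _ := measurableTypeR R.
Let T : measurableType _ := (R1 * R1)%type.
Local Notation leb := (@lebesgue_measure R).
Local Notation mus := (@plane_measure R).
Local Notation mu := (leb2 R).
Implicit Types (u : R * R -> R) (x : R * R).

Lemma polar_coordinates x : exists t, x = rotation t (enorm x, 0).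
Proof.
case: x => a b; set r := enorm (a, b).
have r0 : 0 <= r by exact: sqrtr_ge0.
have r2 : r ^+ 2 = a ^+ 2 + b ^+ 2 by rewrite sqr_sqrtr// addr_ge0// sqr_ge0.
have [r00|rN0] := eqVneq r 0.
  move: r2; rewrite r00 expr0n => /esym/eqP; rewrite paddr_eq0 ?sqr_ge0// !sqrf_eq0.
  by move=> /andP[/eqP -> /eqP ->]; exists 0; rewrite rotation0.
have rp : 0 < r by rewrite lt_neqAle eq_sym rN0.
have ar : -1 <= a / r <= 1.
  rewrite -ler_norml normrM normfV (ger0_norm r0) ler_pdivrMr// mul1r.
  by rewrite -(ger0_norm r0) -!sqrtr_sqr ler_wsqrtr// r2 lerDl sqr_ge0.
have sinE : sin (acos (a / r)) = `|b| / r.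
  rewrite sin_acos//; have -> : 1 - (a / r) ^+ 2 = (b / r) ^+ 2.
    by rewrite !expr_div_n r2; field; rewrite -r2 sqrf_eq0.
  by rewrite sqrtr_sqr normrM normfV (ger0_norm r0).
have [b0|b0] := leP 0 b.
  exists (acos (a / r)); rewrite /rotation /rotate /= acosK// sinE (ger0_norm b0).
  by rewrite !mulr0 subr0 addr0 !divfK.
exists (- acos (a / r)); rewrite /rotation /rotate /= cosN sinN acosK// sinE (ltr0_norm b0).
by rewrite !mulr0 subr0 addr0 [- b / r]mulNr opprK !divfK.
Qed.

Lemma not_ae_False : ~ {ae leb, forall t : R, False}.
Proof.
move=> [N [mN N0 H]]; have NT : N = setT by apply/seteqP; split => // t _; exact: H.
have : (leb `[0%R, 1%R]%classic <= leb N)%E.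
  by apply: le_measure; rewrite ?inE ?NT//; exact: measurable_itv.
have -> := lebesgue_measure_itv `[0%R, 1%R].
by rewrite /= lte_fin ltr01 sube0 [leb N]N0 lee_fin ler10.
Qed.

(** For each angle, invariance holds off a null set of points; [ae_swap] turns this into: for almost
    every x, u takes the value u x at almost every angle on the circle through x. That common value
    defines the radial profile. *)
Lemma radial_rotation_invariant u : measurable_fun (setT : set T) (u : T -> R) ->
  (forall t, {ae mu, forall x, u (rotation t x) = u x}) -> radial u.
Proof.
move=> mu' inv.
have mflow := flow_measurable (@rotation_flow R).
pose D (p : T * R1) : R := u (rotation p.2 p.1) - u p.1.
have mD : measurable_fun (setT : set (T * R1)) D.
  by apply: measurable_funB; [exact: (measurableT_comp mu' mflow)|exact: (measurableT_comp mu' measurable_fst)].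
pose E : set (T * R1) := D @^-1` [set 0].
have mE : measurable E.
  by rewrite -[X in measurable X]setTI; apply: mD => //; exact: measurable_set1.
have H : {ae mus, forall x, {ae leb, forall t, E (x, t)}}.
  apply: (ae_swap mE); apply: aeW => t; apply: ae2S (inv t) => x Ex.
  by rewrite /E /D /= Ex subrr.
(* The candidate values on the circle of radius r. There is at most one, because two full sets of
   angles intersect; circles without any value get 0, and they only meet a null set of points. *)
pose C r : set R := [set c | {ae leb, forall t, u (rotation t (r, 0)) = c}].
exists (fun r => xget 0 (C r)).
apply: ae2S H => x aex.
have [s xs] := polar_coordinates x.
(* The angle is shifted by s to start from (enorm x, 0) instead of x. *)
have Cx : C (enorm x) (u x).
  have := ae_measure_preserving (measure_preserving_addr (- s)) aex.
  apply: ae1S => t /eqP; rewrite /D /= subr_eq0 => /eqP <-.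
  by rewrite {2}xs -rotationD subrK.
case: xgetP => [c _ Cc|/(_ _ Cx)//].
apply: contrapT => cu; apply: not_ae_False.
by apply: ae1S (ae1I Cx Cc) => t [E1 E2]; apply: cu; rewrite -E1 -E2.
Qed.

Lemma rotation_invariant_iter u h k : {ae mu, forall x, u (rotation h x) = u x} ->
  {ae mu, forall x, u (rotation (k%:R * h) x) = u x}.
Proof.
move=> Hh; elim: k => [|k IH].
  by apply: aeW => x; rewrite mul0r rotation0.
have IH' := ae_measure_preserving (measure_preserving_rotation h) IH.
apply: ae2S (ae2I Hh IH') => x [E1 E2].
by rewrite -natr1 mulrDl mul1r rotationD E2.
Qed.

(** With h = 2 pi / N, write t = k h + r with 0 <= r <= h. The k full steps change nothing, and the
    remaining rotation by r moves u by at most h times the norm of its angular derivative, which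
    tends to 0 as N grows. *)
Lemma rotation_invariant_frac u g1 g2 (N0 : nat) : has_H_gradient u g1 g2 ->
  (forall N, (N0 < N)%N -> {ae mu, forall x, u (rotation (2 * pi / N%:R) x) = u x}) ->
  forall t, {ae mu, forall x, u (rotation t x) = u x}.
Proof.
move=> uH inv; have [u2 _ _ _ _] := uH.
suff pos t : 0 <= t -> {ae mu, forall x, u (rotation t x) = u x}.
  move=> t; have [|t0] := leP 0 t; first exact: pos.
  have /pos Nt : 0 <= - t by rewrite oppr_ge0 ltW.
  have := ae_measure_preserving (measure_preserving_rotation t) Nt.
  by apply: ae2S => x; rewrite -rotationD addNr rotation0.
move=> t0; pose S := sqnorm (fun x => x.1 * g2 x - x.2 * g1 x).
pose d x := u (rotation t x) - u x.
have d2 : L2 d by apply: L2B => //; exact: L2_rotation.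
have bound N : (N0 < N)%N -> sqnorm d <= (2 * pi / N%:R) ^+ 2 * S.
  move=> N0N; set h := 2 * pi / N%:R.
  have Np : 0 < N%:R :> R by rewrite ltr0n (leq_ltn_trans _ N0N).
  have h0 : 0 < h by rewrite /h !mulr_gt0 ?invr_gt0 ?pi_gt0.
  pose k := Num.truncn (t / h); pose r := t - k%:R * h.
  have /truncn_itv/andP[k1 k2] : 0 <= t / h by rewrite divr_ge0// ltW.
  have r0 : 0 <= r by rewrite subr_ge0 -ler_pdivlMr.
  have rh : r <= h.
    by rewrite lerBlDl -[X in _ + X]mul1r -mulrDl natr1 -ler_pdivrMr// ltW.
  have Hk := rotation_invariant_iter k (inv N N0N).
  have Hk' := ae_measure_preserving (measure_preserving_rotation r) Hk.
  have -> : sqnorm d = sqnorm (fun x => u (rotation r x) - u x).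
    have L : L2 (fun x => u (rotation r x) - u x) by apply: L2B => //; exact: L2_rotation.
    rewrite /sqnorm /Rintegral; congr fine; apply: ae_eq_integral => //.
    - by apply/measurable_EFinP/measurable_funX; exact: L2_measurable.
    - by apply/measurable_EFinP/measurable_funX; exact: L2_measurable.
    - apply: ae2S Hk' => x Ex _; rewrite /d -Ex -rotationD.
      by have -> : k%:R * h + r = t by rewrite /r addrC subrK.
  apply: le_trans (rotation_increment_sqnorm uH r0) _.
  by rewrite ler_wpM2r ?sqnorm_ge0// lerXn2r// ?nnegrE// ltW.
have d0 : sqnorm d = 0.
  apply/eqP; rewrite eq_le sqnorm_ge0 andbT; apply/ler_addgt0Pr => e e0; rewrite add0r.
  pose K := (2 * pi) ^+ 2 * S.
  have K0 : 0 <= K by rewrite mulr_ge0 ?sqr_ge0 ?sqnorm_ge0.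
  (* The bound at N is K / N^2, and N >= K / e together with N >= 1 brings it below e. *)
  pose N := (maxn N0 (Num.truncn (K / e))).+1.
  have N1 : (N0 < N)%N by rewrite ltnS leq_maxl.
  apply: le_trans (bound N N1) _.
  have Np : 0 < N%:R :> R by rewrite ltr0n.
  have N1' : 1 <= N%:R :> R by rewrite ler1n.
  have KN : K / e <= N%:R.
    have /truncn_itv/andP[_ /ltW] : 0 <= K / e by rewrite divr_ge0// ltW.
    by move=> /le_trans; apply; rewrite ler_nat ltnS leq_maxr.
  rewrite expr_div_n mulrAC -/K ler_pdivrMr ?exprn_gt0//.
  apply: (@le_trans _ _ (e * N%:R)); first by rewrite mulrC -ler_pdivrMr.
  by rewrite ler_pM2l// expr2 ler_peMr// ltW.
by apply: ae2S (sqnorm_eq0 d2 d0) => x /eqP; rewrite subr_eq0 => /eqP.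
Qed.

End radial.

Section rotation_angles.
Context {R : realType}.
Let R1 : measurableType _ := measurableTypeR R.
Let T : measurableType _ := (R1 * R1)%type.
Local Notation mu := (leb2 R).
Implicit Types (u w : R * R -> R) (lam : R).

Lemma Linfty_norm_ae u : {ae mu, forall x, ((`|u x|)%:E <= Linfty_norm u)%E}.
Proof.
rewrite /Linfty_norm unlock; case: ifPn => [_|]; first exact: (@ess_sup_ge _ _ _ mu (abse \o (EFin \o u))).
rewrite -leNgt => mu0; exists setT; split => //.
by apply/eqP; rewrite eq_le mu0 measure_ge0.
Qed.

Lemma sin_lower_bound (r : R) : r < 1 ->
  exists2 d, 0 < d & forall x, 0 < x -> x < d -> r * x <= sin x.
Proof.
move=> r1; have H := is_derive_sin (0 : R); rewrite cos0 in H.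
have /cvgrPdist_le /(_ (1 - r)) : h^-1 *: ((sin \o shift 0) (h *: 1) - sin 0) @[h --> (0 : R)^'] --> (1 : R).
  have [D E] := H; suff K : h^-1 *: ((sin \o shift 0) (h *: 1) - sin 0) @[h --> (0 : R)^'] --> 'D_1 (@sin R) 0.
    by move: K; rewrite E.
  exact: D.
rewrite subr_gt0 => /(_ r1).
move=> /nbhs_ballP[d /= d0 Hd]; exists d => // x x0 xd.
have := Hd x; rewrite /ball /= sub0r normrN gtr0_norm// => /(_ xd).
rewrite gt_eqF//= sin0 addr0 subr0 => /(_ isT).
rewrite ler_norml => /andP[_]; rewrite -![_ *: _]/(_ * _) mulr1 lerBlDr -lerBlDl opprB addrC subrK.
by rewrite mulrC ler_pdivlMr.
Qed.

(** 2 - 2 cos h = (2 sin (h / 2))^2 is the squared chord, compared with the squared arc h^2. The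
    square root of r enters because the bound on the sine gets squared. *)
Lemma chord_lower_bound (r : R) : 0 <= r -> r < 1 -> exists N0 : nat, forall N, (N0 < N)%N ->
  let h := 2 * pi / N%:R in r * h ^+ 2 <= 2 - 2 * cos h.
Proof.
move=> r0 r1; have sr1 : Num.sqrt r < 1 by rewrite -sqrtr1 ltr_sqrt.
have [d d0 Hd] := sin_lower_bound sr1.
exists (Num.truncn (pi / d)) => N N1 /=; set h := 2 * pi / N%:R.
have Np : 0 < N%:R :> R by rewrite ltr0n (leq_ltn_trans _ N1).
have hE : h = pi / N%:R *+ 2 by rewrite /h -[RHS]mulr_natl mulrA.
have p0 := pi_gt0 R.
have x0 : 0 < pi / N%:R :> R by rewrite divr_gt0.
have xd : pi / N%:R < d.
  have /truncn_itv/andP[_ H] : 0 <= pi / d by rewrite divr_ge0// ltW.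
  have : pi / d < N%:R by apply: lt_le_trans H _; rewrite ler_nat.
  by rewrite !ltr_pdivrMr// mulrC.
have := Hd _ x0 xd; rewrite hE cos_mulr2n; set x := pi / N%:R => sx.
have -> : 2 - 2 * (cos x ^+ 2 *+ 2 - 1) = 4 * sin x ^+ 2.
  by rewrite sin2cos2; ring.
have -> : r * (x *+ 2) ^+ 2 = 4 * (Num.sqrt r * x) ^+ 2.
  by rewrite exprMn sqr_sqrtr//; ring.
have A0 : 0 <= Num.sqrt r * x by rewrite mulr_ge0 ?sqrtr_ge0 ?ltW.
have S0 := le_trans A0 sx.
by rewrite ler_pM2l//; exact: lerXn2r.
Qed.

End rotation_angles.

(** * The equation for the increment, and radiality under a sup bound *)

Section rotation_increment.
Context {R : realType}.
Let R1 : measurableType _ := measurableTypeR R.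
Let T : measurableType _ := (R1 * R1)%type.
Local Notation mu := (leb2 R).
Implicit Types (u w F G : R * R -> R) (lam p h : R).

Lemma ae_le_Rintegral F G : mu.-integrable setT (EFin \o F) -> mu.-integrable setT (EFin \o G) ->
  {ae mu, forall x, F x <= G x} -> \int[mu]_x F x <= \int[mu]_x G x.
Proof.
move=> IF IG FG; rewrite -subr_ge0 -(RintegralB measurableT IG IF).
have mB : measurable_fun (setT : set T) ((fun x => G x - F x) : T -> R).
  by apply: measurable_funB; apply/measurable_EFinP; [exact: (measurable_int mu IG)|exact: (measurable_int mu IF)].
have -> : \int[mu]_x (G x - F x) = \int[mu]_x `|G x - F x|.
  rewrite /Rintegral; congr fine; apply: ae_eq_integral => //.
  - exact/measurable_EFinP.
  - by apply/measurable_EFinP; exact: measurableT_comp.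
  - by apply: ae2S FG => x FGx _; rewrite ger0_norm// subr_ge0.
exact: Rintegral_ge0.
Qed.

Definition rotation_increment u h : R * R -> R := fun x => u (rotation h x) - u x.

(** Used through its successor, a natural number above p - 2; the moment bounds are stated for
    successor exponents. *)
Definition growth_exponent p : nat := Num.truncn (p - 2).

Lemma growth_exponentP p : 2 < p -> p - 2 <= (growth_exponent p).+1%:R.
Proof.
by move=> p2; have /truncn_itv/andP[_ /ltW] : 0 <= p - 2 by rewrite subr_ge0 ltW.
Qed.

Lemma L2_norm_power u g1 g2 k : has_H_gradient u g1 g2 -> L2 (fun x => `|u x| ^+ k.+1).
Proof.
move=> uH; pose B := sqnorm u + (sqnorm g1 + sqnorm g2).
have [] // := moment_bound (B := B) k uH.
- by rewrite lerDl addr_ge0// sqnorm_ge0.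
- by rewrite /B addrCA lerDl addr_ge0// sqnorm_ge0.
- by rewrite /B addrA lerDr addr_ge0// sqnorm_ge0.
Qed.

Lemma has_H_gradient_nonlin p u g1 g2 : 2 < p -> has_H_gradient u g1 g2 ->
  L2 (fun x => nonlin p (u x)).
Proof.
move=> p2 uH; have [u2 _ _ _ _] := uH.
exact: (L2_nonlin p2 (growth_exponentP p2) u2 (L2_norm_power _ uH)).
Qed.

Lemma spaceH_rotation_increment u g1 g2 h : has_H_gradient u g1 g2 ->
  spaceH (rotation_increment u h).
Proof.
move=> uH; have uR := has_H_gradient_rotate (cos2Dsin2 h) uH.
by have [] := has_H_gradient_spaceH (has_H_gradientB uR uH).
Qed.

Lemma innerH_rotation_increment p lam u h : 2 < p -> weak_solution p lam u ->
  let w := rotation_increment u h in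
  innerH lam w w = \int[mu]_x ((nonlin p (u (rotation h x)) - nonlin p (u x)) * w x).
Proof.
move=> p2 Hu w; have [uS Hu'] := Hu; have uH := spaceH_gradient uS.
have f2 := has_H_gradient_nonlin p2 uH.
have uR := has_H_gradient_rotate (cos2Dsin2 h) uH.
have wS : spaceH w := spaceH_rotation_increment h uH.
have wH := spaceH_gradient wS; have [w2 _ _ _ _] := wH.
have [_ HR] := weak_solution_rotate (cos2Dsin2 h) (L2_measurable f2) Hu.
have fR2 := L2_rotation h f2.
rewrite [LHS](innerHBl lam uR uH wH) (HR _ wS) (Hu' _ wS).
rewrite -(RintegralB measurableT (L2M_Rintegrable fR2 w2) (L2M_Rintegrable f2 w2)).
by apply: eq_Rintegral => x _; rewrite mulrBl.
Qed.

Lemma radial_rotation_increment u (N0 : nat) : spaceH u ->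
  (forall N, (N0 < N)%N -> sqnorm (rotation_increment u (2 * pi / N%:R)) = 0) -> radial u.
Proof.
move=> uS H; have uH := spaceH_gradient uS; have [u2 _ _ _ _] := uH.
apply: radial_rotation_invariant; first exact: L2_measurable.
apply: (rotation_invariant_frac (N0 := N0) uH) => N N1.
have w2 : L2 (rotation_increment u (2 * pi / N%:R)) by apply: L2B => //; exact: L2_rotation.
by apply: ae2S (sqnorm_eq0 w2 (H N N1)) => x /eqP; rewrite subr_eq0 => /eqP.
Qed.

Lemma wirtinger_rotation_increment u g1 g2 (r : R) : 0 <= r -> r < 1 -> has_H_gradient u g1 g2 ->
  exists N0 : nat, forall N, (N0 < N)%N -> let w := rotation_increment u (2 * pi / N%:R) in
  forall h1 h2 : R * R -> R, has_H_gradient w h1 h2 ->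
  r * sqnorm w <= sqnorm (fun x => x.1 * h2 x - x.2 * h1 x).
Proof.
move=> r0 r1 uH; have [N0 H] := chord_lower_bound r0 r1; exists N0 => N N1 w h1 h2 wH.
have N0' : (0 < N)%N := leq_ltn_trans (leq0n _) N1.
have := angular_wirtinger N0' uH wH; have /= := H N N1; set h := 2 * pi / N%:R => rh Wh.
have h0 : 0 < h ^+ 2 by rewrite exprn_gt0// /h !mulr_gt0 ?invr_gt0 ?pi_gt0 ?ltr0n.
rewrite -(ler_pM2l h0); apply: le_trans Wh; rewrite mulrA mulrC [_ * r]mulrC mulrC.
by rewrite ler_wpM2r ?sqnorm_ge0.
Qed.

Lemma radial_bounded p lam (M : R) u : 2 < p -> 0 < lam -> weak_solution p lam u ->
  {ae mu, forall x, `|u x| <= M} -> lam ^+ 2 * ((p - 1) * M `^ (p - 2)) < 1 -> radial u.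
Proof.
move=> p2 lam0 Hu uM; set K := (p - 1) * _ => lamK.
have K0 : 0 <= K by rewrite mulr_ge0 ?powR_ge0//; move: p2; lra.
have l2 : 0 < lam ^+ 2 by rewrite exprn_gt0.
(* The midpoint between lam^2 K and 1: the loss allowed in the Wirtinger inequality still leaves
   lam^2 K < r, which forces the increment to vanish. *)
pose r := (1 + lam ^+ 2 * K) / 2.
have lK0 : 0 <= lam ^+ 2 * K by rewrite mulr_ge0// ltW.
have r0 : 0 <= r by rewrite /r; lra.
have r1 : r < 1 by rewrite /r; lra.
have rK : lam ^+ 2 * K < r by rewrite /r; lra.
have [uS _] := Hu; have uH := spaceH_gradient uS.
have [N0 HN] := wirtinger_rotation_increment r0 r1 uH.
apply: (radial_rotation_increment (N0 := N0) uS) => N /HN.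
set h := 2 * pi / N%:R; set w := rotation_increment u h => /= W.
have wS : spaceH w := spaceH_rotation_increment h uH.
have wH := spaceH_gradient wS; have [w2 _ _ _ _] := wH.
have := W _ _ wH; set S := sqnorm (fun x => x.1 * _ - _) => {}W.
have f2 := has_H_gradient_nonlin p2 uH; have fR2 := L2_rotation h f2.
have D1 : innerH lam w w <= K * sqnorm w.
  rewrite (innerH_rotation_increment h p2 Hu) -(RintegralZl _ measurableT (L2M_Rintegrable w2 w2)).
  apply: ae_le_Rintegral.
  - exact: (L2M_Rintegrable (L2B fR2 f2) w2).
  - exact: integrable_EFinZl (L2M_Rintegrable w2 w2).
  - have uMR := ae_measure_preserving (measure_preserving_rotation h) uM.
    apply: ae2S (ae2I uM uMR) => x [ux uRx].
    apply: le_trans (ler_norm _) _; rewrite normrM.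
    have -> : K * (w x * w x) = (K * `|w x|) * `|w x|.
      by rewrite -mulrA -normrM ger0_norm// -expr2 sqr_ge0.
    by rewrite ler_wpM2r//; exact: (nonlin_lipschitz p2).
have D2 : (lam ^+ 2)^-1 * S <= innerH lam w w.
  rewrite (innerH_sqnorm lam wH) -/S -addrA [_ + (_ * S + _)]addrCA lerDl.
  by rewrite !addr_ge0 ?sqnorm_ge0.
have : r * sqnorm w <= lam ^+ 2 * (K * sqnorm w).
  apply: le_trans W _; rewrite -ler_pdivrMl//; exact: le_trans D2 D1.
rewrite mulrA -subr_ge0 -mulrBl => H.
apply/eqP; rewrite eq_le sqnorm_ge0 andbT -(nmulr_rge0 _ (_ : lam ^+ 2 * K - r < 0))//.
by rewrite subr_lt0.
Qed.

End rotation_increment.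

(** * Radiality for small lam under an energy bound *)

Section small_energy.
Context {R : realType}.
Let R1 : measurableType _ := measurableTypeR R.
Let T : measurableType _ := (R1 * R1)%type.
Local Notation mu := (leb2 R).
Implicit Types (u w : R * R -> R) (lam p c : R).

(** Testing the equation with u itself identifies the integral of |u|^p with <u, u>. For p > 2 the
    factor is positive, so an energy bound is a norm bound. *)
Lemma energy_weak_solution p lam u : 2 < p -> weak_solution p lam u ->
  energy p lam u = (2^-1 - p^-1) * innerH lam u u.
Proof.
move=> p2 [uS Hu]; rewrite /energy mulrBl; congr (_ * _ - _ * _).
  apply: eq_Rintegral => x _.
  by rewrite !real_normK ?num_real// !expr2.
by rewrite (Hu _ uS); apply: eq_Rintegral => x _; rewrite -nonlin_mul.
Qed.

Lemma le_sum4 (a b c d : R) : 0 <= a -> 0 <= b -> 0 <= c -> 0 <= d ->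
  let s := a + b + c + d in [/\ a <= s, b <= s, c <= s & d <= s].
Proof. by move=> a0 b0 c0 d0 /=; split; lra. Qed.

(* Writing D = <w,w> for an increment w, D <= (p-1) (4 lam^2 + 8 K lam) D, where
   the coefficient 8 K lam comes from Cauchy-Schwarz applied to |u|^m |w|^2
   together with the fourth moment bound int |w|^4 <= 4 |w|^2 D <= (4 lam D)^2. *)
Lemma radial_small_inner p (B : R) : 2 < p -> 0 <= B ->
  exists2 l : R, 0 < l & forall lam u, 0 < lam -> lam < l -> weak_solution p lam u ->
    innerH lam u u <= B -> radial u.
Proof.
move=> p2 B0; pose m := (growth_exponent p).+1; pose K := m`!%:R * Num.sqrt (B ^+ m).
have K0 : 0 <= K by rewrite mulr_ge0 ?sqrtr_ge0.
(* Twice the coefficient of lam D in the final estimate, so that lam < 1 / q gives D <= D / 2. The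
   other restriction, lam < 1, allows lam^2 to be replaced by lam. *)
pose q := 2 * ((p - 1) * (4 + 8 * K)).
have p1 : 0 < p - 1 by move: p2; lra.
have K4 : 0 < 4 + 8 * K by lra.
have q0 : 0 < q by rewrite !mulr_gt0.
exists (Num.min 1 q^-1); first by rewrite lt_min ltr01 invr_gt0.
move=> lam u lam0; rewrite lt_min => /andP[lam1 lamq] Hu uB.
have l2 : 0 < lam ^+ 2 by rewrite exprn_gt0.
have [uS _] := Hu; have uH := spaceH_gradient uS.
have [u2 _ _ _ _] := uH.
(* A fixed Wirtinger constant is enough here, since smallness comes from lam; 1/4 yields |w|^2 <= 4
   lam^2 D. *)
have r0 : 0 <= 4^-1 :> R by rewrite invr_ge0.
have r1 : 4^-1 < 1 :> R by rewrite invf_lt1// ltr1n.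
have [N0 HN] := wirtinger_rotation_increment r0 r1 uH.
apply: (radial_rotation_increment (N0 := N0) uS) => N /HN.
set h := 2 * pi / N%:R; set w := rotation_increment u h => /= W.
have wS : spaceH w := spaceH_rotation_increment h uH.
have wH := spaceH_gradient wS; have [w2 _ _ [k12 k22] _] := wH.
have := W _ _ wH; set S := sqnorm (fun x => x.1 * _ - _) => {}W.
set k1 := weak_partial _ w in wH k12 *; set k2 := weak_partial _ w in wH k22 *.
have S0 : 0 <= S by exact: sqnorm_ge0.
have [D Dw] : exists D, D = innerH lam w w by eexists.
have DE : D = sqnorm k1 + sqnorm k2 + (lam ^+ 2)^-1 * S + sqnorm w.
  by rewrite Dw (innerH_sqnorm lam wH).
have [s1 s2 sw] : [/\ 0 <= sqnorm k1, 0 <= sqnorm k2 & 0 <= sqnorm w] by split; exact: sqnorm_ge0.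
have sS : 0 <= (lam ^+ 2)^-1 * S by rewrite mulr_ge0// invr_ge0 ltW.
have := le_sum4 s1 s2 sS sw; rewrite /= -DE => -[k1D k2D SD wD].
have D0 := le_trans sw wD.
have wl : sqnorm w <= 4 * lam ^+ 2 * D.
  have SD' : S <= lam ^+ 2 * D by rewrite -ler_pdivrMl.
  by rewrite -mulrA -ler_pdivrMl//; exact: le_trans W SD'.
have Su : 0 <= (lam ^+ 2)^-1 * sqnorm (fun x => x.1 * weak_partial e2 u x - x.2 * weak_partial e1 u x).
  by apply: mulr_ge0; [rewrite invr_ge0 ltW|exact: sqnorm_ge0].
have := le_sum4 (sqnorm_ge0 (weak_partial e1 u)) (sqnorm_ge0 (weak_partial e2 u)) Su (sqnorm_ge0 u).
rewrite /= -(innerH_sqnorm lam uH) => -[uk1 uk2 _ uk].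
have [um2 umB] := moment_bound (growth_exponent p) uH (le_trans uk uB) (le_trans uk1 uB) (le_trans uk2 uB).
rewrite -/m in um2 umB.
have w12 : L2 (fun x => `|w x| ^+ 1) by exact: L2_norm.
have [ww2 wwD] := L2_power_step wH w12.
have {}wwD : sqnorm (fun x => `|w x| ^+ 2) <= (4 * lam * D) ^+ 2.
  apply: le_trans wwD _; rewrite (sqnorm_norm w).
  have -> : (4 * lam * D) ^+ 2 = 2 ^+ 2 * ((4 * lam ^+ 2 * D) * D) by ring.
  rewrite ler_wpM2l ?sqr_ge0//; apply: ler_pM => //.
  rewrite -[leRHS](sqr_sqrtr D0) expr2.
  exact: ler_pM (sqrtr_ge0 _) (sqrtr_ge0 _) (ler_wsqrtr k1D) (ler_wsqrtr k2D).
have CS (v : R * R -> R) : L2 v -> sqnorm v <= m`!%:R ^+ 2 * B ^+ m ->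
    \int[mu]_x (v x * `|w x| ^+ 2) <= K * (4 * lam * D).
  move=> v2 vB; apply: le_trans (cauchy_schwarz v2 ww2) _.
  apply: ler_pM; rewrite ?sqrtr_ge0//.
    by apply: le_trans (ler_wsqrtr vB) _; rewrite sqrtrM ?sqr_ge0// sqrtr_sqr ger0_norm.
  apply: le_trans (ler_wsqrtr wwD) _; rewrite sqrtr_sqr ger0_norm//.
  by rewrite !mulr_ge0// ltW.
have f2 := has_H_gradient_nonlin p2 uH; have fR2 := L2_rotation h f2.
pose v x := `|u x| ^+ m; pose vR := v \o rotation h.
have vR2 : L2 vR := L2_rotation h um2.
have vRB : sqnorm vR <= m`!%:R ^+ 2 * B ^+ m.
  by rewrite (sqnorm_preserving (measure_preserving_rotation h) um2).
have I1 := L2M_Rintegrable w2 w2; have I2 := L2M_Rintegrable vR2 ww2.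
have I3 := L2M_Rintegrable um2 ww2.
have I12 : mu.-integrable setT (EFin \o (fun x => w x * w x + vR x * `|w x| ^+ 2)).
  exact: (@integrableD _ _ _ mu setT measurableT _ _ I1 I2).
have I123 : mu.-integrable setT (EFin \o (fun x => w x * w x + vR x * `|w x| ^+ 2 + v x * `|w x| ^+ 2)).
  exact: (@integrableD _ _ _ mu setT measurableT _ _ I12 I3).
have DB : D <= (p - 1) * (sqnorm w + K * (4 * lam * D) + K * (4 * lam * D)).
  rewrite [leLHS]Dw [leLHS](innerH_rotation_increment h p2 Hu).
  apply: (@le_trans _ _ (\int[mu]_x ((p - 1) *
      (w x * w x + vR x * `|w x| ^+ 2 + v x * `|w x| ^+ 2)))).
    apply: ae_le_Rintegral.
    - exact: (L2M_Rintegrable (L2B fR2 f2) w2).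
    - exact: integrable_EFinZl I123.
    (* The local Lipschitz constant splits into 1 and one m-th power for each of u \o R and u; the
       two powers have the same moment bound, as R preserves measure. *)
    - apply: aeW => x; apply: le_trans (nonlin_growth p2 _ _ (growth_exponentP p2)) _.
      rewrite -mulrA ler_wpM2l ?(ltW p1)// real_normK ?num_real//.
      rewrite le_eqVlt; apply/orP; left; apply/eqP; rewrite /vR /v /w /rotation_increment /=; ring.
  rewrite (RintegralZl _ measurableT I123) (RintegralD measurableT I12 I3) (RintegralD measurableT I1 I2).
  rewrite ler_wpM2l ?(ltW p1)//; apply: lerD; last exact: (CS v um2 umB).
  by apply: lerD; [exact: lexx|exact: (CS vR vR2 vRB)].
have lD : 0 <= lam * D by rewrite mulr_ge0// ltW.
have Dq : D <= (p - 1) * (4 + 8 * K) * (lam * D).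
  apply: le_trans DB _; rewrite -[leRHS]mulrA ler_wpM2l ?(ltW p1)//.
  have : sqnorm w <= 4 * (lam * D).
    apply: le_trans wl _; rewrite -mulrA ler_wpM2l// expr2 -mulrA.
    by rewrite ler_piMl// ltW.
  have -> : K * (4 * lam * D) = 4 * (K * (lam * D)) by ring.
  have -> : (4 + 8 * K) * (lam * D) = 4 * (lam * D) + 8 * (K * (lam * D)) by ring.
  by move: (lam * D) (K * (lam * D)) (sqnorm w) => a b d; clear; lra.
have ql : (p - 1) * (4 + 8 * K) * lam <= 2^-1.
  have lq : lam * q <= 1 by rewrite -ler_pdivlMr// mul1r ltW.
  rewrite -[leRHS]mul1r ler_pdivlMr//.
  by have -> : (p - 1) * (4 + 8 * K) * lam * 2 = lam * q by rewrite /q; ring.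
have : D <= 2^-1 * D.
  by apply: le_trans Dq _; rewrite mulrA ler_wpM2r.
move=> DD; apply/eqP; rewrite eq_le sw andbT; apply: le_trans wD _; move: DD; clear; lra.
Qed.

End small_energy.

(** Translates the hypothesis of (i) from extended reals to reals. An infinite norm makes the
    right-hand side 0, which a positive lam excludes. *)
Lemma bound_of_Linfty (R : realType) (p lam : R) (M : \bar R) : 2 < p -> 0 < lam -> (0 <= M)%E ->
  (lam%:E < (((p - 1)%:E * M `^ (p - 2))^-1) `^ 2^-1)%E ->
  M \is a fin_num /\ lam ^+ 2 * ((p - 1) * fine M `^ (p - 2)) < 1.
Proof.
move=> p2 lam0; have p1 : 0 < p - 1 by move: p2; lra.
have q0 : p - 2 != 0 by rewrite gt_eqF// subr_gt0.
case: M => [r| |]//; last first.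
  move=> _; rewrite poweRyr//; have -> : ((p - 1)%:E * +oo = +oo :> \bar R)%E by rewrite gt0_muley// lte_fin.
  by rewrite invey poweR0r ?invr_eq0// lte_fin ltNge ltW.
move=> r0; rewrite poweR_EFin -EFinM /=; set k := (p - 1) * _ => H; split => //.
have k0 : 0 <= k by rewrite mulr_ge0 ?powR_ge0// ltW.
(* For k = 0 the inverse is +oo and the hypothesis is void, but the conclusion reads 0 < 1. *)
have [k00|kN] := eqVneq k 0; first by rewrite k00 mulr0.
have kp : 0 < k by rewrite lt_neqAle eq_sym kN.
move: H; rewrite inver (negbTE kN) poweR_EFin lte_fin powR12_sqrt ?invr_ge0// => H.
rewrite -ltr_pdivlMr// mul1r -(sqr_sqrtr (_ : 0 <= k^-1)) ?invr_ge0//.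
by rewrite ltrXn2r// ?nnegrE ?sqrtr_ge0// ltW.
Qed.

(* The bound in the first part is computed in \bar R (with 1 / +oo = 0). *)
Theorem theorem1p3 (R : realType) (p : R) (hp : 2 < p) :
  (forall (lam : R) (u : R * R -> R),
      0 < lam -> weak_solution p lam u -> nontrivial u ->
      (lam%:E < (((p - 1)%:E * Linfty_norm u `^ (p - 2))^-1) `^ 2^-1)%E ->
      radial u)
  /\
  (forall c : R, 0 < c ->
      exists2 lamc : R, 0 < lamc &
        forall (lam : R) (u : R * R -> R),
          0 < lam -> lam < lamc -> weak_solution p lam u ->
          energy p lam u <= c -> radial u).
Proof.
split=> [lam u lam0 Hu _ /bound_of_Linfty H|c c0].
  have {H} [Mfin HM] : Linfty_norm u \is a fin_num /\
      lam ^+ 2 * ((p - 1) * fine (Linfty_norm u) `^ (p - 2)) < 1.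
    by apply: H => //; exact: Lnorm_ge0.
  apply: (radial_bounded hp lam0 Hu _ HM); apply: ae2S (Linfty_norm_ae u) => x.
  by rewrite -{1}(fineK Mfin) lee_fin.
have p0 : 0 < p by exact: lt_trans hp.
have k0 : 0 < 2^-1 - p^-1 by rewrite subr_gt0 ltf_pV2 ?posrE.
(* By [energy_weak_solution], energy at most c means <u, u> at most c / (1/2 - 1/p), a bound
   independent of lam. *)
have [l l0 Hl] := radial_small_inner hp (divr_ge0 (ltW c0) (ltW k0)).
exists l => // lam u lam0 laml Hu Ec; apply: (Hl lam u lam0 laml Hu).
by rewrite ler_pdivlMr// mulrC -(energy_weak_solution hp Hu).
Qed.
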